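(* Let $p\ge5$ be a prime. There does not exist a hyperbolic, irreducible $A\in\mathrm{GL}_p(\mathbb{Z})$ so that $\mathbb{Z}^p\rtimes_A\mathbb{Z}$ is arithmetic.
   Context: A matrix $A\in\mathrm{GL}_p(\mathbb{Z})$ is hyperbolic if it has no (complex) eigenvalues on the unit circle, and irreducible if its characteristic polynomial is irreducible over $\mathbb{Q}$. The group $\mathbb{Z}^p\rtimes_A\mathbb{Z}$ is the set $\mathbb{Z}^p\times\mathbb{Z}$ with multiplication $(x,i)(y,j)=(x+A^iy,\,i+j)$. A group $\Gamma$ is arithmetic if it embeds in a (linear) algebraic group $G$ defined over $\mathbb{Q}$ with image commensurable to $G(\mathbb{Z})$ (image in $G(\mathbb{Q})$ whose intersection with $G(\mathbb{Z})$ has finite index in both). *)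

(* Defs.v *)
From HB Require Import structures.
From mathcomp Require Import all_boot all_order all_algebra.
From mathcomp Require Import mpoly complex.
From mathcomp Require Import classical_sets cardinality reals.

Set Implicit Arguments.
Unset Strict Implicit.
Unset Printing Implicit Defensive.

Import Order.TTheory GRing.Theory Num.Theory.

Local Open Scope classical_set_scope.
Local Open Scope ring_scope.

(* MathComp's {'GL_n[R]} requires R to be finite. *)
Record GL (R : comUnitRingType) (n : nat) := MkGL {
  GLval :> 'M[R]_n;
  GLvalP : GLval \in unitmx
}.
Arguments MkGL {R n}.

HB.instance Definition _ R n := [isSub for @GLval R n].
HB.instance Definition _ R n := [Choice of GL R n by <:].

Section GLGroup.
Variables (R : comUnitRingType) (n : nat).
Implicit Types g h : GL R n.

Lemma GL1_subproof : (1%:M : 'M[R]_n) \in unitmx.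
Proof. exact: unitmx1. Qed.

Lemma GLM_subproof g h : (g : 'M[R]_n) *m h \in unitmx.
Proof. by rewrite unitmx_mul !GLvalP. Qed.

Lemma GLV_subproof g : invmx g \in unitmx.
Proof. by rewrite unitmx_inv GLvalP. Qed.

Definition GL1 : GL R n := MkGL 1%:M GL1_subproof.
Definition GLM g h : GL R n := MkGL (g *m h) (GLM_subproof g h).
Definition GLV g : GL R n := MkGL (invmx g) (GLV_subproof g).

Lemma GLMA : associative GLM.
Proof. by move=> f g h; apply: val_inj; rewrite /= mulmxA. Qed.
Lemma GL1M : left_id GL1 GLM.
Proof. by move=> g; apply: val_inj; rewrite /= mul1mx. Qed.
Lemma GLM1 : right_id GL1 GLM.
Proof. by move=> g; apply: val_inj; rewrite /= mulmx1. Qed.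
Lemma GLVM : left_inverse GL1 GLV GLM.
Proof. by move=> g; apply: val_inj; rewrite /= mulVmx ?GLvalP. Qed.
Lemma GLMV : right_inverse GL1 GLV GLM.
Proof. by move=> g; apply: val_inj; rewrite /= mulmxV ?GLvalP. Qed.

HB.instance Definition _ := isGroup.Build (GL R n) GLMA GL1M GLM1 GLVM GLMV.

End GLGroup.

Lemma GLmap_subproof (R S : comUnitRingType) (f : {rmorphism R -> S}) n
  (g : GL R n) : map_mx f g \in unitmx.
Proof. by rewrite unitmxE det_map_mx rmorph_unit // -unitmxE GLvalP. Qed.

Definition GLmap (R S : comUnitRingType) (f : {rmorphism R -> S}) n
  (g : GL R n) : GL S n := MkGL (map_mx f g) (GLmap_subproof f g).
Arguments GLmap {R S} f {n} g.

Definition expgz (G : groupType) (g : G) (i : int) : G :=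
  match i with
  | Posz m => (g ^+ m)%g
  | Negz m => (g ^- m.+1)%g
  end.

Lemma expgz_natB (G : groupType) (g : G) m n :
  expgz g (m%:Z - n%:Z) = (g ^+ m * g ^- n)%g.
Proof.
case: (leqP n m) => [le_nm|/ltnW le_mn].
  by rewrite subzn //= -[in RHS](subnK le_nm) expgnDr mulgK.
have -> : m%:Z - n%:Z = - (n - m)%N%:Z by rewrite -subzn // opprB.
have -> k : expgz g (- k%:Z) = (g ^- k)%g.
  by case: k => [|k]; rewrite ?oppr0 /= ?expg0 ?invg1 // -NegzE.
by rewrite -[in RHS](subnK le_mn) expgnDr invgM mulgA mulgV mul1g.
Qed.

Lemma expgzD (G : groupType) (g : G) i j :
  expgz g (i + j) = (expgz g i * expgz g j)%g.
Proof.
have E (k : int) : exists m n : nat, k = m%:Z - n%:Z.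
  case: k => m; first by exists m, 0%N; rewrite subr0.
  by exists 0%N, m.+1; rewrite NegzE sub0r.
have [m [n ->]] := E i; have [m' [n' ->]] := E j.
have -> : m%:Z - n%:Z + (m'%:Z - n'%:Z) = (m + m')%N%:Z - (n' + n)%N%:Z.
  by rewrite !PoszD addrACA opprD [- n'%:Z - _]addrC.
rewrite !expgz_natB !expgnDr invgM -!mulgA; congr (_ * _)%g.
rewrite !mulgA; congr (_ * _)%g.
by apply: commuteV; apply: commuteX2.
Qed.

(* The group Z^p \rtimes_A Z, whose product is (x, i) (y, j) = (x + A^i y, i + j);
   elements of Z^p are column vectors. *)
Definition sdprodZ (p : nat) (A : GL int p) : Type := ('cV[int]_p * int)%type.

Section SdprodZ.
Variables (p : nat) (A : GL int p).
Implicit Types u v w : sdprodZ A.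

HB.instance Definition _ := Choice.copy (sdprodZ A) ('cV[int]_p * int)%type.

Definition sdprodZ1 : sdprodZ A := (0, 0).
Definition sdprodZM u v : sdprodZ A :=
  (u.1 + (expgz A u.2 : GL int p) *m v.1, u.2 + v.2).
Definition sdprodZV u : sdprodZ A :=
  (- ((expgz A (- u.2) : GL int p) *m u.1), - u.2).

Let expAD i j : (expgz A (i + j) : 'M_p) = expgz A i *m expgz A j.
Proof. by rewrite expgzD. Qed.

Let expA0 : (expgz A 0 : 'M_p) = 1%:M.
Proof. by []. Qed.

Lemma sdprodZMA : associative sdprodZM.
Proof.
by move=> u v w; rewrite /sdprodZM /= expAD mulmxDr mulmxA !addrA.
Qed.
Lemma sdprodZ1M : left_id sdprodZ1 sdprodZM.
Proof. by case=> x i; rewrite /sdprodZM /= mul1mx !add0r. Qed.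
Lemma sdprodZM1 : right_id sdprodZ1 sdprodZM.
Proof. by case=> x i; rewrite /sdprodZM /= mulmx0 !addr0. Qed.
Lemma sdprodZVM : left_inverse sdprodZ1 sdprodZV sdprodZM.
Proof. by move=> u; rewrite /sdprodZM /= !addNr. Qed.
Lemma sdprodZMV : right_inverse sdprodZ1 sdprodZV sdprodZM.
Proof.
by move=> u; rewrite /sdprodZM /= mulmxN mulmxA -expAD !subrr expA0 mul1mx subrr.
Qed.

HB.instance Definition _ :=
  isGroup.Build (sdprodZ A) sdprodZMA sdprodZ1M sdprodZM1 sdprodZVM sdprodZMV.

End SdprodZ.

Definition hyperbolic (R : realType) (p : nat) (A : GL int p) : Prop :=
  forall z : R[i], eigenvalue (map_mx intr A) z -> `|z| <> 1.

Definition irreducible_GLZ (p : nat) (A : GL int p) : Prop :=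
  irreducible_poly (map_poly intr (char_poly A) : {poly rat}).

Definition is_subgroup (G : groupType) (H : set G) : Prop :=
  [/\ H 1%g, forall x y, H x -> H y -> H (x * y)%g & forall x, H x -> H x^-1%g].

(* H is meant to be a subgroup of K: the set of left cosets xH, x in K, is
   finite. *)
Definition finite_index (G : groupType) (H K : set G) : Prop :=
  finite_set [set [set (x * h)%g | h in H] | x in K].

Definition commensurable (G : groupType) (H K : set G) : Prop :=
  finite_index (H `&` K) H /\ finite_index (H `&` K) K.

Definition zero_locus (R : realType) (n : nat) (I : set {mpoly rat[n * n]}) :
    set (GL R[i] n) :=
  [set g | forall f, I f ->
     (map_mpoly ratr f).@[fun k => mxvec (g : 'M[R[i]]_n) 0 k] = 0].

(* A linear algebraic group over Q, given by its complex points: a subgroup of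
   GL_n(C) cut out by polynomials with rational coefficients in the n^2 matrix
   entries.  No coordinate 1/det is needed, since det is invertible on GL_n.
   As Q is perfect, being the zero set of rational polynomials is the same as
   being closed and defined over Q. *)
Definition algebraic_Qgroup (R : realType) (n : nat) (G : set (GL R[i] n)) :
    Prop :=
  is_subgroup G /\ exists I : set {mpoly rat[n * n]}, G = zero_locus I.

Definition Qpoints (R : realType) (n : nat) (G : set (GL R[i] n)) :
    set (GL rat n) :=
  [set g | G (GLmap ratr g)].

(* G(Z) = G \cap GL_n(Z), as a subset of GL_n(Q) *)
Definition Zpoints (R : realType) (n : nat) (G : set (GL R[i] n)) :
    set (GL rat n) :=
  Qpoints G `&` range (GLmap intr : GL int n -> GL rat n).

(* The embedding of Gam in G has image in G(Q), hence takes values in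
   GL_n(Q). *)
Definition arithmetic (R : realType) (Gam : groupType) : Prop :=
  exists (n : nat) (G : set (GL R[i] n)) (phi : {multiplicative Gam -> GL rat n}),
    [/\ algebraic_Qgroup G,
        injective phi,
        range phi `<=` Qpoints G
      & commensurable (range phi) (Zpoints G)].

(* Main.v *)
Require Import Defs.
From HB Require Import structures.
From mathcomp Require Import all_boot all_order all_algebra all_fingroup all_solvable all_field.
From mathcomp Require Import spectral mpoly complex ring zify.
From mathcomp Require Import boolp classical_sets cardinality reals.
From Stdlib Require Import Classical.

(** Suppose that the group is arithmetic, embedded in the rational algebraic group
    G by phi. Let lam be an eigenvalue of A; it has degree p, and no positive
    power of lam is 1 because A is hyperbolic. Put s = phi (0, 1). The
    contradiction is an element of G(Z) that acts on a suitable vector by a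
    unit u of Q(lam) no positive power of which is a power of lam, while every
    phi (x, i) acts on it by lam ^ i.

    The unit. As p >= 5, the field Q(lam) has at least three archimedean
    places. Minkowski's pigeonhole argument (exists_small_values,
    exists_small_norm) and a second pigeonhole on elements of bounded norm
    give, for each place, a unit of norm 1 that is large there and small at
    all the other places (exists_unit_small_outside). For the units attached
    to two of the places, it is impossible that both have a positive power
    which is a power of lam: the signs of the logarithms at three places would
    be incompatible (exists_independent_unit).

    The vector. The matrices phi (x, 0) commute and s permutes the finitely
    many characters that they afford, so that a subgroup of finite index of
    Z^p is mapped to unipotent matrices (unipotent_translation). The logarithm
    turns this subgroup into a lattice of matrices on which conjugation by phi
    (x, i) is A ^ i; hence, after extension of scalars, an eigenvector of A
    gives a nonzero matrix v with phi (x, i) * v = lam ^ i *: (v * phi (x, i))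
    (log_eigenvector). In particular lam is a quotient of two eigenvalues of s
    (eigenvector_ratio).

    The torus element. As p is prime, the Galois group contains a p-cycle on
    the roots, and irreducibility of the p-th cyclotomic polynomial shows that
    the only multiplicative relations between the conjugates of lam are the
    powers of the norm (roots_independent). Therefore an integral character of
    the group that they generate may be prescribed on the conjugates up to one
    linear condition, and it extends, up to a factor, to the group generated
    by the eigenvalues of s (extend_character). Twisting the conjugates of u
    by the Galois translates of such a character gives a map T from the
    eigenvalues of s to units which is Galois equivariant, preserves every
    multiplicative relation, and satisfies T a = u ^+ M * T b whenever a = lam
    * b (galois_torus_element). Let t be the semisimple matrix that acts by T
    z on the generalised eigenspace of s for z. It is rational because T is
    equivariant, and it lies in the Zariski closure of the powers of s, hence
    in G, because T preserves the relations (zariski_closure_powers). Some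
    power of t is integral, with an integral inverse, because the values of T
    are units (integral_power). By construction, t * v = u ^+ M *: (v * t).

    So a power of t is in G(Z), and finite index puts a further power in the
    image of phi (finite_index_expg). If t ^+ m = phi (x, i) with m > 0,
    comparing the two actions on v gives u ^+ (M * m) = lam ^ i, which
    contradicts the choice of u. *)

Set Implicit Arguments.
Unset Strict Implicit.
Unset Printing Implicit Defensive.

Import Order.TTheory GRing.Theory Num.Theory.

Local Open Scope ring_scope.

(** * Splitting fields of rational polynomials *)

Lemma perm_map_stable (T : eqType) (g : T -> T) (s : seq T) : injective g ->
  uniq s -> (forall x, x \in s -> g x \in s) -> perm_eq (map g s) s.
Proof.
move=> g_inj uniq_s gs; have uniq_gs : uniq (map g s) by rewrite map_inj_uniq.
have sub_gs : {subset map g s <= s} by move=> _ /mapP[x x_s ->]; apply: gs.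
have [|_ eq_g] := uniq_min_size uniq_gs sub_gs; first by rewrite size_map.
exact: uniq_perm.
Qed.

Lemma nat_pigeonhole (T : finType) (f : nat -> T) :
  exists i j : nat, [/\ (i < j)%N, (j <= #|T|)%N & f i = f j].
Proof.
have /injectivePn[i [j ne_ij eq_ij]] : ~~ injectiveb (fun i : 'I_#|T|.+1 => f i).
  by apply/negP => /injectiveP/leq_card; rewrite card_ord ltnn.
have [le_i le_j] := (ltn_ord i, ltn_ord j).
have [lt|gt|/val_inj eq] := ltngtP i j; first by exists i, j.
  by exists j, i.
by rewrite eq eqxx in ne_ij.
Qed.

Lemma splitting_number_field (q : {poly rat}) : q \is monic ->
  exists (L : splittingFieldType rat) (iota : {rmorphism L -> algC})
    (rs : seq L),
  [/\ galois 1 {:L}, map_poly (in_alg L) q = \prod_(r <- rs) ('X - r%:P)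
    & <<1 & rs>>%VS = fullv].
Proof.
move=> mon_q.
have [ws Dq] := closed_field_poly_normal (map_poly (ratr : rat -> algC) q).
rewrite (monicP _) ?map_monic // scale1r in Dq.
have [L [LC [rs Drs genL]]] := num_field_exists ws.
have DqL : map_poly (in_alg L) q = \prod_(r <- rs) ('X - r%:P).
  apply: (map_poly_inj LC); rewrite -map_poly_comp /=.
  under eq_map_poly => x do rewrite /= alg_num_field fmorph_rat.
  rewrite Dq -Drs big_map rmorph_prod /=.
  by apply: eq_bigr => x _; rewrite rmorphB /= map_polyX map_polyC.
have Qq : map_poly (in_alg L) q \is a polyOver 1%AS.
  apply/polyOverP => i; rewrite coef_map /=.
  by rewrite rpredZ // mem1v.
have splitq : splittingFieldFor 1 (map_poly (in_alg L) q) {:L}.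
  by exists rs; rewrite ?DqL ?eqpxx.
have L_ax : FieldExt_isSplittingField _ L by constructor; exists (map_poly (in_alg L) q).
pose L' : splittingFieldType rat := HB.pack_for (splittingFieldType rat) L L_ax.
exists L', LC, rs; split=> //.
rewrite /galois sub1v normalFieldf andbT /=; apply/separableP => y _.
apply: pcharf0_separable => k; rewrite -(fmorph_pchar LC); exact: pchar_num.
Qed.

Section Galois.
Variables (L : splittingFieldType rat) (galL : galois 1 {:L}).

Lemma gal_fixed_rat (x : L) :
  (forall g : gal_of {:L}, g \in 'Gal({:L} / 1)%g -> g x = x) ->
  exists a : rat, x = a%:A.
Proof.
move=> fix_x; have : x \in fixedField 'Gal({:L} / 1)%g.
  by apply/fixedFieldP; rewrite ?memvf.
rewrite (galois_fixedField galL) => /vlineP[a ->].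
by exists a.
Qed.

Lemma irreducible_minPoly (q : {poly rat}) (x : L) : irreducible_poly q ->
  root (map_poly (in_alg L) q) x -> map_poly (in_alg L) q %= minPoly 1%AS x.
Proof.
move=> irr_q qx; have /polyOver1P[r Dr] := minPolyOver 1 x.
have := minPoly_dvdp (K := 1%AS) _ qx; rewrite Dr.
have -> : map_poly (in_alg L) q \is a polyOver 1%AS.
  by apply/polyOver1P; exists q.
move=> /(_ isT); rewrite dvdp_map => rq; rewrite eqp_map eqp_sym.
apply: irr_q.2 => //; rewrite -(size_map_poly (in_alg L)) -Dr.
by rewrite size_minPoly eqSS /adjoin_degree.
Qed.

Lemma gal_conjugate (q : {poly rat}) (x y : L) : irreducible_poly q ->
  root (map_poly (in_alg L) q) x -> root (map_poly (in_alg L) q) y ->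
  exists2 g : gal_of {:L}, g \in 'Gal({:L} / 1)%g & g x = y.
Proof.
move=> irr_q qx qy; apply: (normalField_root_minPoly (sub1v _) (normalFieldf _)).
  exact: memvf.
by rewrite -(eqp_root (irreducible_minPoly irr_q qx)).
Qed.

Lemma gal_root (q : {poly rat}) (g : gal_of {:L}) x :
  root (map_poly (in_alg L) q) (g x) = root (map_poly (in_alg L) q) x.
Proof.
rewrite -[in RHS](fmorph_root g) -map_poly_comp; congr root.
by apply: eq_map_poly => a /=; rewrite rmorph_alg.
Qed.
End Galois.

Lemma irreducible_roots_uniq (q : {poly rat}) (F : fieldType)
    (f : {rmorphism rat -> F}) (rs : seq F) : irreducible_poly q ->
  map_poly f q = \prod_(r <- rs) ('X - r%:P) -> uniq rs.
Proof.
move=> irr_q Dq; rewrite -separable_prod_XsubC -Dq separable_map.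
have [sz_q _] := irr_q; have nz_q : q != 0 by rewrite -size_poly_gt0 ltnW.
rewrite unlock irreducible_poly_coprime //.
apply/negP => /dvdp_leq; rewrite leqNgt lt_size_deriv // => /implyP.
rewrite implybF negbK => /eqP/polyP/(_ (size q).-2)/eqP; apply/negP.
rewrite coefE coef0 -mulr_natr mulf_neq0 ?pnatr_eq0 //.
have := nz_q; rewrite -lead_coef_eq0 lead_coefE.
by case: (size q) sz_q => [|[|m]].
Qed.

(** * Multiplicative relations between the roots *)

(** The sum is the p-th cyclotomic polynomial, that is, the minimal polynomial
    of a primitive p-th root of unity: it is irreducible, and e has at most
    its degree. *)
Lemma coprimep_sum_Xn (p : nat) (e : {poly rat}) : prime p -> (size e <= p)%N ->
  coprimep e (\sum_(k < p) 'X^k) \/ exists c, e = c *: \sum_(k < p) 'X^k.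
Proof.
move=> p_pr sz_e; have p_gt0 := prime_gt0 p_pr.
have [z prim_z] := C_prim_root_exists p_gt0.
have [r [Dr mon_r] dv_r] := minCpolyP z.
set Phi : {poly rat} := \sum_(k < p) 'X^k.
have DPhi : Phi = \poly_(k < p) 1.
  by rewrite poly_def; apply: eq_bigr => k _; rewrite scale1r.
have sz_r : size r = p.
  rewrite -(size_map_poly (ratr : {rmorphism rat -> algC})) -Dr.
  by rewrite (minCpoly_cyclotomic prim_z) size_cyclotomic totient_prime // prednK.
have sz_Phi : size Phi = p.
  by rewrite DPhi size_poly_eq // oner_eq0.
have r_Phi : r %= Phi.
  rewrite -(dvdp_size_eqp _) ?sz_r ?sz_Phi // -dv_r.
  have : root (map_poly (ratr : rat -> algC) (('X - 1) * Phi)) z.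
    rewrite -subrX1 rmorphB /= map_polyXn rmorph1 rootE !hornerE.
    by rewrite prim_expr_order ?subrr.
  rewrite rmorphM rootM => /orP[|//]; rewrite rmorphB /= map_polyX rmorph1.
  rewrite rootE !hornerE subr_eq0 => /eqP z1.
  have := prim_order_dvd prim_z 1; rewrite expr1 z1 eqxx dvdn1 => /eqP p1.
  by rewrite p1 in p_pr.
have [->|nz_e] := eqVneq e 0; first by right; exists 0; rewrite scale0r.
have [ez|ez] := boolP (root (map_poly (ratr : rat -> algC) e) z).
  right; have /eqpP[[a b] /= /andP[nz_a nz_b] Dab] : e %= Phi.
    rewrite -(eqp_rtrans r_Phi) eqp_sym -(dvdp_size_eqp _) -?dv_r //.
    by rewrite eqn_leq sz_r sz_e -{1}sz_r dvdp_leq // -dv_r.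
  exists (a^-1 * b); rewrite -scalerA -Dab scalerA mulVf // scale1r //.
left; rewrite -(eqp_coprimepr _ r_Phi) coprimep_def.
have rz : root (map_poly (ratr : rat -> algC) r) z by rewrite dv_r.
have Er : r %/ gcdp e r * gcdp e r = r by rewrite divpK // dvdp_gcdr.
have nz_r : r != 0 by rewrite monic_neq0.
move: rz; rewrite -{1}Er rmorphM rootM => /orP[|rd]; last first.
  case/negP: ez; move: rd; rewrite !dv_r => /dvdp_trans; apply; exact: dvdp_gcdl.
rewrite dv_r => /dvdp_leq.
have := nz_r; rewrite -{1}Er mulf_eq0 negb_or => /andP[nz1 nz2] /(_ nz1).
have -> : size r = (size (r %/ gcdp e r) + size (gcdp e r)).-1.
  by rewrite -size_mul // Er.
have := nz1; have := nz2; rewrite -!size_poly_gt0 eqn_leq => -> /prednK <-.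
by rewrite addSn /= -[leqRHS]addn1 leq_add2l => ->.
Qed.

Section PrimeCycle.
Variables (L : splittingFieldType rat) (galL : galois 1 {:L}).
Variables (p : nat) (q : {poly rat}) (rs : seq L).
Hypotheses (p_pr : prime p) (irr_q : irreducible_poly q) (sz_q : size q = p.+1).
Hypotheses (Dq : map_poly (in_alg L) q = \prod_(r <- rs) ('X - r%:P)).
Hypothesis genL : <<1 & rs>>%VS = fullv.

(** The degree p of a root divides the order of the Galois group, which by
    Cauchy's theorem has an element of order p. It moves a root, since the
    roots generate L, and an orbit of prime length p exhausts the roots. *)
Lemma gal_prime_cycle :
  exists2 g : gal_of {:L}, (g ^+ p)%g = 1%g &
    exists2 r0, r0 \in rs & perm_eq rs [seq (g ^+ k)%g r0 | k <- iota 0 p].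
Proof.
have p_gt0 := prime_gt0 p_pr.
have sz_rs : size rs = p.
  by have := size_map_poly (in_alg L) q; rewrite Dq size_prod_XsubC sz_q => -[].
have uniq_rs : uniq rs := irreducible_roots_uniq irr_q Dq.
have root_rs x : root (map_poly (in_alg L) q) x = (x \in rs).
  by rewrite Dq root_prod_XsubC.
have p_dv : (p %| #|'Gal({:L} / 1)%g|)%N.
  rewrite -(galois_dim galL) dimv1 divn1.
  have r0P : rs`_0 \in rs by rewrite mem_nth // sz_rs.
  suff <- : \dim <<1; rs`_0>> = p by rewrite field_dimS ?subvf.
  have := r0P; rewrite -root_rs => /(irreducible_minPoly irr_q)/eqp_size;
  rewrite size_map_poly sz_q.
  by rewrite size_minPoly => -[->]; rewrite adjoin_degreeE dimv1 divn1.
have [g _ og] := Cauchy p_pr p_dv.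
exists g; first by rewrite -og expg_order.
have [r0 r0P gr0] : exists2 r0, r0 \in rs & g r0 != r0.
  apply/hasP; rewrite -[has _ _]negbK -all_predC; apply/negP => /allP fix_rs.
  suff g1 : g = 1%g by move: og p_pr; rewrite g1 order1 => <-.
  have : (<<1 & rs>> <= fixedField [set g])%VS.
    apply/Fadjoin_seqP; split; first exact: sub1v.
    move=> x /fix_rs /=; rewrite negbK => /eqP gx.
    by apply/fixedFieldP; rewrite ?memvf // => _ /set1P ->.
  rewrite genL => /subvP fixL; apply/eqP/gal_eqP => x _.
  have /fixedFieldP/(_ g (set11 g)) := fixL x (memvf x).
  by rewrite ?memvf // gal_id => ->.
exists r0 => //.
have gM k l x : (g ^+ (k + l))%g x = (g ^+ k)%g ((g ^+ l)%g x) :> L.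
  by rewrite addnC expgnDr galM ?memvf.
have orb_in k : (g ^+ k)%g r0 \in rs by rewrite -root_rs gal_root root_rs.
have uniq_orb : uniq [seq (g ^+ k)%g r0 | k <- iota 0 p].
  rewrite map_inj_in_uniq ?iota_uniq //.
  (* two coinciding points of the orbit give a power of g, prime to p, fixing r0 *)
  suff inj d i : (0 < d)%N -> (i + d < p)%N -> (g ^+ (i + d))%g r0 != (g ^+ i)%g r0.
    move=> i j; rewrite !mem_iota /= !add0n => lt_ip lt_jp /eqP.
    case: (ltngtP i j) => // lt_ij.
      rewrite eq_sym -(subnKC (ltnW lt_ij)) (negPf (inj _ _ _ _)) ?subn_gt0 //.
      by rewrite subnKC // ltnW.
    rewrite -(subnKC (ltnW lt_ij)) (negPf (inj _ _ _ _)) ?subn_gt0 //.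
    by rewrite subnKC // ltnW.
  move=> d_gt0 lt_dp; rewrite gM (inj_eq (fmorph_inj _)).
  apply: contra gr0 => /eqP gd.
  have gdk k : (g ^+ (k * d))%g r0 = r0.
    by elim: k => [|k IH]; rewrite ?mul0n ?expg0 ?gal_id // mulSn addnC gM gd IH.
  have [u v Duv _] := egcdnP p d_gt0.
  have co : gcdn d p = 1%N.
    apply/eqP; rewrite -/(coprime d p) coprime_sym prime_coprime //.
    by rewrite gtnNdvd // (leq_ltn_trans _ lt_dp) // leq_addl.
  rewrite co in Duv; have := gdk u; rewrite Duv gM expg1 mulnC expgM -og.
  by rewrite expg_order expg1n gal_id => ->.
have sub_orb : {subset [seq (g ^+ k)%g r0 | k <- iota 0 p] <= rs}.
  by move=> _ /mapP[k _ ->].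
have [|_ eq_orb] := uniq_min_size uniq_orb sub_orb.
  by rewrite size_map size_iota sz_rs.
by rewrite perm_sym; apply: uniq_perm.
Qed.
End PrimeCycle.

Lemma coprimep_int_Bezout (e f : {poly int}) :
  coprimep (map_poly intr e : {poly rat}) (map_poly intr f) ->
  exists u v : {poly int}, exists2 N : int, N != 0 & u * e + v * f = N%:P.
Proof.
move=> /Bezout_coprimepP[[u v] /=]; rewrite -size_poly_eq1 => /size_poly1P[c nz_c].
have [U [a nz_a ->]] := rat_poly_scale u; have [V [b nz_b ->]] := rat_poly_scale v.
have nzr (k : int) : k != 0 -> k%:~R != 0 :> rat by rewrite intr_eq0.
move/(congr1 (fun h => (a * b * denq c)%:~R *: h)) => H.
exists ((b * denq c) *: U), ((a * denq c) *: V), (a * b * numq c).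
  by rewrite !mulf_neq0 ?numq_eq0.
apply: (map_inj_poly (intr_inj : injective (intr : int -> rat))) => //.
rewrite rmorphD !rmorphM /= !map_polyZ !map_polyC /= !intrM numqE.
have -> : (a%:~R)%:P * (b%:~R)%:P * (c * (denq c)%:~R)%:P = (a * b * denq c)%:~R *: c%:P.
  by rewrite -mul_polyC -!polyCM !intrM; congr _%:P; ring.
rewrite -H !intrM.
rewrite scalerDr -!scalerAl !scalerA; congr (_ *: _ + _ *: _).
  by field; rewrite nzr.
by field; rewrite nzr.
Qed.

Section CyclicRelations.
Variables (F : fieldType) (g : {rmorphism F -> F}) (z : nat -> F).
Hypotheses (nz_z : forall k, z k != 0) (gz : forall k, g (z k) = z k.+1).

(** A relation with exponents e_k between the z k is recorded by the
    polynomial with coefficients e_k, so that g acts on relations as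
    multiplication by the variable. *)
Let ev (P : {poly int}) := \prod_(k < size P) z k ^ P`_k.

Let evE m (P : {poly int}) : (size P <= m)%N -> ev P = \prod_(k < m) z k ^ P`_k.
Proof.
move=> le_Pm; rewrite /ev (big_ord_widen m (fun k => z k ^ P`_k)) //.
rewrite [RHS](bigID (fun k : 'I_m => (k < size P)%N)) /= [X in _ * X]big1 ?mulr1 //.
by move=> k; rewrite -leqNgt => /leq_sizeP/(_ k (leqnn _)) ->.
Qed.

Let evD (P Q : {poly int}) : ev (P + Q) = ev P * ev Q.
Proof.
pose m := maxn (size P) (size Q).
rewrite !(@evE m) ?leq_maxl ?leq_maxr ?size_polyD // -big_split /=.
by apply: eq_bigr => k _; rewrite coefD expfzDr.
Qed.

Let evZ c (P : {poly int}) : ev (c *: P) = ev P ^ c.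
Proof.
rewrite (evE (size_scale_leq c P)) /ev.
rewrite (big_morph (fun x => x ^ c) (fun x y => expfzMl x y c) (exp1rz _ c)).
by apply: eq_bigr => k _; rewrite coefZ mulrC exprz_exp.
Qed.

Let evX (P : {poly int}) : ev ('X * P) = g (ev P).
Proof.
have le_sz : (size ('X * P)%R <= (size P).+1)%N.
  by rewrite (leq_trans (size_polyMleq _ _)) // size_polyX.
rewrite (evE le_sz) big_ord_recl coefXM /= mul1r rmorph_prod.
by apply: eq_bigr => k _; rewrite coefXM /= fmorphXz gz.
Qed.

Let ev_ideal (U P : {poly int}) : ev P = 1 -> ev (U * P) = 1.
Proof.
move=> P1; elim/poly_ind: U => [|U c IH].
  by rewrite mul0r /ev size_poly0 big_ord0.
by rewrite mulrDl -mulrAC commr_polyX mul_polyC evD evX evZ IH P1 rmorph1 exp1rz mulr1.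
Qed.

(** The polynomials that record relations form an ideal of Z[X] containing
    X^p-1. If it contains e prime to (X^p-1)/(X-1), then by Bezout it contains
    a nonzero multiple of X-1. *)
Lemma cyclic_relation (p : nat) (e : {poly int}) : z p = z 0%N ->
  (size e <= p)%N -> \prod_(k < p) z k ^ e`_k = 1 ->
  coprimep (map_poly intr e : {poly rat}) (\sum_(k < p) 'X^k) ->
  exists2 N : int, N != 0 & z 1%N ^ N = z 0%N ^ N.
Proof.
move=> zp sz_e e1; have -> : \sum_(k < p) 'X^k =
    map_poly intr (\sum_(k < p) 'X^k) :> {poly rat}.
  by rewrite rmorph_sum; apply: eq_bigr => k _; rewrite /= map_polyXn.
move=> /coprimep_int_Bezout[u [v [N nz_N DN]]]; exists N => //.
have evXn k c : ev (c *: 'X^k) = z k ^ c.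
  rewrite evZ /ev size_polyXn big_ord_recr big1 /= ?mul1r.
    by rewrite coefXn eqxx expr1z.
  by move=> i _; rewrite coefXn ltn_eqF.
have evXp : ev ('X^p - 1) = 1.
  by rewrite evD -(scale1r 'X^p) -scaleN1r -(expr0 'X) !evXn zp expr1z exprN1 mulfV.
have : ev (N%:P * ('X - 1)) = 1.
  have -> : N%:P * ('X - 1) = u * ('X - 1) * e + v * ('X^p - 1).
    by rewrite -DN subrX1; ring.
  by rewrite evD !ev_ideal ?mulr1 // (evE sz_e).
rewrite mul_polyC scalerBr -['X]expr1 -(expr0 'X) -scaleNr evD !evXn.
have nz_z0 : z 0%N ^ N != 0 by rewrite expfz_neq0.
by rewrite -invr_expz => /(congr1 ( *%R^~ (z 0%N ^ N))); rewrite divfK // mul1r.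
Qed.
End CyclicRelations.

Section RootsIndependent.
Variables (L : splittingFieldType rat) (galL : galois 1 {:L}).
Variables (p : nat) (q : {poly rat}) (rs : seq L).
Hypotheses (p_pr : prime p) (irr_q : irreducible_poly q) (sz_q : size q = p.+1).
Hypotheses (Dq : map_poly (in_alg L) q = \prod_(r <- rs) ('X - r%:P)).
Hypothesis genL : <<1 & rs>>%VS = fullv.
Hypothesis unit_q : q`_0 ^+ 2 = 1.
Hypothesis not_unity : forall k, (0 < k)%N -> ~~ (q %| 'X^k - 1).

(** Number the roots along a p-cycle of the Galois group. The polynomial of
    the exponents is either proportional to 1 + X + ... + X^(p-1), which is
    the claim, or prime to it. In the latter case the relation spreads over
    the cycle and makes some power of all the roots equal; as the product of
    the roots is a sign, the roots would be roots of unity. *)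
Lemma splitting_roots_independent (f : L -> int) :
  \prod_(r <- rs) r ^ f r = 1 -> {in rs &, forall x y, f x = f y}.
Proof.
move=> f1; have [g gp [r0 r0P orb]] := gal_prime_cycle galL p_pr irr_q sz_q Dq genL.
have p_gt0 := prime_gt0 p_pr.
pose z k := (g ^+ k)%g r0.
have gz k : g (z k) = z k.+1 by rewrite /z expgSr galM ?memvf.
have sz_rs : size rs = p by rewrite (perm_size orb) size_map size_iota.
have prod_rs : (\prod_(r <- rs) r) ^+ 2 = 1.
  have : (\prod_(r <- rs) ('X - r%:P))`_0 ^+ 2 = 1.
    by rewrite -Dq coef_map -rmorphXn unit_q rmorph1.
  rewrite -horner_coef0 horner_prod.
  under eq_bigr => r _ do rewrite hornerXsubC sub0r -mulN1r.
  by rewrite big_split /= exprMn big_const_seq iter_mulr_1 -exprM mulnC exprM sqrrN !expr1n mul1r.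
have nz_rs r : r \in rs -> r != 0.
  move=> rP; apply/eqP => r0'; move/eqP: prod_rs.
  by rewrite (big_rem r) //= r0' mul0r expr0n eq_sym oner_eq0.
have z_rs k : z k \in rs.
  rewrite -root_prod_XsubC -Dq gal_root Dq root_prod_XsubC //.
pose e : {poly int} := \poly_(k < p) f (z k).
have sz_e : (size e <= p)%N := size_poly _ _.
have [|cop|[c De]] := @coprimep_sum_Xn p (map_poly intr e) p_pr.
- by rewrite size_map_inj_poly //; apply: intr_inj.
- have nz_z k : z k != 0 by exact: nz_rs _ (z_rs k).
  have zp : z p = z 0%N by rewrite /z gp.
  have [|N nz_N zN] := cyclic_relation nz_z gz zp sz_e _ cop.
    rewrite -[RHS]f1 (perm_big _ orb) /= big_map -[in iota _ _](subn0 p) -/(index_iota 0 p).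
    by rewrite big_mkord; apply: eq_bigr => k _; rewrite coef_poly ltn_ord.
  (* every root has the same N-th power, which is a root of unity *)
  have zkN k : z k ^ N = z 0%N ^ N.
    by elim: k => // k IH; rewrite -gz -fmorphXz IH fmorphXz /= gz zN.
  have : z 0%N ^ (N * (p * 2)%N%:Z) = 1.
    rewrite -exprz_exp -[LHS]/(_ ^+ (p * 2)) exprM -[RHS](exp1rz _ N) -prod_rs.
    rewrite -[(_ ^+ 2) ^ N]/((_ ^ 2) ^ N) exprz_exp mulrC -exprz_exp.
    rewrite -[RHS]/(_ ^+ 2); congr (_ ^+ 2).
    rewrite (big_morph (fun x => x ^ N) (fun x y => expfzMl x y N) (exp1rz _ N)).
    rewrite (perm_big _ orb) /= big_map -[in iota _ _](subn0 p) -/(index_iota 0 p).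
    rewrite big_mkord (eq_bigr (fun=> z 0%N ^ N)) => [|k _]; last exact: zkN.
    by rewrite prodr_const card_ord.
  have {}zN (M : int) : z 0%N ^ M = 1 -> z 0%N ^+ `|M|%N = 1.
    case: M => // M; rewrite NegzE /= -invr_expz => /(congr1 GRing.inv).
    by rewrite invrK invr1.
  move/zN; set M := `|_|%N => zM1; have M_gt0 : (0 < M)%N.
    by rewrite absz_gt0 mulf_neq0 // eqz_nat muln_eq0 negb_or -lt0n p_gt0.
  have := not_unity M_gt0; rewrite -irreducible_poly_coprime //.
  rewrite -(coprimep_map (in_alg L)) => co_q.
  have /(coprimep_root co_q)/negP[] : root (map_poly (in_alg L) q) (z 0%N).
    by rewrite Dq root_prod_XsubC z_rs.
  by rewrite rmorphB /= map_polyXn rmorph1 !hornerE zM1 subrr.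
move=> x y; rewrite !(perm_mem orb) => /mapP[i + ->] /mapP[j + ->].
rewrite !mem_iota /= !add0n => lt_ip lt_jp.
suff E k : (k < p)%N -> (f (z k))%:~R = c by apply: (intr_inj : injective (intr : int -> rat)); rewrite !E.
move=> lt_kp; have := congr1 (fun P : {poly rat} => P`_k) De; rewrite coef_map coef_poly lt_kp /=.
move=> ->; rewrite coefZ coef_sum (bigD1 (Ordinal lt_kp)) //= coefXn eqxx big1 ?addr0 ?mulr1 //.
by move=> i' ne; rewrite coefXn; case: eqP => // Ek; rewrite -val_eqE /= -Ek eqxx in ne.
Qed.
End RootsIndependent.

(** The relations between the roots do not depend on the field in which they
    are taken; in a field generated by the roots the Galois group acts
    faithfully on them. *)
Lemma roots_independent (F : fieldType) (iota : {rmorphism F -> algC})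
    (in_F : {rmorphism rat -> F}) (p : nat) (q : {poly rat}) (rs : seq F)
    (f : F -> int) :
  prime p -> irreducible_poly q -> q \is monic -> size q = p.+1 ->
  q`_0 ^+ 2 = 1 -> (forall k, (0 < k)%N -> ~~ (q %| 'X^k - 1)) ->
  map_poly in_F q = \prod_(r <- rs) ('X - r%:P) ->
  \prod_(r <- rs) r ^ f r = 1 -> {in rs &, forall x y, f x = f y}.
Proof.
move=> p_pr irr_q mon_q sz_q unit_q not_unity Dq f1.
have [L [iotaL [rsL [galL DqL genL]]]] := splitting_number_field mon_q.
have qC (G : fieldType) (h : {rmorphism G -> algC}) (k : {rmorphism rat -> G}) s :
  map_poly k q = \prod_(r <- s) ('X - r%:P) ->
  map_poly ratr q = \prod_(r <- [seq h x | x <- s]) ('X - r%:P).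
- move/(congr1 (map_poly h)); rewrite -map_poly_comp.
  rewrite (eq_map_poly (fmorph_eq_rat (h \o k)%FUN)).
  rewrite big_map rmorph_prod /= => ->.
  by apply: eq_bigr => x _; rewrite rmorphB /= map_polyX map_polyC.
have eq_roots : perm_eq [seq iota x | x <- rs] [seq iotaL x | x <- rsL].
  have U (G : fieldType) (h : {rmorphism G -> algC}) (k : {rmorphism rat -> G}) s :
      map_poly k q = \prod_(r <- s) ('X - r%:P) -> uniq [seq h x | x <- s].
    by move=> Ds; rewrite map_inj_uniq ?(irreducible_roots_uniq irr_q Ds) //; apply: fmorph_inj.
  apply: uniq_perm; rewrite ?(U _ _ _ _ Dq) ?(U _ _ _ _ DqL) // => x.
  by rewrite -!root_prod_XsubC -(qC _ _ _ _ Dq) -(qC _ _ _ _ DqL).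
pose c (y : algC) := f (nth 0 rs (index y [seq iota x | x <- rs])).
have cE x : x \in rs -> c (iota x) = f x.
  by move=> x_rs; rewrite /c index_map ?nth_index //; apply: fmorph_inj.
have f1L : \prod_(r <- rsL) r ^ c (iotaL r) = 1.
  apply: (fmorph_inj iotaL); rewrite rmorph1 rmorph_prod.
  under eq_bigr => r _ do rewrite fmorphXz.
  rewrite -(big_map iotaL predT (fun y => y ^ c y)) -(perm_big _ eq_roots) big_map /=.
  rewrite -[RHS](rmorph1 iota) -f1 rmorph_prod !big_seq.
  by apply: eq_bigr => x x_rs; rewrite fmorphXz cE.
have indL := splitting_roots_independent galL p_pr irr_q sz_q DqL genL unit_q not_unity f1L.
move=> x y x_rs y_rs.
have [] : iota x \in [seq iotaL x | x <- rsL] /\ iota y \in [seq iotaL x | x <- rsL].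
  by rewrite -!(perm_mem eq_roots) !map_f.
move=> /mapP[x' x'P Ex] /mapP[y' y'P Ey].
by rewrite -!cE // Ex Ey; apply: indL.
Qed.

(** * Small values of integer polynomials at algebraic integers *)

(** The polynomial x stands for an element of Z[r], where r is an algebraic
    integer; the values of x at the conjugates of r are the conjugates of this
    element. *)
Definition evalZ (F : nzRingType) (x : {poly int}) (r : F) : F :=
  (map_poly intr x).[r].

Section EvalZ.
Variables (F : comNzRingType) (r : F).

Lemma evalZB x y : evalZ (x - y) r = evalZ x r - evalZ y r.
Proof. by rewrite /evalZ rmorphB /= !hornerE. Qed.

Lemma evalZ_sum n (x : {poly int}) : (size x <= n)%N ->
  evalZ x r = \sum_(j < n) (x`_j)%:~R * r ^+ j.
Proof.
move=> le_xn; rewrite /evalZ (horner_coef_wide (n := n)).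
  by apply: eq_bigr => j _; rewrite coef_map.
by rewrite (leq_trans _ le_xn) // map_polyE (leq_trans (size_Poly _)) // size_map.
Qed.

Lemma rmorph_evalZ (G : comNzRingType) (g : {rmorphism F -> G}) x :
  g (evalZ x r) = evalZ x (g r).
Proof.
rewrite /evalZ -horner_map -map_poly_comp; congr _.[_].
by apply: eq_map_poly => c /=; rewrite rmorph_int.
Qed.
End EvalZ.

Section SmallValues.

(** Of two complex conjugate roots, one yields the real part and the other the
    imaginary part: in this way the conjugates of an element have as many real
    coordinates as there are roots. *)
Let part (r z : algC) := if 0 <= 'Im r then 'Re z else 'Im z.

Let partB r z w : part r (z - w) = part r z - part r w.
Proof. by rewrite /part; case: ifP; rewrite raddfB. Qed.

Let part_real r z : part r z \is Num.real.
Proof. by rewrite /part; case: ifP => _; rewrite ?Creal_Re ?Creal_Im. Qed.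

Let norm_part r z : `|part r z| <= `|z|.
Proof.
rewrite /part; case: ifP => _; first exact: leif_normC_Re_Creal.
by rewrite -[leRHS]mul1r -normCi -normrM; rewrite -[`|'Im z|]normrN -ReMil leif_normC_Re_Creal.
Qed.

Let conj_evalZ x (r : algC) : (evalZ x r)^* = evalZ x r^*.
Proof. exact: (rmorph_evalZ r Num.conj). Qed.

Let norm_le_parts x (r e : algC) :
  `|part r (evalZ x r)| <= e -> `|part r^* (evalZ x r^*)| <= e ->
  `|evalZ x r| <= e *+ 2.
Proof.
move=> le1 le2; rewrite [evalZ x r]Crect (le_trans (ler_normD _ _)) //.
rewrite normrM normCi mul1r mulr2n.
move: le1 le2; rewrite /part -conj_evalZ Im_conj Re_conj Im_conj oppr_ge0.
have [Im_lt|Im_gt|Im0] := real_ltgtP (Creal_Im r) (real0 _).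
- by move=> le_Im le_Re; rewrite addrC lerD.
- by move=> le_Re; rewrite normrN => le_Im; rewrite lerD.
move=> le_Re _; rewrite [X in _ + `|X|](_ : _ = 0) ?normr0 ?addr0.
  by rewrite (le_trans le_Re) // lerDl (le_trans _ le_Re).
apply/eqP; have : r^* == r by rewrite -CrealE; apply/Creal_ImP.
move=> /eqP r_real; have := Im_conj (evalZ x r); rewrite conj_evalZ r_real.
by move/eqP; rewrite -addr_eq0 -mulr2n mulrn_eq0.
Qed.

Let trunc_eq_dist (a b : algC) : 0 <= a -> 0 <= b -> Num.truncn a = Num.truncn b ->
  `|a - b| <= 1.
Proof.
move=> a_ge0 b_ge0 eq_ab; have := truncn_itv a_ge0; have := truncn_itv b_ge0.
rewrite eq_ab -natr1; set k := _%:R => /andP[kb bk] /andP[ka ak].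
rewrite real_ler_norml ?realB ?ger0_real //; apply/andP; split.
  by rewrite lerBrDr addrC lerBlDr (le_trans (ltW bk)) // lerD2r.
by rewrite lerBlDr addrC (le_trans (ltW ak)) // lerD2r.
Qed.

(** Minkowski's box principle. Let d and d' be the numbers of roots in S and
    outside S, and p = d + d'. There are more than t ^ (d' * p) polynomials
    with p coefficients in {0, ..., t ^ d'}. Their d' real coordinates outside
    S are O(t ^ d'); cutting the range of each into t ^ p intervals gives only
    t ^ (p * d') cells. Two polynomials in the same cell differ by O(t ^
    (d'-p)), which is O(t ^- d), outside S. *)
Lemma exists_small_values (rs : seq algC) (S : {pred algC}) : (0 < size rs)%N ->
  (forall r, r \in rs -> r^* \in rs) -> (forall r, (r^* \in S) = (r \in S)) ->
  exists2 K : algC, 0 < K & forall t, (0 < t)%N -> exists x : {poly int},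
    [/\ x != 0, (size x <= size rs)%N,
      forall r, r \in rs -> r \notin S -> `|evalZ x r| * t%:R ^+ count (mem S) rs <= K
    & forall r, r \in rs -> r \in S -> `|evalZ x r| <= K * t%:R ^+ count (predC (mem S)) rs].
Proof.
move=> rs_gt0 conj_rs conj_S; set d := count (mem S) rs; set d' := count _ rs.
have Dp : size rs = (d + d')%N by rewrite /d /d' -(count_predC (mem S)).
pose p := size rs.
pose K := \sum_(r <- rs) \sum_(j < p) `|r| ^+ j + 1.
have le_sumK r : r \in rs -> \sum_(j < p) `|r| ^+ j < K.
  move=> r_rs; rewrite /K (big_rem r) //= -addrA ltrDl ltr_wpDl //.
  by apply: sumr_ge0 => s _; apply: sumr_ge0 => j _; rewrite exprn_ge0.
have K_gt0 : 0 < K.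
  by rewrite ltr_wpDl //; apply: sumr_ge0 => s _; apply: sumr_ge0 => j _; rewrite exprn_ge0.
exists (K *+ 4); first by rewrite pmulrn_lgt0.
move=> t t_gt0; pose B := (t ^ d')%N; pose s := (t ^ p)%N.
have B_gt0 : (0 < B)%N by rewrite expn_gt0 t_gt0.
have s_gt0 : (0 < s)%N by rewrite expn_gt0 t_gt0.
pose X (c : {ffun 'I_p -> 'I_B.+1}) : {poly int} := rVpoly (\row_j (c j)%:Z).
have sz_X c : (size (X c) <= p)%N := size_poly _ _.
have coefX c (j : 'I_p) : (X c)`_j = (c j)%:Z by rewrite coef_rVpoly_ord mxE.
pose M := K * B%:R; have M_gt0 : 0 < M by rewrite mulr_gt0 ?ltr0n.
have le_XM c r : r \in rs -> `|evalZ (X c) r| < M.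
  move=> r_rs; rewrite (evalZ_sum _ (sz_X c)) (le_lt_trans (ler_norm_sum _ _ _)) //.
  rewrite (le_lt_trans (_ : _ <= (\sum_(j < p) `|r| ^+ j) * B%:R)) //; last first.
    by rewrite ltr_pM2r ?ltr0n // le_sumK.
  rewrite mulr_suml ler_sum // => j _; rewrite normrM normrX mulrC ler_wpM2l ?exprn_ge0 //.
  by rewrite coefX normr_nat ler_nat -ltnS.
pose cell c r := Num.truncn ((part r (evalZ (X c) r) + M) / (M *+ 2) * s%:R).
have M2_gt0 : 0 < M *+ 2 by rewrite pmulrn_lgt0.
have real_part c r : r \in rs -> 0 <= (part r (evalZ (X c) r) + M) / (M *+ 2) * s%:R < s%:R.
  move=> r_rs; rewrite -[ltRHS]mul1r ltr_pM2r ?ltr0n // ltr_pdivrMr // mul1r.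
  have := le_lt_trans (norm_part r _) (le_XM c r r_rs).
  rewrite real_ltr_norml ?part_real // => /andP[gtM ltM].
  rewrite mulr2n ltrD2r ltM andbT mulr_ge0 ?ler0n // divr_ge0 ?(ltW M2_gt0) //.
  by rewrite -lerBlDr sub0r ltW.
pose rs' := [seq r <- rs | r \notin S].
have sz_rs' : size rs' = d' by rewrite size_filter.
pose box c : {ffun 'I_d' -> 'I_s} := [ffun i : 'I_d' => insubd (Ordinal s_gt0) (cell c rs'`_i)].
have /injectivePn[c1 [c2 c12 eq_box]] : ~~ injectiveb box.
  apply/negP => /injectiveP/leq_card; rewrite !card_ffun !card_ord leqNgt.
  have -> : (s ^ d' = B ^ p)%N by rewrite -!expnM mulnC.
  by rewrite ltn_exp2r ?ltnSn.
have eq_cell r : r \in rs -> r \notin S -> cell c1 r = cell c2 r.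
  move=> r_rs r_S; have r_rs' : r \in rs' by rewrite mem_filter r_S.
  have lt_i : (index r rs' < d')%N by rewrite -sz_rs' index_mem.
  have /ffunP/(_ (Ordinal lt_i))/(congr1 val) := eq_box.
  have lt_cell c : (cell c r < s)%N.
    by have /andP[ge0 lts] := real_part c r r_rs; rewrite truncn_lt_nat.
  by rewrite !ffunE /= !val_insubd nth_index // !lt_cell.
exists (X c1 - X c2); split.
- rewrite subr_eq0; apply: contraNneq c12 => eqX; apply/eqP/ffunP => j.
  by apply: val_inj; have := coefX c1 j; rewrite eqX coefX => -[].
- by rewrite (leq_trans (size_polyD _ _)) // geq_max size_polyN !sz_X.
- have le_part r : r \in rs -> r \notin S ->
    `|part r (evalZ (X c1 - X c2) r)| <= M *+ 2 / s%:R.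
    move=> r_rs r_S; rewrite evalZB partB ler_pdivlMr ?ltr0n //.
    have [/andP[x_ge0 _] /andP[y_ge0 _]] := (real_part c1 r r_rs, real_part c2 r r_rs).
    have := trunc_eq_dist x_ge0 y_ge0 (eq_cell r r_rs r_S).
    set x := part r _; set y := part r _.
    have -> : (x + M) / (M *+ 2) * s%:R - (y + M) / (M *+ 2) * s%:R =
        (x - y) * (s%:R / (M *+ 2)) by ring.
    rewrite normrM [X in _ * X]gtr0_norm ?divr_gt0 ?ltr0n //.
    by rewrite mulrA ler_pdivrMr // mul1r.
  move=> r r_rs r_S; have t_neq0 k : t%:R ^+ k != 0 :> algC by rewrite expf_neq0 // pnatr_eq0 -lt0n.
  have -> : K *+ 4 = M *+ 2 / s%:R *+ 2 * t%:R ^+ d.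
    by rewrite /M /B /s !natrX /p Dp exprD; field; rewrite !t_neq0.
  rewrite ler_wpM2r ?exprn_ge0 ?ler0n // norm_le_parts ?le_part ?conj_rs //.
  by rewrite conj_S.
move=> r r_rs _; rewrite evalZB (le_trans (ler_normB _ _)) //.
rewrite (le_trans (lerD (ltW (le_XM c1 r r_rs)) (ltW (le_XM c2 r r_rs)))) //.
rewrite /M /B natrX -mulr2n mulrnAl -[leLHS]mulr_natl -[leRHS]mulr_natl ler_wpM2r ?ler_nat //.
by rewrite mulr_ge0 ?exprn_ge0 // ltW.
Qed.
End SmallValues.

Section Norm.
Variables (qZ : {poly int}) (rs : seq algC).
Let q : {poly rat} := map_poly intr qZ.
Hypotheses (irr_q : irreducible_poly q) (mon_q : qZ \is monic).
Hypothesis Dq : map_poly intr qZ = \prod_(r <- rs) ('X - r%:P).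

Let Dq' : map_poly ratr q = \prod_(r <- rs) ('X - r%:P).
Proof.
rewrite -Dq -map_poly_comp; apply: eq_map_poly => c /=; exact: ratr_int.
Qed.

Let root_rs r : root (map_poly ratr q) r = (r \in rs).
Proof. by rewrite Dq' root_prod_XsubC. Qed.

Let uniq_rs : uniq rs := irreducible_roots_uniq irr_q Dq'.

Let size_q : size q = (size rs).+1.
Proof. by rewrite -(size_map_poly (ratr : {rmorphism rat -> algC})) Dq' size_prod_XsubC. Qed.

Lemma root_Aint r : r \in rs -> r \in Aint.
Proof.
rewrite -root_prod_XsubC -Dq => qr; apply: (root_monic_Aint qr).
  exact: monic_map.
by apply/polyOverP => i; rewrite coef_map /= intr_int.
Qed.

Lemma evalZ_Aint (x : {poly int}) r : r \in rs -> evalZ x r \in Aint.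
Proof.
move=> r_rs; rewrite (evalZ_sum _ (leqnn _)) rpred_sum // => j _.
by rewrite rpredM ?Aint_int // rpredX // root_Aint.
Qed.

Lemma evalZ_neq0 (x : {poly int}) r : r \in rs -> x != 0 -> (size x <= size rs)%N ->
  evalZ x r != 0.
Proof.
move=> r_rs nz_x sz_x; have inj : injective (intr : int -> rat) := intr_inj.
have : coprimep q (map_poly intr x).
  rewrite irreducible_poly_coprime //; apply/negP => /dvdp_leq.
  by rewrite map_poly_eq0_id0 ?intr_eq0 ?lead_coef_eq0 // size_q size_map_inj_poly // ltnNge sz_x => /(_ nz_x).
rewrite -(coprimep_map (ratr : {rmorphism rat -> algC})).
move=> /coprimep_root/(_ _)/= H; have := H r; rewrite root_rs => /(_ r_rs).
rewrite -map_poly_comp (eq_map_poly (g := intr)) // => c /=; exact: ratr_int.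
Qed.

Lemma conj_roots r : r \in rs -> r^* \in rs.
Proof.
rewrite -!root_rs => qr.
rewrite -(fmorph_root Num.conj) -map_poly_comp in qr.
by rewrite (eq_map_poly (g := ratr)) in qr => // c /=; rewrite fmorph_rat.
Qed.

Lemma norm_int (x : {poly int}) : \prod_(r <- rs) evalZ x r \in Num.int.
Proof.
apply: Cint_rat_Aint; last first.
  by rewrite big_seq rpred_prod // => r r_rs; rewrite evalZ_Aint.
have mon_q' : q \is monic by exact: monic_map.
have [L [iota [rsL [galL DqL _]]]] := splitting_number_field mon_q'.
have eq_rs : perm_eq rs (map iota rsL).
  apply: uniq_perm => //.
    by rewrite map_inj_uniq ?(irreducible_roots_uniq irr_q DqL) //; apply: fmorph_inj.
  move=> r; rewrite -root_rs -root_prod_XsubC; congr (root _ r).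
  move/(congr1 (map_poly iota)): DqL; rewrite -map_poly_comp.
  rewrite (eq_map_poly (fmorph_eq_rat (iota \o in_alg L)%FUN)) => ->.
  rewrite big_map rmorph_prod; apply: eq_bigr => y _.
  by rewrite rmorphB /= map_polyX map_polyC.
have [a Da] : exists a : rat, \prod_(r <- rsL) evalZ x r = a%:A.
  apply: gal_fixed_rat => // g _; rewrite rmorph_prod.
  under eq_bigr => r _ do rewrite /= rmorph_evalZ.
  rewrite -(big_map g predT (evalZ x)); apply/perm_big/perm_map_stable.
  - exact: fmorph_inj.
  - exact: irreducible_roots_uniq irr_q DqL.
  by move=> r r_rs; rewrite -root_prod_XsubC -DqL gal_root DqL root_prod_XsubC.
rewrite (perm_big _ eq_rs) big_map /=.
under eq_bigr => r _ do rewrite -rmorph_evalZ.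
by rewrite -rmorph_prod Da alg_num_field fmorph_rat rpred_rat.
Qed.

End Norm.

(** * Units *)

Section Units.
Variables (qZ : {poly int}) (rs : seq algC).
Let q : {poly rat} := map_poly intr qZ.
Hypotheses (irr_q : irreducible_poly q) (mon_q : qZ \is monic).
Hypothesis Dq : map_poly intr qZ = \prod_(r <- rs) ('X - r%:P).

Let norm (x : {poly int}) := \prod_(r <- rs) evalZ x r.

Let prod_le_exp (S : {pred algC}) (F : algC -> algC) B :
  (forall r, r \in rs -> r \in S -> 0 <= F r <= B) ->
  \prod_(r <- rs | r \in S) F r <= B ^+ count (mem S) rs.
Proof.
move=> le_FB; have -> : B ^+ count (mem S) rs = \prod_(r <- rs | r \in S) B.
  by rewrite big_const_seq iter_mulr_1.
rewrite [leLHS]big_seq_cond [leRHS]big_seq_cond.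
by apply: ler_prod => r /andP[r_rs r_S]; exact: le_FB.
Qed.

(** In the product of the bounds of exists_small_values over all the roots the
    powers of t cancel, while the values outside S tend to 0 as t grows. *)
Lemma exists_small_norm (S : {pred algC}) : has (mem S) rs ->
  (forall r, (r^* \in S) = (r \in S)) ->
  exists M : nat, forall e : algC, 0 < e -> exists x : {poly int},
    [/\ x != 0, (size x <= size rs)%N, `|norm x| <= M%:R
    & forall r, r \in rs -> r \notin S -> `|evalZ x r| < e].
Proof.
move=> hasS conjS; have rs_gt0 : (0 < size rs)%N by case: (rs) hasS.
have [K K_gt0 smallK] := exists_small_values rs_gt0 (conj_roots Dq) conjS.
set d := count (mem S) rs in smallK; set d' := count _ rs in smallK.
have d_gt0 : (0 < d)%N by rewrite -has_count.
exists (Num.truncn (K ^+ (size rs))).+1 => e e_gt0.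
pose t := (Num.truncn (K / e)).+1.
have lt_Kt : K / e < t%:R by apply: real_truncnS_gt; rewrite realM ?gtr0_real ?invr_gt0.
have [x [nz_x sz_x outS inS]] := smallK t (ltn0Sn _).
have t_gt0 : 0 < t%:R :> algC by rewrite ltr0n.
exists x; split=> //; last first.
  move=> r r_rs r_S; rewrite -(ltr_pM2r (x := t%:R ^+ d)) ?exprn_gt0 //.
  rewrite (le_lt_trans (outS r r_rs r_S)) // -ltr_pdivrMl // mulrC.
  by rewrite (lt_le_trans lt_Kt) // -[leLHS]expr1 ler_weXn2l // ler1n.
rewrite (@le_trans _ _ (K ^+ size rs)) //; last first.
  by apply/ltW/real_truncnS_gt; rewrite realX ?gtr0_real.
rewrite /norm normr_prod (bigID (mem S)) /=.
rewrite -(ler_pM2r (x := (t%:R ^+ d) ^+ d')) ?exprn_gt0 // -mulrA.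
have -> : (\prod_(r <- rs | r \notin S) `|evalZ x r|) * (t%:R ^+ d) ^+ d' =
    \prod_(r <- rs | r \notin S) (`|evalZ x r| * t%:R ^+ d).
  by rewrite big_split /= big_const_seq iter_mulr_1.
have -> : K ^+ size rs * (t%:R ^+ d) ^+ d' = (K * t%:R ^+ d') ^+ d * K ^+ d'.
  rewrite -(count_predC (mem S)) exprD exprMn -!exprM [(d * d')%N]mulnC.
  by rewrite -/d -/d' mulrAC.
apply: ler_pM; rewrite ?prodr_ge0 //.
  by move=> r _; rewrite mulr_ge0 ?exprn_ge0 ?ler0n.
  by apply: prod_le_exp => r r_rs r_S; rewrite normr_ge0 inS.
apply: (prod_le_exp (S := [predC S])) => r r_rs r_S.
by rewrite mulr_ge0 ?exprn_ge0 ?ler0n //= outS.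
Qed.

Lemma positive_lower_bound (I : eqType) (s : seq I) (F : I -> algC) :
  (forall i, i \in s -> 0 < F i) -> exists2 e, 0 < e & forall i, i \in s -> e <= F i.
Proof.
elim: s => [|i s IH] F_gt0; first by exists 1.
have [j j_s|e e_gt0 le_e] := IH; first by rewrite F_gt0 // inE j_s orbT.
have Fi_gt0 : 0 < F i by rewrite F_gt0 ?mem_head.
have [le_iF|/ltW le_Fi] := real_leP (gtr0_real e_gt0) (gtr0_real Fi_gt0).
  by exists e => // j; rewrite inE => /predU1P[->//|/le_e].
exists (F i) => // j; rewrite inE => /predU1P[->//|/le_e]; exact: le_trans.
Qed.

(** At each root, x / y = 1 + (N / y) z, and N / y is the product of the other
    conjugates of y. *)
Lemma congruent_ratio_Aint (x y z : {poly int}) (N : int) : N != 0 ->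
  norm x = N%:~R -> norm y = N%:~R -> x - y = N *: z ->
  {in rs, forall r, evalZ x r / evalZ y r \in Aint}.
Proof.
move=> nz_N Nx Ny Dz r r_rs.
have nz_y : evalZ y r != 0.
  apply: contraNneq nz_N => y0; rewrite -(intr_eq0 algC) -Ny /norm (big_rem r) //=.
  by rewrite y0 mul0r.
have -> : evalZ x r = evalZ y r + N%:~R * evalZ z r.
  apply/eqP; rewrite -subr_eq0 opprD addrA subr_eq0 -evalZB Dz.
  by rewrite /evalZ map_polyZ /= hornerZ.
rewrite mulrDl mulfV // -Ny /norm (big_rem r) //=.
rewrite (_ : _ * _ * _ / _ = (\prod_(s <- rem r rs) evalZ y s) * evalZ z r); last first.
  by field.
rewrite rpredD ?Aint1 // rpredM ?(evalZ_Aint mon_q Dq) // big_seq rpred_prod // => s /mem_rem s_rs.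
by rewrite (evalZ_Aint mon_q Dq).
Qed.

(** A long enough sequence of elements of bounded norm that decreases at each
    root outside S contains two elements with the same norm N and the same
    residue modulo M!, a multiple of N. Their quotient is a unit. *)
Lemma exists_unit_small_outside (S : {pred algC}) : has (mem S) rs ->
  (forall r, (r^* \in S) = (r \in S)) ->
  exists x y : {poly int}, let u r := evalZ x r / evalZ y r in
  [/\ {in rs, forall r, evalZ y r != 0},
      {in rs, forall r, u r \in Aint /\ (u r)^-1 \in Aint},
      \prod_(r <- rs) u r = 1
    & forall r, r \in rs -> r \notin S -> `|u r| < 1].
Proof.
move=> hasS conjS; have [M smallM] := exists_small_norm hasS conjS.
pose good (x : {poly int}) := [/\ x != 0, (size x <= size rs)%N & `|norm x| <= M%:R].
pose smaller (y x : {poly int}) := forall r, r \in rs -> r \notin S -> `|evalZ y r| < `|evalZ x r|.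
have nz_val x r : good x -> r \in rs -> evalZ x r != 0.
  by case=> nz_x sz_x _ r_rs; apply: (evalZ_neq0 irr_q Dq).
have next x : good x -> exists2 y, good y & smaller y x.
  move=> gx; have [|e e_gt0 le_e] := @positive_lower_bound _ rs (fun r => `|evalZ x r|).
    by move=> r r_rs; rewrite normr_gt0 nz_val.
  have [y [nz_y sz_y Ny lt_y]] := smallM e e_gt0; exists y => // r r_rs r_S.
  by rewrite (lt_le_trans (lt_y r r_rs r_S)) ?le_e.
have chain n : exists f : nat -> {poly int}, (forall i, (i <= n)%N -> good (f i)) /\
    forall i j, (i < j <= n)%N -> smaller (f j) (f i).
  elim: n => [|n [f [gf sf]]].
    have [x [nz_x sz_x Nx _]] := smallM 1 ltr01.
    by exists (fun=> x); split=> [i _ //|i j]; lia.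
  have [y gy lt_y] := next (f n) (gf n (leqnn n)).
  exists (fun i => if (i <= n)%N then f i else y); split=> [i _|i j /andP[lt_ij le_jn]].
    by case: leqP => // /gf.
  have -> : (i <= n)%N by lia.
  case: leqP => [le_jn'|lt_nj]; first by apply: sf; rewrite lt_ij.
  move=> r r_rs r_S; have [->|ne_in] := eqVneq i n; first exact: lt_y.
  by rewrite (lt_trans (lt_y r r_rs r_S)) // sf //; lia.
have Nint x : exists N : int, norm x = N%:~R.
  by have /intrP := norm_int irr_q mon_q Dq x.
pose N x := Num.floor (norm x).
have NE x : norm x = (N x)%:~R by have [k Dk] := Nint x; rewrite /N Dk intrKfloor.
pose D := M`!; have D_gt0 : (0 < D)%N := fact_gt0 M.
pose cls (x : {poly int}) : 'I_M.+1 * bool * {ffun 'I_(size rs) -> 'I_D} :=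
  (inord `|N x|%N, N x < 0, [ffun i : 'I_(size rs) => insubd (Ordinal D_gt0) `|(x`_i %% D)%Z|%N]).
have [f [gf sf]] := chain #|{: 'I_M.+1 * bool * {ffun 'I_(size rs) -> 'I_D}}|.
have [i [j [lt_ij le_jn eq_ij]]] := nat_pigeonhole (fun i => cls (f i)).
have [gx gy] : good (f j) /\ good (f i) by split; apply: gf; rewrite // (leq_trans (ltnW lt_ij)).
have sxy : smaller (f j) (f i) by apply: sf; rewrite lt_ij.
move: (f j) (f i) eq_ij gx gy sxy => x y eq_xy gx gy sxy {i j lt_ij le_jn sf gf f}.
have absN z : good z -> (`|N z| <= M)%N.
  case=> _ _; rewrite NE -intr_norm -[M%:R]/((M%:Z)%:~R) ler_int; lia.
have eqN : N x = N y.
  case: eq_xy => /(congr1 val) /=; rewrite !inordK ?ltnS ?absN // => eq_abs eq_sgn _; lia.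
have nzN z : good z -> N z != 0.
  move=> gz; rewrite -(intr_eq0 algC) -NE /norm prodf_seq_neq0.
  by apply/allP => r r_rs /=; apply: nz_val.
have dvdN : (N x %| D%:Z)%Z.
  rewrite dvdzE /= dvdn_fact // absN // andbT lt0n absz_eq0; exact: nzN.
(* The coefficients of index at least size rs vanish; the classes record the
   others. *)
have dvd_xy k : (N x %| (x - y)`_k)%Z.
  have [le_k|lt_k] := leqP (size rs) k.
    by rewrite coefB !(nth_default _ (leq_trans _ le_k)) ?subr0 //; [case: gy | case: gx].
  apply: dvdz_trans dvdN _; rewrite coefB -eqz_mod_dvd; apply/eqP.
  case: eq_xy => _ _ /ffunP/(_ (Ordinal lt_k)); rewrite !ffunE /= => /(congr1 val).
  rewrite !val_insubd /=.
  have lt_mod (c : int) : (`|(c %% D)%Z| < D)%N by lia.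
  by rewrite !lt_mod => eq_mod; lia.
have [z Dz] : exists z, x - y = N x *: z.
  exists (\poly_(k < size (x - y)) ((x - y)`_k %/ N x)%Z).
  apply/polyP => k; rewrite coefZ coef_poly; case: ltnP => [_|/leq_sizeP-> //].
    by rewrite mulrC divzK.
  by rewrite mulr0.
exists x, y => u; split.
- by move=> r r_rs; apply: nz_val.
- move=> r r_rs; split.
    by apply: (congruent_ratio_Aint (nzN x gx) (NE x) _ Dz r_rs); rewrite NE eqN.
  rewrite invf_div; apply: (congruent_ratio_Aint (N := N x) (z := - z) (nzN x gx) _ (NE x)) => //.
    by rewrite NE eqN.
  by rewrite scalerN -Dz opprB.
- rewrite big_split /= -/(norm x) NE eqN; have := NE y; rewrite /norm.
  move=> Ey; have nzNy : (N y)%:~R != 0 :> algC by rewrite intr_eq0 nzN.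
  by rewrite prodfV Ey mulfV.
move=> r r_rs r_S; rewrite normrM normfV ltr_pdivrMr ?normr_gt0 ?nz_val // mul1r.
exact: sxy.
Qed.
End Units.

Section IndependentUnit.
Variables (qZ : {poly int}) (rs : seq algC).
Let q : {poly rat} := map_poly intr qZ.
Hypotheses (irr_q : irreducible_poly q) (mon_q : qZ \is monic).
Hypothesis Dq : map_poly intr qZ = \prod_(r <- rs) ('X - r%:P).

Let uniq_rs : uniq rs.
Proof.
apply: (irreducible_roots_uniq (f := ratr) irr_q).
by rewrite -Dq -map_poly_comp; apply: eq_map_poly => c /=; exact: ratr_int.
Qed.

Lemma exprz_lt1 (X : algC) (b : int) : 0 < X -> X ^ b < 1 ->
  (0 < b) && (X < 1) || (b < 0) && (1 < X).
Proof.
move=> X_gt0; have X_real := gtr0_real X_gt0; case: b => [[|n]|n].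
- by rewrite expr0z ltxx.
- rewrite -[X ^ _]/(X ^+ n.+1) => lt1; rewrite (real_ltNge X_real (real1 _)) orbF.
  by apply: contraL lt1 => le1X; rewrite -real_leNgt ?realX ?real1 // exprn_ege1.
rewrite NegzE -invr_expz invf_lt1 ?exprn_gt0 // -[X ^ _]/(X ^+ n.+1) => gt1.
rewrite (real_ltNge (real1 _) X_real) /=.
by apply: contraL gt1 => leX1; rewrite -real_leNgt ?realX ?real1 // exprn_ile1 // ltW.
Qed.

Let conj_pair (s : algC) : {pred algC} := [pred r | (r == s) || (r == s^*)].

Let conj_pairC s r : (r^* \in conj_pair s) = (r \in conj_pair s).
Proof.
by rewrite !inE -{1}(conjCK s) !(inj_eq (fmorph_inj _)) orbC.
Qed.

(** The absolute values at the conjugates multiply to 1 and are less than 1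
    outside one place, hence greater than 1 at this place. *)
Let unit_at s x y (u := fun r => evalZ x r / evalZ y r) : s \in rs ->
  \prod_(r <- rs) u r = 1 ->
  (forall r, r \in rs -> r \notin conj_pair s -> `|u r| < 1) ->
  has [predC conj_pair s] rs -> 1 < `|u s|.
Proof.
move=> s_rs prod_u out_u /hasP[t t_rs t_out].
have u_real r : `|u r| \is Num.real by rewrite ger0_real.
rewrite real_ltNge ?real1 //; apply/negP => le_us.
have le_u r : r \in rs -> `|u r| <= 1.
  move=> r_rs; have [|r_out] := boolP (r \in conj_pair s); last by rewrite ltW ?out_u.
  rewrite inE => /orP[/eqP->//|/eqP->]; rewrite /u -!(rmorph_evalZ _ Num.conj).
  by rewrite -fmorphV -rmorphM norm_conjC.
have := congr1 Num.norm prod_u; rewrite normr1 normr_prod (big_rem t) //= => prod1.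
have : `|u t| * \prod_(r <- rem t rs) `|u r| < 1.
  rewrite (le_lt_trans _ (out_u t t_rs t_out)) // ler_piMr //.
  rewrite big_seq; apply: prodr_ile1 => r /mem_rem r_rs.
  by rewrite normr_ge0 le_u.
by rewrite prod1 ltxx.
Qed.

(** Among five roots there are r1, r2 and r3 at distinct places. Let u1 and u2
    be units that are greater than 1 in absolute value at r1 and r2
    respectively, and less than 1 at the other places. Suppose that positive
    powers of u1 and u2 are the powers r ^ b and r ^ d. At r3 both are less
    than 1, so that b and d have the same sign; at r1 exactly one of them is,
    so that b and d have opposite signs. *)
Lemma exists_independent_unit : (5 <= size rs)%N ->
  exists x y : {poly int}, let u r := evalZ x r / evalZ y r in
  [/\ {in rs, forall r, evalZ y r != 0},
      {in rs, forall r, u r \in Aint /\ (u r)^-1 \in Aint},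
      \prod_(r <- rs) u r = 1
    & forall (a : nat) (b : int), (0 < a)%N -> ~ {in rs, forall r, u r ^+ a = r ^ b}].
Proof.
move=> rs_ge5.
have other (s : seq algC) : (size s <= 4)%N -> exists2 r, r \in rs & r \notin s.
  move=> s_le4; apply/hasP; rewrite -[has _ _]negbK -all_predC; apply/negP => /allP sub_s.
  suff : (size rs <= size s)%N by lia.
  by apply: uniq_leq_size => // r /sub_s /=; rewrite negbK.
have [r1 r1_rs _] := other [::] isT.
have [r2 r2_rs] := other [:: r1; r1^*] isT; rewrite !inE => r2_r1.
have [r3 r3_rs] := other [:: r1; r1^*; r2; r2^*] isT.
rewrite !inE !negb_or => /and4P[r31 r31' r32 r32'].
have out1 : has [predC conj_pair r1] rs by apply/hasP; exists r2.
have out2 : has [predC conj_pair r2] rs.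
  by apply/hasP; exists r3 => //=; rewrite inE negb_or r32.
have in_pair s : s \in rs -> has (fun x => x \in conj_pair s) rs.
  by move=> s_rs; apply/hasP; exists s => //; rewrite inE eqxx.
have [x1 [y1 [nz1 A1 prod1 lt1]]] :=
  exists_unit_small_outside irr_q mon_q Dq (in_pair _ r1_rs) (conj_pairC r1).
have [x2 [y2 [nz2 A2 prod2 lt2]]] :=
  exists_unit_small_outside irr_q mon_q Dq (in_pair _ r2_rs) (conj_pairC r2).
have gt1 := unit_at r1_rs prod1 lt1 out1.
pose dep x y := exists (a : nat) (b : int), (0 < a)%N /\
  {in rs, forall r, (evalZ x r / evalZ y r) ^+ a = r ^ b}.
have [[a [b [a_gt0 Eab]]]|indep1] := classic (dep x1 y1); last first.
  by exists x1, y1; split=> // a b a_gt0 Eab; apply: indep1; exists a, b.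
have [[c [d [c_gt0 Ecd]]]|indep2] := classic (dep x2 y2); last first.
  by exists x2, y2; split=> // c d c_gt0 Ecd; apply: indep2; exists c, d.
exfalso.
have nz_r r : r \in rs -> r != 0.
  apply: contraTneq => ->; rewrite -root_prod_XsubC -Dq.
  have Dq' : map_poly intr qZ = map_poly (ratr : rat -> algC) q.
    by rewrite -map_poly_comp; apply: eq_map_poly => k /=; rewrite ratr_int.
  rewrite Dq' -(rmorph0 (ratr : {rmorphism rat -> algC})) fmorph_root.
  apply/negP; rewrite root_factor_theorem subr0 => Xq.
  have := eqp_size (irr_q.2 _ _ Xq); rewrite size_polyX => /(_ isT) sz_q.
  have szq : size q = (size rs).+1.
    have := congr1 (fun P : {poly algC} => size P) Dq.
    by rewrite size_prod_XsubC Dq' size_map_poly.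
  by move: rs_ge5 (etrans sz_q szq); clear; case: (size rs) => [|[]].
have normX x y (m : nat) (k : int) r : (0 < m)%N -> r \in rs ->
    (evalZ x r / evalZ y r) ^+ m = r ^ k ->
    `|evalZ x r / evalZ y r| < 1 -> `|r| ^ k < 1.
  move=> m_gt0 r_rs Emk ltu.
  have -> : `|r| ^ k = `|r ^ k| by case: (k) => n; rewrite ?NegzE -?invr_expz ?normfV normrX.
  by rewrite -Emk normrX exprn_ilt1 // -lt0n.
have lt_pair : r1 \notin conj_pair r2.
  rewrite inE; apply: contra r2_r1 => /orP[/eqP->|/eqP->]; first by rewrite eqxx.
  by rewrite conjCK eqxx orbT.
have b3 : `|r3| ^ b < 1.
  by apply: (normX _ _ _ _ _ a_gt0 r3_rs (Eab _ r3_rs)); rewrite lt1 // inE negb_or r31.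
have d3 : `|r3| ^ d < 1.
  by apply: (normX _ _ _ _ _ c_gt0 r3_rs (Ecd _ r3_rs)); rewrite lt2 // inE negb_or r32.
have d1 : `|r1| ^ d < 1.
  by apply: (normX _ _ _ _ _ c_gt0 r1_rs (Ecd _ r1_rs)); rewrite lt2.
have b1 : `|r1| ^ (- b) < 1.
  have -> : `|r1| ^ (- b) = `|r1 ^ b|^-1.
    by rewrite -invr_expz; congr _^-1; case: (b) => n; rewrite ?NegzE -?invr_expz ?normfV normrX.
  rewrite -(Eab _ r1_rs) normrX invf_lt1 ?exprn_egt1 -?lt0n //.
  by rewrite exprn_gt0 // (lt_trans ltr01).
have [p1 p3] : 0 < `|r1| /\ 0 < `|r3| by rewrite !normr_gt0 !nz_r.
have ltC (X : algC) : X < 1 -> 1 < X -> false by move=> lt /(lt_trans lt); rewrite ltxx.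
case/orP: (exprz_lt1 p3 b3) => /andP[sb s3]; case/orP: (exprz_lt1 p3 d3) => /andP[sd s3'];
  try by have := ltC _ s3 s3'.
- case/orP: (exprz_lt1 p1 d1) => /andP[sd' s1]; last by move: sd sd'; clear; lia.
  case/orP: (exprz_lt1 p1 b1) => /andP[sb' s1']; first by move: sb sb'; clear; lia.
  by have := ltC _ s1 s1'.
- by have := ltC _ s3' s3.
case/orP: (exprz_lt1 p1 d1) => /andP[sd' s1]; first by move: sd sd'; clear; lia.
case/orP: (exprz_lt1 p1 b1) => /andP[sb' s1']; last by move: sb sb'; clear; lia.
by have := ltC _ s1' s1.
Qed.
End IndependentUnit.

(** * Characters of finitely generated multiplicative groups *)

Lemma map_intr_mx_inj m n : injective (map_mx intr : 'M[int]_(m, n) -> 'M[rat]_(m, n)).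
Proof.
move=> A B /matrixP eqAB; apply/matrixP => i j.
by have := eqAB i j; rewrite !mxE => /intr_inj.
Qed.

Lemma common_denominator m n (A : 'M[rat]_(m, n)) :
  exists2 N : int, 0 < N & exists B : 'M[int]_(m, n), map_mx intr B = N%:~R *: A.
Proof.
pose N := \prod_i \prod_j denq (A i j).
have N_gt0 : 0 < N by apply: prodr_gt0 => i _; apply: prodr_gt0 => j _; apply: denq_gt0.
exists N => //; exists (\matrix_(i, j) numq (N%:~R * A i j)).
apply/matrixP => i j; rewrite !mxE.
suff /intrP[k ->] : N%:~R * A i j \is a Num.int by rewrite numq_int.
rewrite /N (bigD1 i) //= (bigD1 j) //=; set P := \prod_(_ | _) _; set Q := \prod_(_ | _) _.
have -> : (denq (A i j) * P * Q)%:~R * A i j = (P * Q * numq (A i j))%:~R.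
  by rewrite !intrM numqE; ring.
exact: intr_int.
Qed.

Section Characters.
Variables (F : fieldType) (r : nat) (mu : 'I_r -> F).
Hypothesis nz_mu : forall k, mu k != 0.

Let chi (e : 'rV[int]_r) := \prod_k mu k ^ e 0 k.

Let chiD e f : chi (e + f) = chi e * chi f.
Proof. by rewrite /chi -big_split; apply: eq_bigr => k _; rewrite mxE expfzDr. Qed.

Let chiZ c e : chi (c *: e) = chi e ^ c.
Proof.
rewrite /chi (big_morph (fun x => x ^ c) (fun x y => expfzMl x y c) (exp1rz _ c)).
by apply: eq_bigr => k _; rewrite mxE mulrC exprz_exp.
Qed.

Let chi_mul m (g : 'rV[int]_m) (R : 'M[int]_(m, r)) :
  (forall i, chi (row i R) = 1) -> chi (g *m R) = 1.
Proof.
move=> R1; rewrite mulmx_sum_row.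
apply: (big_ind (fun e => chi e = 1)) => [|e f e1 f1|i _].
- by rewrite /chi big1 // => k _; rewrite mxE expr0z.
- by rewrite chiD e1 f1 mulr1.
by rewrite chiZ R1 exp1rz.
Qed.

(** Finitely many relations span all of them over the rationals, since the
    rank of a family of relations is at most r. *)
Let spanning_relations : exists m (R : 'M[int]_(m, r)),
  (forall i, chi (row i R) = 1) /\
  (forall e, chi e = 1 -> (map_mx intr e <= (map_mx intr R : 'M[rat]_(m, r)))%MS).
Proof.
suff H n : (exists m (R : 'M[int]_(m, r)), (forall i, chi (row i R) = 1) /\
      (n <= \rank (map_mx intr R : 'M[rat]_(m, r)))%N) \/
    exists m (R : 'M[int]_(m, r)), (forall i, chi (row i R) = 1) /\
      (forall e, chi e = 1 -> (map_mx intr e <= (map_mx intr R : 'M[rat]_(m, r)))%MS).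
  by have [[m [R [_]]]|//] := H r.+1; rewrite leqNgt ltnS rank_leq_col.
elim: n => [|n [[m [R [R1 rkR]]]|]]; last by right.
  by left; exists 0%N, 0; split=> // -[].
have [all_e|/not_all_ex_not[e He]] := classic (forall e, chi e = 1 ->
    (map_mx intr e <= (map_mx intr R : 'M[rat]_(m, r)))%MS).
  by right; exists m, R.
left; have [e1 /negP nRe] := imply_to_and _ _ He.
exists (m + 1)%N, (col_mx R e); split.
  move=> i; case: (split_ordP i) => j ->; first by rewrite rowKu.
  by rewrite rowKd row_id.
have : (map_mx intr R < (map_mx intr (col_mx R e) : 'M[rat]_(m + 1, r)))%MS.
  rewrite ltmxE map_col_mx -addsmxE addsmxSl /=; apply: contra nRe.
  by rewrite col_mx_sub => /andP[].
by rewrite ltmxErank => /andP[_]; apply: leq_ltn_trans.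
Qed.

(** Rows of D are elements of the group generated by the mu k, given by their
    exponents, and b prescribes integral values on them; c is a character of
    the whole group, given by its values on the generators. It is a solution
    of a linear system whose rows are the relations, with value 0, and the
    rows of D. The system is solvable over the rationals as soon as each
    integral combination of rows that vanishes also kills the prescribed
    values, and such a combination is a relation between the rows of D; N
    clears denominators. *)
Lemma extend_character p (D : 'M[int]_(p, r)) (b : 'cV[int]_p) :
  (forall f : 'rV[int]_p, \prod_k mu k ^ (f *m D) 0 k = 1 -> f *m b = 0) ->
  exists c : 'cV[int]_r, exists2 N : int, 0 < N &
    (forall e : 'rV[int]_r, \prod_k mu k ^ e 0 k = 1 -> e *m c = 0) /\ D *m c = N *: b.
Proof.
move=> Db; have [m [R [R1 spanR]]] := spanning_relations.
pose toQ k l (A : 'M[int]_(k, l)) : 'M[rat]_(k, l) := map_mx intr A.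
pose M := col_mx R D; pose w : 'cV[int]_(m + p) := col_mx 0 b.
have [c0 Dc0] : exists c0 : 'cV[rat]_r, toQ _ _ M *m c0 = toQ _ _ w.
  suff /submxP[C DC] : ((toQ _ _ w)^T <= (toQ _ _ M)^T)%MS.
    by exists C^T; apply: trmx_inj; rewrite trmx_mul trmxK.
  rewrite submxE; set K := cokermx _; apply/eqP/trmx_inj; rewrite trmx0 trmx_mul trmxK.
  have KM : K^T *m toQ _ _ M = 0 by apply: trmx_inj; rewrite trmx_mul trmxK mulmx_coker trmx0.
  have [N N_gt0 [K' DK']] := common_denominator K^T.
  have NK0 : toQ _ _ (K' *m M) = 0 by rewrite /toQ map_mxM /= DK' -scalemxAl KM scaler0.
  have K'M : K' *m M = 0.
    by apply: map_intr_mx_inj; rewrite [LHS]NK0 map_mx0.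
  suff K'w : K' *m w = 0.
    have : toQ _ _ (K' *m w) = 0 by rewrite K'w /toQ map_mx0.
    rewrite /toQ map_mxM DK' -scalemxAl => /eqP; rewrite scaler_eq0 intr_eq0 gt_eqF //=.
    by move/eqP.
  apply/row_matrixP => i; rewrite row_mul row0 -[row i K']hsubmxK mul_row_col mulmx0 add0r.
  apply: Db; rewrite -/(chi _); have := congr1 (row i) K'M.
  rewrite row_mul row0 -[row i K']hsubmxK mul_row_col row_mxKr.
  move/eqP; rewrite addrC addr_eq0 => /eqP ->; rewrite -mulNmx; exact: chi_mul.
have [N N_gt0 [c Dc]] := common_denominator c0.
have Mc : M *m c = N *: w.
  apply: map_intr_mx_inj.
  by rewrite map_mxM Dc -scalemxAr [_ *m _]Dc0 map_mxZ.
move: Mc; rewrite /M /w mul_col_mx scale_col_mx scaler0 => /eq_col_mx[Rc Dc'].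
exists c, N => //; split=> // e e1; have /submxP[g Dg] := spanR e e1.
apply: map_intr_mx_inj.
by rewrite map_mxM Dg -mulmxA -map_mxM Rc !map_mx0 mulmx0.
Qed.
End Characters.

(** Writing the elements of rs as quotients of elements of Lam gives the rows
    of the matrix D of extend_character. *)
Lemma extend_character_seq (F : fieldType) (Lam rs : seq F) (beta : F -> int) :
  uniq Lam -> uniq rs -> (forall z, z \in Lam -> z != 0) ->
  (forall r, r \in rs -> exists a b, [/\ a \in Lam, b \in Lam & a = r * b]) ->
  (forall f : F -> int, \prod_(r <- rs) r ^ f r = 1 -> \sum_(r <- rs) f r * beta r = 0) ->
  exists c : F -> int, exists2 N : int, 0 < N &
    (forall e : F -> int, \prod_(z <- Lam) z ^ e z = 1 -> \sum_(z <- Lam) e z * c z = 0) /\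
    (forall r a b, r \in rs -> a \in Lam -> b \in Lam -> a = r * b -> c a - c b = N * beta r).
Proof.
move=> uniqL uniqr nzL ratio rel.
pose l := size Lam; pose p := size rs.
pose mu (k : 'I_l) := Lam`_k.
have nz_mu k : mu k != 0 by rewrite nzL ?mem_nth.
have /fin_all_exists[ab abP] (i : 'I_p) : exists ab : 'I_l * 'I_l, mu ab.1 = rs`_i * mu ab.2.
  have [|a [b [aL bL Dab]]] := ratio rs`_i; first exact: mem_nth.
  have lta : (index a Lam < l)%N by rewrite index_mem.
  have ltb : (index b Lam < l)%N by rewrite index_mem.
  by exists (Ordinal lta, Ordinal ltb); rewrite /mu /= !nth_index.
pose d (k : 'I_l) : 'rV[int]_l := delta_mx 0 k.
pose D : 'M[int]_(p, l) := \matrix_i (d (ab i).1 - d (ab i).2).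
pose b : 'cV[int]_p := \col_i beta rs`_i.
have chi_d k : \prod_j mu j ^ d k 0 j = mu k.
  rewrite (bigD1 k) //= mxE !eqxx expr1z big1 ?mulr1 // => j jk.
  by rewrite mxE (negPf jk).
have chiB e f : \prod_j mu j ^ (e - f : 'rV[int]_l) 0 j =
    (\prod_j mu j ^ e 0 j) / \prod_j mu j ^ f 0 j.
  rewrite -prodfV -big_split; apply: eq_bigr => j _.
  by rewrite !mxE expfzDr // -invr_expz.
have chi_row i : \prod_j mu j ^ D i j = rs`_i.
  transitivity (\prod_j mu j ^ (d (ab i).1 - d (ab i).2) 0 j).
    by apply: eq_bigr => j _; rewrite mxE.
  by rewrite chiB !chi_d abP mulfK.
have chi_mul (f : 'rV[int]_p) : \prod_j mu j ^ (f *m D) 0 j = \prod_(i < p) rs`_i ^ f 0 i.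
  under eq_bigr => j _.
    rewrite mxE (big_morph (fun c => mu j ^ c) (id1 := 1) (op1 := *%R)); last by rewrite expr0z.
      over.
    by move=> c c'; rewrite expfzDr.
  rewrite exchange_big; apply: eq_bigr => i _; rewrite -[X in _ = X ^ _]chi_row.
  rewrite (big_morph (fun x => x ^ f 0 i) (fun x y => expfzMl x y (f 0 i)) (exp1rz _ _)).
  by apply: eq_bigr => j _; rewrite exprz_exp mulrC.
have [|c [N N_gt0 [c_rel Dc]]] := extend_character nz_mu (D := D) (b := b).
  move=> f; rewrite chi_mul => f1; apply/matrixP => i0 j0; rewrite !mxE !ord1.
  have := rel (fun r => oapp (f 0) 0 (insub (index r rs) : option 'I_p)).
  have fE (i : 'I_p) : oapp (f 0) 0 (insub (index rs`_i rs) : option 'I_p) = f 0 i.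
    by rewrite index_uniq // valK.
  rewrite !(big_nth (0 : F)) !big_mkord => rel_f.
  under eq_bigr => i _ do rewrite mxE.
  rewrite -[RHS]rel_f; first by apply: eq_bigr => i _; rewrite fE.
  by rewrite -[RHS]f1; apply: eq_bigr => i _; rewrite fE.
pose c' z := oapp (fun k => c k 0) 0 (insub (index z Lam) : option 'I_l).
have c'E (k : 'I_l) : c' Lam`_k = c k 0 by rewrite /c' index_uniq // valK.
have c'_rel (e : F -> int) : \prod_(z <- Lam) z ^ e z = 1 -> \sum_(z <- Lam) e z * c' z = 0.
  rewrite !(big_nth (0 : F)) !big_mkord => e1.
  have := c_rel (\row_k e Lam`_k); rewrite -[X in _ = X -> _]e1 => /(_ _)/matrixP/(_ 0 0).
  rewrite !mxE => H; rewrite -[RHS]H.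
    by apply: eq_bigr => k _; rewrite mxE c'E.
  by apply: eq_bigr => k _; rewrite mxE.
exists c', N => //; split=> // r a b' r_rs a_L b_L Dab.
have lti : (index r rs < p)%N by rewrite index_mem.
pose i := Ordinal lti; have Dr : rs`_i = r by rewrite /= nth_index.
have [k1 Dk1] : exists k : 'I_l, mu k = a.
  have lta : (index a Lam < l)%N by rewrite index_mem.
  by exists (Ordinal lta); rewrite /mu /= nth_index.
have [k2 Dk2] : exists k : 'I_l, mu k = b'.
  have ltb : (index b' Lam < l)%N by rewrite index_mem.
  by exists (Ordinal ltb); rewrite /mu /= nth_index.
have Ec : (d k1 - d k2 - (d (ab i).1 - d (ab i).2)) *m c = 0.
  apply: c_rel; rewrite !chiB !chi_d Dk1 Dk2 abP Dr Dab.
  have nz_b' := nzL _ b_L; have nz_r : r != 0.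
    by apply: contraNneq (nzL _ a_L) => r0; rewrite Dab r0 mul0r.
  by rewrite !mulfK // divff.
have Dci : row (ab i).1 c - row (ab i).2 c = row i (N *: b).
  by rewrite -Dc row_mul rowK mulmxBl -!rowE.
move: Ec; rewrite !mulmxBl -!rowE Dci => /matrixP/(_ 0 0); rewrite !mxE Dr.
by move/eqP; rewrite subr_eq0 -Dk1 -Dk2 !c'E => /eqP.
Qed.

(** * Exponential polynomials *)

Section ExponentialPolynomials.
Variables (F : fieldType) (pchar0 : [pchar F] =i pred0).

Let natF_inj (i j : nat) : i%:R = j%:R :> F -> i = j.
Proof.
wlog le_ij : i j / (i <= j)%N.
  by move=> W; case/orP: (leq_total i j) => /W // H /esym/H.
have /pcharf0P natF0 := pchar0.
move=> /eqP; rewrite eq_sym -subr_eq0 -natrB // natF0.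
  by rewrite subn_eq0 => le_ji; apply/eqP; rewrite eqn_leq le_ij.
Qed.

Lemma poly_nat_eq0 (p : {poly F}) : (forall j : nat, p.[j%:R] = 0) -> p = 0.
Proof.
move=> p0; apply/eqP/negPn/negP => nz_p.
have roots_p : all (root p) [seq j%:R | j <- iota 0 (size p)].
  by apply/allP => _ /mapP[j _ ->]; apply/rootP.
have := max_poly_roots nz_p roots_p; rewrite size_map size_iota ltnn.
by rewrite map_inj_uniq ?iota_uniq => [/(_ isT)|] //; exact: natF_inj.
Qed.

Let shift (p : {poly F}) := p \Po ('X + 1%:P).

Let shiftE p (j : nat) : (shift p).[j%:R] = p.[j.+1%:R].
Proof. by rewrite horner_comp !hornerE -natr1. Qed.

Let size_shift p : size (shift p) = size p.
Proof. by rewrite size_comp_poly2 // size_XaddC. Qed.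

Let lead_shift p : lead_coef (shift p) = lead_coef p.
Proof. by rewrite lead_coef_comp ?size_XaddC // lead_coefXaddC expr1n mulr1. Qed.

(** The effect on the term p(j) b^j of the operator that sends the sequence f
    to f(j + 1) - c f(j). *)
Let diff (c : F) (t : {poly F} * F) : {poly F} * F :=
  (t.2 *: shift t.1 - c *: t.1, t.2).

(** The operator f(j + 1) - c f(j) lowers the degree of the coefficient of the
    base c and raises none of the others. By induction on the total size it
    kills all the coefficients, so that the coefficient of c is constant and
    the others vanish; the value at j = 0 concludes. *)
Lemma exponential_polynomials_free (s : seq ({poly F} * F)) :
  uniq (unzip2 s) -> (forall t, t \in s -> t.2 != 0) ->
  (forall j : nat, \sum_(t <- s) t.1.[j%:R] * t.2 ^+ j = 0) ->
  forall t, t \in s -> t.1 = 0.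
Proof.
have [n] := ubnP (\sum_(t <- s) size t.1)%N; elim: n s => // n IH s le_sn uniq_s nz_s sum0.
have [all0 t t_s|/allPn[[p0 c] pc_s nz_p0]] := altP (@allP _ (fun t => t.1 == 0) s).
  by apply/eqP/all0.
have nz_c := nz_s _ pc_s; rewrite /= in nz_c nz_p0.
have sz_diff t : t \in s -> (size (diff c t).1 <= size t.1)%N.
  move=> _; rewrite (leq_trans (size_polyD _ _)) // size_polyN geq_max.
  by rewrite !(leq_trans (size_scale_leq _ _)) // size_shift.
have lt_diff : (size (diff c (p0, c)).1 < size p0)%N.
  rewrite /diff /= -scalerBr size_scale //.
  have : (size (shift p0 - p0)%R <= size p0)%N.
    by rewrite (leq_trans (size_polyD _ _)) // size_polyN geq_max size_shift leqnn.
  rewrite leq_eqVlt => /orP[/eqP eq_sz|//].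
  have := lead_shift p0; rewrite !lead_coefE size_shift => /eqP.
  rewrite -subr_eq0 -coefB -eq_sz -lead_coefE lead_coef_eq0 -size_poly_eq0 eq_sz.
  by rewrite size_poly_eq0 (negPf nz_p0).
have diff0 t : t \in s -> (diff c t).1 = 0.
  move=> t_s; apply: (IH [seq diff c t | t <- s]); last exact: map_f.
  - rewrite big_map (big_rem _ pc_s) /= -ltnS (leq_trans _ le_sn) // ltnS.
    rewrite [X in (_ < X)%N](big_rem _ pc_s) /= -addSn leq_add // !big_seq leq_sum // => u.
    by move/mem_rem; apply: sz_diff.
  - by rewrite /unzip2 -map_comp.
  - by move=> _ /mapP[u u_s ->]; apply: (nz_s u).
  move=> j; rewrite big_map /=.
  transitivity (\sum_(t <- s) (t.1.[j.+1%:R] * t.2 ^+ j.+1) - c * \sum_(t <- s) (t.1.[j%:R] * t.2 ^+ j)).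
    rewrite mulr_sumr -sumrB; apply: eq_bigr => u _.
    by rewrite hornerD hornerN !hornerZ shiftE exprS; ring.
  by rewrite !sum0 mulr0 subrr.
have other u : u \in s -> u.2 != c -> u.1 = 0.
  move=> u_s ne_uc; have /eqP := diff0 u u_s; rewrite subr_eq0 => /eqP/(congr1 lead_coef).
  rewrite !lead_coefZ lead_shift => /eqP; rewrite -subr_eq0 -mulrBl mulf_eq0 subr_eq0.
  by rewrite (negPf ne_uc) lead_coef_eq0 => /eqP.
have p0_const j : p0.[j%:R] = p0.[0].
  elim: j => // j <-; have /eqP := diff0 _ pc_s; rewrite /diff /= -scalerBr scaler_eq0 (negPf nz_c).
  by rewrite subr_eq0 -shiftE => /eqP ->.
case/eqP: nz_p0; apply: poly_nat_eq0 => j; rewrite p0_const.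
have := sum0 0%N; rewrite (big_rem _ pc_s) /= expr0 mulr1 big_seq big1 ?addr0 // => u u_rem.
rewrite other ?horner0 ?mul0r //; first exact: mem_rem u_rem.
have : uniq (unzip2 ((p0, c) :: rem (p0, c) s)).
  by rewrite -(perm_uniq (perm_map snd (perm_to_rem pc_s))).
by case/andP=> c_rem _; apply: contraNneq c_rem => uc; apply/mapP; exists u.
Qed.
End ExponentialPolynomials.

Section ExponentialPairs.
Variables (F : fieldType) (pchar0 : [pchar F] =i pred0).
Variable Psi : F -> F -> Prop.
Hypothesis Psi1 : Psi 1 1.
Hypothesis PsiM : forall a b c d, Psi a b -> Psi c d -> Psi (a * c) (b * d).
Hypothesis Psi_neq0 : forall a b, Psi a b -> a != 0.
Hypothesis Psi_fun : forall a b c, Psi a b -> Psi a c -> b = c.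

(** alpha is an exponential polynomial with bases in the domain of Psi, and
    beta is what it becomes when j is replaced by 0 in its coefficients and
    each base by its image under Psi. Such pairs are stable under polynomial
    operations. *)
Definition exp_pair (alpha : nat -> F) (beta : F) : Prop :=
  exists T : seq ({poly F} * (F * F)),
  [/\ forall t, t \in T -> Psi t.2.1 t.2.2,
      forall j : nat, alpha j = \sum_(t <- T) t.1.[j%:R] * t.2.1 ^+ j
    & beta = \sum_(t <- T) t.1.[0] * t.2.2].

Lemma exp_pair_term p a b : Psi a b -> exp_pair (fun j => p.[j%:R] * a ^+ j) (p.[0] * b).
Proof.
move=> ab; exists [:: (p, (a, b))]; split=> [t|j|]; rewrite ?big_seq1 //.
by rewrite inE => /eqP->.
Qed.

Lemma exp_pair_ext alpha alpha' beta : (forall j, alpha j = alpha' j) ->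
  exp_pair alpha' beta -> exp_pair alpha beta.
Proof. by move=> eqa [T [TP Ta Tb]]; exists T; split=> // j; rewrite eqa. Qed.

Lemma exp_pair_const c : exp_pair (fun=> c) c.
Proof.
have := exp_pair_term c%:P Psi1; rewrite hornerC mulr1; apply: exp_pair_ext => j.
by rewrite hornerC expr1n mulr1.
Qed.

Lemma exp_pairD a1 b1 a2 b2 : exp_pair a1 b1 -> exp_pair a2 b2 ->
  exp_pair (fun j => a1 j + a2 j) (b1 + b2).
Proof.
move=> [T1 [P1 A1 ->]] [T2 [P2 A2 ->]]; exists (T1 ++ T2); split=> [t|j|].
- by rewrite mem_cat => /orP[/P1|/P2].
- by rewrite big_cat A1 A2.
by rewrite big_cat.
Qed.

Lemma exp_pairM a1 b1 a2 b2 : exp_pair a1 b1 -> exp_pair a2 b2 ->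
  exp_pair (fun j => a1 j * a2 j) (b1 * b2).
Proof.
move=> [T1 [P1 A1 ->]] [T2 [P2 A2 ->]].
exists [seq (t.1 * u.1, (t.2.1 * u.2.1, t.2.2 * u.2.2)) | t <- T1, u <- T2]; split.
- by move=> _ /allpairsP[[t u] /= [t_T u_T ->]] /=; apply: PsiM; [apply: P1|apply: P2].
- move=> j; rewrite big_allpairs_dep A1 A2 mulr_suml; apply: eq_bigr => t _.
  by rewrite mulr_sumr; apply: eq_bigr => u _; rewrite /= hornerM exprMn; ring.
rewrite big_allpairs_dep mulr_suml; apply: eq_bigr => t _.
by rewrite mulr_sumr; apply: eq_bigr => u _; rewrite /= hornerM; ring.
Qed.

Lemma exp_pair_sum (I : eqType) (s : seq I) (a : I -> nat -> F) b :
  (forall i, i \in s -> exp_pair (a i) (b i)) ->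
  exp_pair (fun j => \sum_(i <- s) a i j) (\sum_(i <- s) b i).
Proof.
elim: s => [|i s IH] ab.
  by rewrite big_nil; apply: exp_pair_ext (exp_pair_const 0) => j; rewrite big_nil.
have ab_s k : k \in s -> exp_pair (a k) (b k) by move=> k_s; apply: ab; rewrite inE k_s orbT.
rewrite big_cons; apply: exp_pair_ext (exp_pairD (ab i (mem_head _ _)) (IH ab_s)) => j.
by rewrite big_cons.
Qed.

Lemma exp_pairX a b k : exp_pair a b -> exp_pair (fun j => a j ^+ k) (b ^+ k).
Proof.
move=> ab; elim: k => [|k IH]; first exact: exp_pair_const.
by rewrite exprS; apply: exp_pair_ext (exp_pairM ab IH) => j; rewrite exprS.
Qed.

Lemma exp_pair_prod (I : Type) (s : seq I) (a : I -> nat -> F) b :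
  (forall i, exp_pair (a i) (b i)) ->
  exp_pair (fun j => \prod_(i <- s) a i j) (\prod_(i <- s) b i).
Proof.
move=> ab; elim: s => [|i s IH].
  by rewrite big_nil; apply: exp_pair_ext (exp_pair_const 1) => j; rewrite big_nil.
rewrite big_cons; apply: exp_pair_ext (exp_pairM (ab i) IH) => j.
by rewrite big_cons.
Qed.

Lemma exp_pair_meval m (f : {mpoly F[m]}) (a : 'I_m -> nat -> F) b :
  (forall i, exp_pair (a i) (b i)) ->
  exp_pair (fun j => f.@[fun i => a i j]) f.@[b].
Proof.
move=> ab; rewrite mevalE.
apply: (@exp_pair_ext _ (fun j => \sum_(k <- msupp f) f@_k * \prod_i a i j ^+ k i)).
  by move=> j; rewrite mevalE.
apply: exp_pair_sum => k _; apply: exp_pairM; first exact: exp_pair_const.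
by apply: exp_pair_prod => i; apply: exp_pairX.
Qed.

(** Grouping the terms with the same base, and hence with the same image since
    Psi is single-valued, each coefficient vanishes by
    exponential_polynomials_free. *)
Lemma exp_pair_eq0 alpha beta : exp_pair alpha beta -> (forall j, alpha j = 0) -> beta = 0.
Proof.
move=> [T [PT ET ->]] alpha0; pose U := undup [seq t.2.1 | t <- T].
have uniqU : uniq U := undup_uniq _.
have inU t : t \in T -> t.2.1 \in U by move=> t_T; rewrite mem_undup; apply: map_f t_T.
have regroup (G : {poly F} * (F * F) -> F) :
    \sum_(t <- T) G t = \sum_(c <- U) \sum_(t <- T | t.2.1 == c) G t.
  rewrite (exchange_big_dep predT) //= !big_seq; apply: eq_bigr => t t_T.
  rewrite (eq_bigl (fun c => c == t.2.1)) => [|c]; last exact: eq_sym.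
  by rewrite -big_filter filter_pred1_uniq ?inU // big_seq1.
pose P c := \sum_(t <- T | t.2.1 == c) t.1.
have P0 c : c \in U -> P c = 0.
  move=> c_U; pose s := [seq (P d, d) | d <- U].
  apply: (exponential_polynomials_free pchar0 (s := s) _ _ _ (t := (P c, c))).
  - by rewrite /unzip2 -map_comp map_id.
  - move=> _ /mapP[d + ->] /=; rewrite mem_undup => /mapP[t /PT Pt ->].
    exact: Psi_neq0 Pt.
  - move=> j; rewrite big_map -[RHS](alpha0 j) ET regroup; apply: eq_bigr => d _ /=.
    by rewrite horner_sum mulr_suml; apply: eq_bigr => t /eqP ->.
  exact: map_f.
rewrite regroup big_seq big1 // => c c_U.
have := c_U; rewrite mem_undup => /mapP[u u_T Dc].
transitivity ((P c).[0] * u.2.2); last by rewrite P0 // horner0 mul0r.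
rewrite horner_sum mulr_suml [LHS]big_seq_cond [RHS]big_seq_cond; apply: eq_bigr => t /andP[t_T /eqP tc].
have Pt := PT t t_T; have Pu := PT u u_T; rewrite tc in Pt; rewrite -Dc in Pu.
by rewrite (Psi_fun Pt Pu).
Qed.
End ExponentialPairs.

(** * Spectral projections and the Zariski closure of the powers of a matrix *)

Section PolynomialIdempotents.
Variables (F : fieldType) (Lam : seq F) (N : nat).
Hypotheses (uniq_Lam : uniq Lam) (N_gt0 : (0 < N)%N).

Lemma dvdp_prod_XsubC_exp (h : {poly F}) :
  (forall z, z \in Lam -> ('X - z%:P) ^+ N %| h) ->
  \prod_(z <- Lam) ('X - z%:P) ^+ N %| h.
Proof.
elim: Lam uniq_Lam => [|z s IH] /=; first by rewrite big_nil dvd1p.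
move=> /andP[z_s uniq_s] dvd_h; rewrite big_cons Gauss_dvdp.
  by rewrite dvd_h ?mem_head //= IH // => w w_s; rewrite dvd_h // inE w_s orbT.
rewrite big_seq; apply: (big_ind (coprimep _)) => [|u v Hu Hv|w w_s].
- exact: coprimep1.
- by rewrite coprimepMr Hu.
rewrite coprimep_expl // coprimep_expr // coprimep_XsubC2 //.
by rewrite subr_eq0; apply: contraNneq z_s => <-.
Qed.

Let lagr z := \prod_(w <- Lam | w != z) ('X - w%:P).

(** With l the Lagrange polynomial that is 1 at z and 0 on the rest of Lam,
    the polynomial 1 - (1 - l^N)^N is 1 modulo (X-z)^N and 0 modulo (X-w)^N
    for the other w. This explicit choice makes the compatibility with field
    automorphisms plain. *)
Definition spectral_poly (z : F) : {poly F} :=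
  1 - (1 - ((lagr z).[z]^-1 *: lagr z) ^+ N) ^+ N.

Lemma spectral_poly1 z : ('X - z%:P) ^+ N %| spectral_poly z - 1.
Proof.
rewrite /spectral_poly addrAC subrr sub0r dvdpNr dvdp_exp2r //.
set l := _ *: _; have lz : l.[z] = 1.
  rewrite hornerZ mulVf // horner_prod prodf_seq_neq0; apply/allP => w _.
  by apply/implyP; rewrite hornerXsubC subr_eq0 eq_sym.
by rewrite -root_factor_theorem rootE hornerD hornerN horner_exp lz hornerC expr1n subrr.
Qed.

Lemma spectral_poly0 z w : w \in Lam -> w != z -> ('X - w%:P) ^+ N %| spectral_poly z.
Proof.
move=> w_Lam wz; rewrite /spectral_poly; set l := _ *: _.
have nz_lz : (lagr z).[z] != 0.
  rewrite horner_prod prodf_seq_neq0; apply/allP => c _.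
  by apply/implyP; rewrite hornerXsubC subr_eq0 eq_sym.
have dvd_l : ('X - w%:P) ^+ N %| l ^+ N.
  by rewrite dvdp_exp2r // dvdpZr ?invr_eq0 // /lagr (big_rem w) //= wz dvdp_mulIl.
have := subrXX 1 (1 - l ^+ N) N; rewrite expr1n subKr => ->.
by rewrite dvdp_mulr.
Qed.

End PolynomialIdempotents.

Section Spectral.
Variables (F : fieldType) (n' : nat).
Local Notation n := n'.+1.
Variables (s : 'M[F]_n) (rs : seq F).
Hypothesis Ds : char_poly s = \prod_(r <- rs) ('X - r%:P).

Let Lam := undup rs.
Let uniq_Lam : uniq Lam := undup_uniq rs.

Let size_rs : size rs = n.
Proof. by have := size_char_poly s; rewrite Ds size_prod_XsubC => -[]. Qed.

(** The multiplicity of each root is at most n, so that the characteristic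
    polynomial divides h. *)
Lemma horner_mx_eq0 (h : {poly F}) :
  (forall z, z \in Lam -> ('X - z%:P) ^+ n %| h) -> horner_mx s h = 0.
Proof.
move=> /(dvdp_prod_XsubC_exp uniq_Lam) dvd_h.
have : char_poly s %| h.
  apply: dvdp_trans dvd_h; rewrite Ds -prodr_undup_exp_count -/Lam.
  apply: (big_ind2 (fun u v => u %| v)) => [|*|z _]; rewrite ?dvdpp ?dvdp_mul //.
  by rewrite dvdp_exp2l // -size_rs count_size.
by move=> /dvdpP[g ->]; rewrite rmorphM /= Cayley_Hamilton mulr0.
Qed.

(** The projection onto the generalised eigenspace of z. *)
Definition spectral_proj z := horner_mx s (spectral_poly Lam n z).
Local Notation E := spectral_proj.

Lemma spectral_proj_sum : \sum_(z <- Lam) E z = 1.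
Proof.
apply/eqP; rewrite -subr_eq0 -(rmorph_sum (horner_mx s)) -(rmorph1 (horner_mx s)).
rewrite -rmorphB; apply/eqP/horner_mx_eq0 => w w_Lam.
rewrite (big_rem w) //= addrAC addrC.
apply: dvdp_add; last exact: spectral_poly1.
rewrite big_seq; apply: (big_ind (fun h => _ %| h)) => [|h g Hh Hg|z].
- exact: dvdp0.
- exact: dvdp_add.
rewrite mem_rem_uniq // inE => /andP[ne_zw z_Lam].
by rewrite spectral_poly0 // eq_sym.
Qed.

Lemma spectral_projM z w : z \in Lam -> w \in Lam ->
  E z * E w = (z == w)%:R *: E z.
Proof.
move=> z_Lam w_Lam; have [->|ne] := eqVneq z w.
  rewrite scale1r; apply/eqP; rewrite -subr_eq0 -rmorphM -rmorphB; apply/eqP/horner_mx_eq0 => c c_Lam.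
  set e := spectral_poly _ _ _; have -> : e * e - e = e * (e - 1) by ring.
  rewrite /e; have [->|ne_cw] := eqVneq c w.
    by rewrite dvdp_mull ?spectral_poly1.
  by rewrite dvdp_mulr ?spectral_poly0.
rewrite scale0r -rmorphM; apply: horner_mx_eq0 => c c_Lam.
have [->|ne_cw] := eqVneq c w; first by rewrite dvdp_mulr // spectral_poly0 // eq_sym.
by rewrite dvdp_mull ?spectral_poly0.
Qed.

Lemma spectral_proj_nilp z k : (n <= k)%N -> (s - z%:M) ^+ k * E z = 0.
Proof.
move=> le_nk; have -> : s - z%:M = horner_mx s ('X - z%:P).
  by rewrite rmorphB /= horner_mx_X horner_mx_C.
rewrite -rmorphXn -rmorphM; apply: horner_mx_eq0 => w w_Lam.
have [->|ne] := eqVneq w z; first by rewrite dvdp_mulr // dvdp_exp2l.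
by rewrite dvdp_mull ?spectral_poly0.
Qed.

(** Since s * v = lam *: (v * s), multiplication by v maps the generalised
    eigenspace of b into that of lam * b. *)
Lemma spectral_proj_conj (v : 'M[F]_n) lam a b : a \in Lam -> b \in Lam -> lam != 0 ->
  s * v = lam *: (v * s) -> a != lam * b -> E a * v * E b = 0.
Proof.
move=> a_Lam b_Lam nz_lam sv ne_ab.
have factor c : horner_mx s ('X - c%:P) = s - c%:M.
  by rewrite rmorphB /= horner_mx_X horner_mx_C.
have kill_b : (s - (lam * b)%:M) ^+ n * (v * E b) = 0.
  have sbv : (s - (lam * b)%:M) * v = lam *: (v * (s - b%:M)).
    rewrite mulrBl mulrBr sv scalerBr [_%:M * v]mul_scalar_mx [v * _%:M]mul_mx_scalar.
    by rewrite scalerA.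
  have conj_b k : (s - (lam * b)%:M) ^+ k * v = lam ^+ k *: (v * (s - b%:M) ^+ k).
    elim: k => [|k IH]; first by rewrite !expr0 scale1r mul1r mulr1.
    by rewrite exprS -mulrA IH -scalerAr mulrA sbv -scalerAl scalerA -exprSr -mulrA -exprS.
  by rewrite mulrA conj_b -scalerAl -mulrA spectral_proj_nilp // mulr0 scaler0.
have kill_a : E a * (s - a%:M) ^+ n = 0.
  rewrite -factor -rmorphXn -rmorphM mulrC rmorphM rmorphXn /= factor.
  exact: spectral_proj_nilp.
have /Bezout_coprimepP[[f g] /=] : coprimep (('X - a%:P) ^+ n) (('X - (lam * b)%:P) ^+ n).
  by rewrite coprimep_expl // coprimep_expr // coprimep_XsubC2 // subr_eq0 eq_sym.
rewrite -size_poly_eq1 => /size_poly1P[c nz_c Dc].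
have := congr1 (horner_mx s) Dc; rewrite rmorphD rmorphM rmorphXn /= factor [X in _ + X](rmorphM (horner_mx s) g).
rewrite /= [X in _ + _ * X]rmorphXn /= factor horner_mx_C => Dcs.
have comm_a : GRing.comm (E a) (horner_mx s f) by rewrite /GRing.comm -!rmorphM mulrC.
apply/eqP; rewrite -(inj_eq (scalerI nz_c)) scaler0 -mulrA.
rewrite scalerAl -[c *: E a]mul_mx_scalar -[_ *m _]/(E a * _) -Dcs mulrDr mulrDl.
rewrite [X in X * _ + _]mulrA comm_a -[X in X * _ + _]mulrA kill_a mulr0 mul0r add0r.
by rewrite -!mulrA kill_b !mulr0.
Qed.

Variable T : F -> F.
(** The semisimple matrix that acts as the scalar T z on the generalised
    eigenspace of z. *)
Definition spectral_fun := \sum_(z <- Lam) T z *: E z.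
Local Notation t := spectral_fun.

Lemma spectral_decomp (v : 'M[F]_n) :
  v = \sum_(a <- Lam) \sum_(b <- Lam) E a * v * E b.
Proof.
rewrite -[LHS]mul1r -[LHS]mulr1 -[in LHS]spectral_proj_sum mulr_suml mulr_suml.
by apply: eq_bigr => a _; rewrite -mulr_sumr.
Qed.

Lemma eigenvector_ratio (v : 'M[F]_n) lam : v != 0 -> lam != 0 ->
  s * v = lam *: (v * s) -> exists a b, [/\ a \in Lam, b \in Lam & a = lam * b].
Proof.
move=> nz_v nz_lam sv; apply: NNPP => none; case/eqP: nz_v.
rewrite (spectral_decomp v) big_seq big1 // => a a_Lam; rewrite big_seq big1 // => b b_Lam.
apply: (spectral_proj_conj a_Lam b_Lam nz_lam sv); apply/eqP => Dab.
by apply: none; exists a, b.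
Qed.

Lemma spectral_fun_conj (v : 'M[F]_n) lam tau : lam != 0 ->
  s * v = lam *: (v * s) ->
  (forall a b, a \in Lam -> b \in Lam -> a = lam * b -> T a = tau * T b) ->
  t * v = tau *: (v * t).
Proof.
move=> nz_lam sv Ttau.
have -> : t * v = \sum_(a <- Lam) \sum_(b <- Lam) T a *: (E a * v * E b).
  rewrite -[LHS]mulr1 -[in LHS]spectral_proj_sum /spectral_fun !mulr_suml.
  apply: eq_bigr => a _; rewrite mulr_sumr; apply: eq_bigr => b _.
  by rewrite -!scalerAl.
have -> : v * t = \sum_(a <- Lam) \sum_(b <- Lam) T b *: (E a * v * E b).
  rewrite -[LHS]mul1r -[in LHS]spectral_proj_sum mulr_suml.
  apply: eq_bigr => a _; rewrite /spectral_fun mulrA mulr_sumr; apply: eq_bigr => b _.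
  by rewrite -scalerAr.
rewrite scaler_sumr !big_seq; apply: eq_bigr => a a_Lam.
rewrite scaler_sumr !big_seq; apply: eq_bigr => b b_Lam; rewrite scalerA.
have [Dab|ne_ab] := eqVneq a (lam * b); first by rewrite (Ttau a b).
by rewrite (spectral_proj_conj a_Lam b_Lam nz_lam sv ne_ab) !scaler0.
Qed.

End Spectral.

Section SpectralFunction.
Variables (F : fieldType) (n' : nat) (s : 'M[F]_n'.+1) (rs : seq F).
Hypothesis Ds : char_poly s = \prod_(r <- rs) ('X - r%:P).
Local Notation fn := (spectral_fun s rs).

Lemma spectral_fun1 : fn (fun=> 1) = 1.
Proof.
by rewrite -(spectral_proj_sum Ds); apply: eq_bigr => z _; rewrite scale1r.
Qed.

Lemma eq_spectral_fun T T' : {in undup rs, T =1 T'} -> fn T = fn T'.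
Proof.
by move=> eqT; rewrite /spectral_fun !big_seq; apply: eq_bigr => z /eqT ->.
Qed.

Lemma spectral_funM T T' : fn T * fn T' = fn (fun z => T z * T' z).
Proof.
rewrite /spectral_fun mulr_suml !big_seq; apply: eq_bigr => z z_Lam.
rewrite -big_seq mulr_sumr (big_rem z) //= big_seq big1 ?addr0 => [|w].
  by rewrite -scalerAl -scalerAr (spectral_projM Ds) // eqxx scale1r scalerA.
rewrite mem_rem_uniq ?undup_uniq // inE => /andP[ne_wz w_Lam].
by rewrite -scalerAl -scalerAr (spectral_projM Ds) // eq_sym (negPf ne_wz) scale0r !scaler0.
Qed.

Lemma spectral_funX T k : fn T ^+ k = fn (fun z => T z ^+ k).
Proof.
elim: k => [|k IH].
  by rewrite expr0 -spectral_fun1; apply: eq_spectral_fun => z _; rewrite expr0.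
rewrite exprS IH spectral_funM; apply: eq_spectral_fun => z _; by rewrite exprS.
Qed.
End SpectralFunction.

Section BinomialPolynomial.
Variables (F : fieldType) (pchar0 : [pchar F] =i pred0).

Definition binom_poly k : {poly F} := k`!%:R^-1 *: \prod_(i < k) ('X - i%:R%:P).

Lemma horner_binom_poly k (j : nat) : (binom_poly k).[j%:R] = 'C(j, k)%:R.
Proof.
have /pcharf0P natF0 := pchar0.
apply: (mulfI (_ : k`!%:R != 0)); first by rewrite natF0 -lt0n fact_gt0.
rewrite hornerZ mulVKf ?natF0 -?lt0n ?fact_gt0 // -natrM mulnC bin_ffact horner_prod.
have [le_kj|lt_jk] := leqP k j.
  rewrite ffact_prod natr_prod; apply: eq_bigr => i _.
  by rewrite hornerXsubC natrB // ltnW // (leq_trans (ltn_ord i)).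
rewrite ffact_small // (bigD1 (Ordinal lt_jk)) //= hornerXsubC subrr mul0r //.
Qed.
End BinomialPolynomial.

Section ZariskiClosure.
Variables (F : fieldType) (pchar0 : [pchar F] =i pred0) (n' : nat).
Local Notation n := n'.+1.
Variables (s : 'M[F]_n) (rs : seq F).
Hypothesis Ds : char_poly s = \prod_(r <- rs) ('X - r%:P).
Let Lam := undup rs.
Hypothesis nz_Lam : forall z, z \in Lam -> z != 0.
Local Notation E := (spectral_proj s rs).

Let big_ord_trunc (V : zmodType) (G : nat -> V) m M :
  (m <= M)%N -> (forall k, (m <= k)%N -> G k = 0) -> \sum_(k < M) G k = \sum_(k < m) G k.
Proof.
move=> le_mM G0; rewrite (big_ord_widen M G le_mM) [RHS]big_mkcond.
by apply: eq_bigr => k _; case: ltnP => // /G0.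
Qed.

(** On the generalised eigenspace of z, expand the power of z + (s - z) by the
    binomial formula; s - z is nilpotent of order at most n there. *)
Lemma spectral_expX j : s ^+ j = \sum_(z <- Lam) \sum_(k < n)
  ('C(j, k)%:R * z ^+ j * z ^- k) *: ((s - z%:M) ^+ k * E z).
Proof.
rewrite -[LHS]mulr1 -(spectral_proj_sum Ds) mulr_sumr !big_seq.
apply: eq_bigr => z z_Lam; have nz_z := nz_Lam z_Lam.
pose G k := ('C(j, k)%:R * z ^+ j * z ^- k) *: ((s - z%:M) ^+ k * E z).
transitivity (\sum_(k < j.+1) G k); last first.
  transitivity (\sum_(k < (n + j).+1) G k).
    apply/esym/big_ord_trunc => [|k lt_jk]; first by lia.
    by rewrite /G bin_small // !mul0r scale0r.
  apply: big_ord_trunc => [|k le_nk]; first by lia.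
  by rewrite /G (spectral_proj_nilp Ds) // scaler0.
rewrite -{1}(subrK z%:M s) addrC exprDn_comm; last first.
  by rewrite /GRing.comm [_%:M * _]mul_scalar_mx [_ * _%:M]mul_mx_scalar.
rewrite mulr_suml; apply: eq_bigr => k _; rewrite /G mulrnAl -mulrA.
have -> : (z%:M : 'M[F]_n) ^+ (j - k) = (z ^+ (j - k))%:M by rewrite -rmorphXn.
rewrite [_%:M * _]mul_scalar_mx -scaler_nat scalerA; congr (_ *: _).
have Dz : z ^+ j = z ^+ (j - k) * z ^+ k by rewrite -exprD subnK // -ltnS.
by rewrite Dz -mulrA mulfK ?expf_neq0 // mulrC.
Qed.

Variable T : F -> F.
Hypothesis nz_T : forall z, z \in Lam -> T z != 0.
Hypothesis T_rel : forall e : F -> int,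
  \prod_(z <- Lam) z ^ e z = 1 -> \prod_(z <- Lam) T z ^ e z = 1.

(** The homomorphism, from the multiplicative group generated by Lam, that
    extends T; it is presented as a relation, and T_rel says that this
    relation is single-valued. *)
Let Psi (a b : F) : Prop := exists e : F -> int,
  a = \prod_(z <- Lam) z ^ e z /\ b = \prod_(z <- Lam) T z ^ e z.

Let prodD (G : F -> F) e f : (forall z, z \in Lam -> G z != 0) ->
  \prod_(z <- Lam) G z ^ (e z + f z) = (\prod_(z <- Lam) G z ^ e z) * \prod_(z <- Lam) G z ^ f z.
Proof.
move=> nzG; rewrite -big_split !big_seq; apply: eq_bigr => z z_Lam.
by rewrite expfzDr ?nzG.
Qed.

Let PsiM a b c d : Psi a b -> Psi c d -> Psi (a * c) (b * d).
Proof.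
by move=> [e [-> ->]] [f [-> ->]]; exists (fun z => e z + f z); rewrite !prodD.
Qed.

Let Psi_neq0 a b : Psi a b -> a != 0.
Proof.
move=> [e [-> _]]; rewrite prodf_seq_neq0; apply/allP => z z_Lam /=.
by rewrite expfz_neq0 // nz_Lam.
Qed.

Let Psi_fun a b c : Psi a b -> Psi a c -> b = c.
Proof.
move=> [e [-> ->]] [f [ef ->]].
have split_ef (G : F -> F) : (forall z, z \in Lam -> G z != 0) ->
    \prod_(z <- Lam) G z ^ e z =
    (\prod_(z <- Lam) G z ^ (e z - f z)) * \prod_(z <- Lam) G z ^ f z.
  by move=> nzG; rewrite -prodD //; apply: eq_bigr => z _; rewrite subrK.
rewrite (split_ef T nz_T) T_rel ?mul1r //.
have nzf : \prod_(z <- Lam) z ^ f z != 0.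
  by rewrite prodf_seq_neq0; apply/allP => z z_Lam; rewrite expfz_neq0 // nz_Lam.
by apply: (mulIf nzf); rewrite -(split_ef id) // mul1r.
Qed.

Let Psi_Lam z : z \in Lam -> Psi z (T z).
Proof.
move=> z_Lam; exists (fun w => (w == z)%:Z).
have single (G : F -> F) : G z = \prod_(w <- Lam) G w ^ (w == z)%:Z.
  rewrite (big_rem z) //= eqxx expr1z big_seq big1 ?mulr1 // => w.
  by rewrite mem_rem_uniq ?undup_uniq // inE => /andP[/negPf->]; rewrite expr0z.
by rewrite -(single id) -single.
Qed.

(** The entries of s ^+ j are exponential polynomials in j with the
    eigenvalues as bases. Putting 0 for j in their coefficients and T z for
    each base z turns them into the entries of spectral_fun s rs T, since this
    kills the nilpotent terms. So the value of f at spectral_fun s rs T is the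
    second component of an exp_pair whose first component is f (s ^+ j) = 0.
    *)
Lemma zariski_closure_powers (f : {mpoly F[n * n]}) :
  (forall j, f.@[fun k => mxvec (s ^+ j) 0 k] = 0) ->
  f.@[fun k => mxvec (spectral_fun s rs T) 0 k] = 0.
Proof.
move=> f0.
apply: (exp_pair_eq0 pchar0 Psi_neq0 Psi_fun _ f0).
have Psi1 : Psi 1 1.
  by exists (fun=> 0); split; rewrite big1 // => z _; rewrite expr0z.
apply: (exp_pair_meval Psi1 PsiM) => i.
case/mxvec_indexP: i => a b; rewrite mxvecE.
pose G z k := ((s - z%:M) ^+ k * E z) a b.
apply: (@exp_pair_ext _ _ _ (fun j => \sum_(z <- Lam) \sum_(k < n)
    (z ^- k * G z k * 'C(j, k)%:R * z ^+ j))).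
  move=> j; rewrite mxvecE spectral_expX summxE; apply: eq_bigr => z _.
  rewrite summxE; apply: eq_bigr => k _; rewrite mxE /G; ring.
have -> : spectral_fun s rs T a b = \sum_(z <- Lam) \sum_(k < n)
    (z ^- k * G z k * 'C(0, k)%:R * T z).
  rewrite /spectral_fun summxE; apply: eq_bigr => z _; rewrite big_ord_recl big1 ?addr0.
    by rewrite mxE /G /= bin0 expr0 mul1r mulr1 invr1 mul1r mulrC.
  by move=> k _; rewrite bin_small // mulr0 mul0r.
apply: (exp_pair_sum Psi1) => z z_Lam; apply: (exp_pair_sum Psi1) => k _.
have Pz := Psi_Lam z_Lam.
have := exp_pair_term ((z ^- k * G z k) *: binom_poly F k) Pz.
rewrite hornerZ; have := horner_binom_poly pchar0 k 0; rewrite mulr0n => ->.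
by apply: exp_pair_ext => j; rewrite hornerZ horner_binom_poly.
Qed.
End ZariskiClosure.

(** * Galois equivariance and integrality of powers *)

Section Equivariance.
Variables (F : fieldType) (g : {rmorphism F -> F}) (Lam : seq F).
Hypothesis gLam : perm_eq (map g Lam) Lam.

Lemma map_spectral_poly N z :
  map_poly g (spectral_poly Lam N z) = spectral_poly Lam N (g z).
Proof.
rewrite /spectral_poly.
have El : map_poly g (\prod_(w <- Lam | w != z) ('X - w%:P)) =
    \prod_(w <- Lam | w != g z) ('X - w%:P).
  rewrite -[RHS](perm_big _ gLam) big_map /= rmorph_prod.
  apply: eq_big => w; first by rewrite (inj_eq (fmorph_inj g)).
  by rewrite rmorphB /= map_polyX map_polyC.
rewrite rmorphB rmorphXn /= rmorphB rmorphXn /= rmorph1 map_polyZ /= El.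
by rewrite fmorphV -horner_map El.
Qed.

Lemma map_spectral_fun n' (s : 'M[F]_n'.+1) rs T : undup rs = Lam ->
  map_mx g s = s -> (forall z, z \in Lam -> g (T z) = T (g z)) ->
  map_mx g (spectral_fun s rs T) = spectral_fun s rs T.
Proof.
move=> DLam gs gT; rewrite /spectral_fun /spectral_proj DLam.
rewrite -[RHS](perm_big _ gLam) big_map raddf_sum !big_seq /=; apply: eq_bigr => z z_Lam.
rewrite map_mxZ gT //; congr (_ *: _).
by rewrite map_horner_mx gs map_spectral_poly.
Qed.
End Equivariance.

Definition int_mx m n (A : 'M[rat]_(m, n)) := exists B : 'M[int]_(m, n), A = map_mx intr B.

Lemma int_mxM m n p (A : 'M[rat]_(m, n)) (B : 'M[rat]_(n, p)) :
  int_mx A -> int_mx B -> int_mx (A *m B).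
Proof. by move=> [A' ->] [B' ->]; exists (A' *m B'); rewrite map_mxM. Qed.

Lemma int_mx_add1 n (A : 'M[rat]_n) : int_mx (A - 1%:M) -> int_mx A.
Proof.
move=> [B DB]; exists (B + 1%:M); rewrite map_mxD map_mx1 -DB subrK //.
Qed.

(** Modulo D^2 the integral matrices D t^j take finitely many values, so that
    two of them are congruent, with i < j. Then t^j - t^i is D times an
    integral matrix, and multiplying by u^i, which becomes integral after
    multiplication by D, shows that t^(j - i) - 1 is integral. *)
Lemma integral_power n' (t u : 'M[rat]_n'.+1) (D : int) : D != 0 -> t * u = 1 ->
  (forall k, int_mx (D%:~R *: t ^+ k)) -> (forall k, int_mx (D%:~R *: u ^+ k)) ->
  exists2 k, (0 < k)%N & int_mx (t ^+ k) /\ int_mx (u ^+ k).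
Proof.
move=> nz_D tu1 intt intu; have ut1 : u * t = 1 by apply: mulmx1C.
have D2_gt0 : (0 < `|D| ^ 2)%N by rewrite expn_gt0 absz_gt0 nz_D.
pose red k : {ffun 'I_n'.+1 * 'I_n'.+1 -> 'I_(`|D| ^ 2)} :=
  [ffun ab => insubd (Ordinal D2_gt0) `|(numq (D%:~R * (t ^+ k) ab.1 ab.2) %% D ^+ 2)%Z|%N].
have [i [j [lt_ij _ eqr]]] := nat_pigeonhole red.
have nzDr : D%:~R != 0 :> rat by rewrite intr_eq0.
have [X DX] : exists X : 'M[int]_n'.+1, t ^+ j - t ^+ i = D%:~R *: map_mx intr X.
  have [[Bi DBi] [Bj DBj]] := (intt i, intt j).
  have entry k (B : 'M[int]_n'.+1) a b : D%:~R *: t ^+ k = map_mx intr B ->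
      D%:~R * (t ^+ k) a b = (B a b)%:~R.
    by move/matrixP/(_ a b); rewrite !mxE.
  exists (\matrix_(a, b) ((Bj a b - Bi a b) %/ D ^+ 2)%Z); apply/matrixP => a b.
  apply: (mulfI nzDr); rewrite !mxE mulrBr !(entry _ _ _ _ DBi) !(entry _ _ _ _ DBj).
  rewrite mulrA -expr2 -rmorphXn -rmorphM -rmorphB /= mulrC divzK //.
  rewrite -eqz_mod_dvd; apply/eqP; move/ffunP/(_ (a, b))/(congr1 val): eqr.
  rewrite !ffunE !val_insubd /= (entry _ _ _ _ DBi) (entry _ _ _ _ DBj) !numq_int.
  have lt_mod (c : int) : (`|(c %% D ^+ 2)%Z| < `|D| ^ 2)%N.
    have : D ^+ 2 != 0 by rewrite expf_neq0.
    by rewrite -abszX; lia.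
  have nz2 : D ^+ 2 != 0 by rewrite expf_neq0.
  by rewrite !lt_mod; lia.
have tuX k : t ^+ k * u ^+ k = 1.
  by rewrite -exprMn_comm ?tu1 ?expr1n // /GRing.comm tu1 ut1.
have utX k : u ^+ k * t ^+ k = 1.
  by rewrite -exprMn_comm ?ut1 ?expr1n // /GRing.comm tu1 ut1.
exists (j - i)%N; first by rewrite subn_gt0.
have Dj : (j = (j - i) + i)%N by rewrite subnK // ltnW.
split; apply: int_mx_add1.
  have -> : t ^+ (j - i) - 1%:M = (t ^+ j - t ^+ i) * u ^+ i.
    by rewrite mulrBl {2}Dj exprD -mulrA tuX mulr1.
  rewrite DX -scalerAl scalerAr; apply: int_mxM (intu i); by exists X.
have -> : u ^+ (j - i) - 1%:M = - (u ^+ j * (t ^+ j - t ^+ i)).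
  rewrite mulrBr utX {2}Dj exprD -mulrA utX mulr1 opprB //.
rewrite DX -scalerAr scalerAl -mulrN; apply: int_mxM (intu j) _.
by exists (- X); rewrite map_mxN.
Qed.

Lemma Aint_denominator (x : algC) : exists2 D : int, 0 < D & D%:~R * x \in Aint.
Proof.
have [p [_ mon_p] dv_p] := minCpolyP x.
have px : root (map_poly ratr p) x by rewrite dv_p.
pose m := (size p).-1; have sz_p : size p = m.+1.
  by rewrite prednK // size_poly_gt0 monic_neq0.
have [D D_gt0 [b Db]] := common_denominator (\row_(i < size p) p`_i).
exists D => //.
have nzD : D%:~R != 0 :> algC by rewrite intr_eq0 gt_eqF.
(* h is D^m p(X / D), which is monic with integral coefficients. *)
pose h : {poly algC} := \poly_(i < m.+1) (ratr p`_i * D%:~R ^+ (m - i)).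
have hm : h`_m = 1.
  by rewrite coef_poly leqnn subnn mulr1 -(rmorph1 ratr) -(monicP mon_p).
have sz_h : size h = m.+1.
  by apply: size_poly_eq; rewrite subnn mulr1 fmorph_eq0 -[p`_m]/(lead_coef p) lead_coef_eq0 monic_neq0.
apply: (@root_monic_Aint h); last first.
- apply/polyOverP => i; rewrite coef_poly; case: ltnP => [|_]; last exact: rpred0.
  rewrite ltnS leq_eqVlt => /orP[/eqP->|lt_im].
    by rewrite subnn mulr1 -[p`_m]/(lead_coef p) (monicP mon_p) rmorph1 rpred1.
  have -> : (m - i = (m - i).-1.+1)%N by lia.
  rewrite exprS mulrA rpredM ?rpredX ?intr_int //.
  have lt_ip : (i < size p)%N by rewrite sz_p ltnW.
  have := congr1 (fun A : 'rV[rat]_(size p) => A 0 (Ordinal lt_ip)) Db; rewrite !mxE /= => Db_i.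
  by rewrite mulrC -(ratr_int _ D) -rmorphM -Db_i /= ratr_int intr_int.
- by rewrite monicE lead_coefE sz_h hm.
suff Dh : h.[D%:~R * x] = D%:~R ^+ m * (map_poly ratr p).[x].
  by rewrite rootE Dh (rootP px) mulr0.
rewrite horner_poly horner_coef size_map_poly sz_p mulr_sumr; apply: eq_bigr => i _.
rewrite coef_map exprMn; have -> : D%:~R ^+ m = D%:~R ^+ (m - i) * D%:~R ^+ i :> algC.
  by rewrite -exprD subnK // -ltnS.
ring.
Qed.

Lemma Aint_common_denominator (I : Type) (s : seq I) (x : I -> algC) :
  exists2 D : int, 0 < D & all (fun i => D%:~R * x i \in Aint) s.
Proof.
elim: s => [|i s [D D_gt0 sD]]; first by exists 1.
have [D' D'_gt0 AD'] := Aint_denominator (x i); exists (D * D'); first exact: mulr_gt0.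
rewrite /= intrM -mulrA rpredM ?Aint_int //=; apply: sub_all sD => j Aj.
by rewrite mulrAC rpredM ?Aint_int.
Qed.

(** * Unipotent matrices and the logarithm *)

Section MatrixLog.
Variable n' : nat.
Local Notation n := n'.+1.
Implicit Types M g : 'M[rat]_n.

Let pchar0 : [pchar rat] =i pred0. Proof. exact: pchar_num. Qed.

Definition unipotent M := (M - 1) ^+ n = 0.

(** For a unipotent M the power M ^+ j is polynomial in j, and the coefficient
    of degree 1 of the binomial polynomials makes this its derivative at j =
    0. *)
Definition mx_log M : 'M[rat]_n := \sum_(k < n) (binom_poly rat k)`_1 *: (M - 1) ^+ k.

Let interp M a b : {poly rat} := \sum_(k < n) ((M - 1) ^+ k) a b *: binom_poly rat k.

Let horner_interp M a b (j : nat) : unipotent M -> (interp M a b).[j%:R] = (M ^+ j) a b.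
Proof.
move=> uM; rewrite horner_sum.
pose G k := ((M - 1) ^+ k) a b * 'C(j, k)%:R.
transitivity (\sum_(k < j.+1) G k); last first.
  rewrite -{1}(subrK 1 M) addrC exprDn_comm; last by apply/commr_sym/commr1.
  by rewrite summxE; apply: eq_bigr => k _; rewrite /G expr1n mul1r mulmxnE mulr_natr.
rewrite (eq_bigr (fun k : 'I_n => G k)) => [|k _]; last by rewrite hornerZ horner_binom_poly.
have G0 k : (n <= k)%N -> G k = 0.
  by move=> le_nk; rewrite /G -(subnK le_nk) exprD uM mulr0 mxE mul0r.
have G0' k : (j < k)%N -> G k = 0 by move=> lt_jk; rewrite /G bin_small // mulr0.
transitivity (\sum_(k < (n + j).+1) G k).
  rewrite (big_ord_widen (n + j).+1 G); last by lia.
  by rewrite big_mkcond; apply: eq_bigr => k _; case: ltnP => // /G0.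
apply/esym; rewrite (big_ord_widen (n + j).+1 G); last by lia.
by rewrite big_mkcond; apply: eq_bigr => k _; case: ltnP => // /G0'.
Qed.

Let mx_logE M a b : mx_log M a b = (interp M a b)`_1.
Proof.
by rewrite summxE coef_sum; apply: eq_bigr => k _; rewrite mxE [RHS]coefZ mulrC.
Qed.

Let interp0 M a b : unipotent M -> (interp M a b)`_0 = (a == b)%:R.
Proof.
move=> uM; have := horner_interp a b 0 uM.
by rewrite expr0 mxE mulr0n horner_coef0.
Qed.

(** The derivative at 0 of the product M ^+ j * M' ^+ j, each factor being 1
    at j = 0. *)
Lemma mx_logM M M' : GRing.comm M M' -> unipotent M -> unipotent M' ->
  unipotent (M * M') -> mx_log (M * M') = mx_log M + mx_log M'.
Proof.
move=> cMM uM uM' uMM; apply/matrixP => a b; rewrite mxE !mx_logE.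
have -> : interp (M * M') a b = \sum_c interp M a c * interp M' c b.
  apply/eqP; rewrite -subr_eq0; apply/eqP/(poly_nat_eq0 pchar0) => j.
  rewrite hornerD hornerN horner_interp // horner_sum exprMn_comm // mxE.
  apply/eqP; rewrite subr_eq0; apply/eqP/eq_bigr => c _.
  by rewrite hornerM !horner_interp.
rewrite coef_sum.
under eq_bigr => c _ do rewrite coefM big_ord_recl big_ord1 /= !interp0 //.
rewrite big_split /= addrC; congr (_ + _).
  rewrite (bigD1 b) //= eqxx mulr1 big1 ?addr0 // => c /negPf cb.
  by rewrite cb mulr0.
rewrite (bigD1 a) //= eqxx mul1r big1 ?addr0 // => c.
by rewrite eq_sym => /negPf ->; rewrite mul0r.
Qed.

Lemma mx_log_conj g M M' : g * M = M' * g -> g * mx_log M = mx_log M' * g.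
Proof.
move=> gM; have gM1 : g * (M - 1) = (M' - 1) * g by rewrite mulrBr mulrBl gM mulr1 mul1r.
rewrite mulr_sumr mulr_suml; apply: eq_bigr => k _.
rewrite -scalerAr -scalerAl; congr (_ *: _).
elim: (nat_of_ord k) => [|l IH]; first by rewrite !expr0 mulr1 mul1r.
by rewrite !exprSr mulrA IH -!mulrA gM1.
Qed.

(** With y = M - 1, the logarithm is y - y * (y * W) for some W commuting with
    y; if it vanishes, then y = y * (y * W) ^+ k for all k, and y is
    nilpotent. *)
Lemma mx_log_eq0 M : unipotent M -> mx_log M = 0 -> M = 1.
Proof.
rewrite /unipotent => yn; have c0 : (binom_poly rat 0)`_1 = 0.
  by rewrite /binom_poly big_ord0 coefZ coef1 mulr0.
have c1 : (binom_poly rat 1)`_1 = 1.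
  by rewrite /binom_poly big_ord1 coefZ coefB coefX coefC subr0 mulr1 invr1.
set y := M - 1 in yn *.
suff [W [cW]] : exists W, GRing.comm y W /\ mx_log M = y - y * (y * W).
  move=> -> /eqP; rewrite subr_eq0 => /eqP Dy.
  apply/eqP; rewrite -subr_eq0 -/y; apply/eqP.
  have {}Dy k : y = y * (y * W) ^+ k.
    by elim: k => [|k IH]; rewrite ?expr0 ?mulr1 // exprS mulrA -Dy.
  by rewrite (Dy n) exprMn_comm // yn mul0r mulr0.
rewrite /mx_log -/y; pose G k := (binom_poly rat k)`_1 *: y ^+ k.
rewrite -(big_mkord xpredT G) big_ltn // {1}/G c0 scale0r add0r.
have [n0|n_gt0] := posnP n'.
  exists 0; split; first exact: commr0.
  rewrite big_geq ?n0 // !mulr0 subr0; apply/esym.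
  have y1 : y ^+ n = y ^+ 1 by congr (_ ^+ _.+1).
  by rewrite -yn y1.
exists (- \sum_(2 <= k < n) (binom_poly rat k)`_1 *: y ^+ (k - 2)); split.
  apply: commrN; apply: commr_sum => k _.
  by rewrite /GRing.comm -scalerAr -scalerAl -exprS -exprSr.
rewrite big_ltn ?ltnS // {1}/G c1 scale1r expr1 !mulrN opprK; congr (_ + _).
rewrite !mulr_sumr !big_nat; apply: eq_bigr => k /andP[le_2k _].
by rewrite /G -!scalerAr mulrA -expr2 -exprD subnKC.
Qed.
End MatrixLog.

(** The eigenspace of M for a is stable under the family; a common eigenvector
    taken in it attains the prescribed eigenvalue. *)
Lemma common_eigenvector_in (C : numClosedFieldType) n (M : 'M[C]_n) (As : seq 'M[C]_n) a :
  eigenvalue M a -> {in As, forall B, comm_mx M B} -> {in As &, forall B B', comm_mx B B'} ->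
  exists2 v : 'rV_n, v != 0 & v *m M = a *: v /\ {in As, forall B, exists b, v *m B = b *: v}.
Proof.
move=> a_eigen M_comm As_comm; pose V := eigenspace M a.
have stab B : B \in As -> stablemx (row_base V) B.
  by move=> B_in; rewrite stablemx_row_base comm_mx_stable_eigenspace //; apply: M_comm.
have [|_ _ /mapP[B B_in ->] /mapP[B' B'_in ->]|v v0 /allP vP] :=
    @common_eigenvector _ _ [seq restrictmx V B | B <- As].
- by rewrite lt0n mxrank_eq0.
- by rewrite /comm_mx -!conjmxM ?inE ?stab // (As_comm B B').
exists (v *m row_base V); first by rewrite mulmx_free_eq0 ?row_base_free.
split; first by apply/eigenspaceP; rewrite mulmx_sub // eq_row_base.
move=> B B_in; have : stablemx (v *m row_base V) B.
  rewrite -stablemx_restrict ?vP ?map_f //.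
  by rewrite comm_mx_stable_eigenspace //; apply: M_comm.
by move/eigenvectorP => [b /eigenspaceP]; exists b.
Qed.

Lemma first_dependent_row (K : fieldType) n (w : nat -> 'rV[K]_n) :
  exists2 m, (m <= n)%N & (exists c : 'rV_m, w m = \sum_(i < m) c 0 i *: w i) /\
    forall d : 'I_m -> K, \sum_i d i *: w i = 0 -> forall i, d i = 0.
Proof.
pose W m := \matrix_(i < m) w i; pose P m := (w m <= W m)%MS.
have WE m (d : 'rV_m) : d *m W m = \sum_(i < m) d 0 i *: w i.
  by rewrite mulmx_sum_row; apply: eq_bigr => i _; rewrite rowK.
have top m (d : 'I_m -> K) : \sum_i d i *: w i = 0 -> (exists i, d i != 0) ->
    exists2 i, (i < m)%N & P i.
  move=> d0 [i0 di0]; case: (@arg_maxnP _ i0 (fun i => d i != 0) val di0) => i di max_i.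
  exists i => //; rewrite /P.
  have -> : w i = - (d i)^-1 *: \sum_(k < m | k != i) d k *: w k.
    move: d0; rewrite (bigD1 i) //= => /eqP; rewrite addrC addr_eq0 => /eqP ->.
    by rewrite scalerN scaleNr opprK scalerA mulVf // scale1r.
  apply/scalemx_sub/summx_sub => k ne_ki.
  have [dk0|dk] := eqVneq (d k) 0; first by rewrite dk0 scale0r sub0mx.
  have lt_ki : (k < i)%N by rewrite ltn_neqAle ne_ki; exact: max_i.
  by apply: scalemx_sub; rewrite -(rowK (fun j : 'I_i => w j) (Ordinal lt_ki)) row_sub.
have [m0 [le_m0 Pm0]] : exists m0, (m0 <= n)%N /\ P m0.
  have : ~~ row_free (W n.+1).
    by rewrite /row_free neq_ltn ltnS rank_leq_col.
  rewrite -kermx_eq0 => /rowV0Pn[d /sub_kermxP d0 nz_d].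
  have [||i lt_i Pi] := @top n.+1 (d 0); first by rewrite -WE.
    by apply/existsP; move: nz_d; apply: contraNT => /existsPn d_0; apply/eqP/rowP => i; rewrite mxE; apply/eqP/negPn.
  by exists i.
have [m Pm min_m] := ex_minnP (ex_intro P m0 Pm0).
exists m; first exact: leq_trans (min_m _ Pm0) le_m0.
split; first by have /submxP[c Dc] := Pm; exists c; rewrite -WE.
move=> d d0 i; apply/eqP/negPn/negP => nz_di.
have [|j lt_jm /min_m] := top _ _ d0; first by exists i.
by rewrite leqNgt lt_jm.
Qed.

Section UnipotentTranslations.
Variables (n' p : nat) (tau : 'cV[int]_p -> 'M[rat]_n'.+1) (A A' : 'M[int]_p).
Local Notation n := n'.+1.
Variable s s' : 'M[rat]_n.
Hypotheses (tau0 : tau 0 = 1) (tauD : forall x y, tau (x + y) = tau x * tau y).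
Hypotheses (AA' : A *m A' = 1%:M) (ss' : s * s' = 1).
Hypothesis s_tau : forall x, s * tau x = tau (A *m x) * s.

Local Notation C := algC.
Let toC (M : 'M[rat]_n) : 'M[C]_n := map_mx ratr M.

Let toCM M M' : toC (M * M') = toC M *m toC M'. Proof. exact: map_mxM. Qed.
Let toC1 : toC 1 = 1. Proof. exact: map_mx1. Qed.

Let tau_comm x y : comm_mx (toC (tau x)) (toC (tau y)).
Proof. by rewrite /comm_mx -!map_mxM -!/(_ * _) -!tauD addrC. Qed.

Let A'A : A' *m A = 1%:M. Proof. exact: mulmx1C. Qed.

Let s's : s' * s = 1. Proof. exact: mulmx1C. Qed.

Let AX_inj k (x : 'cV[int]_p) : exists y, A ^+ k *m y = x.
Proof.
elim: k => [|k [y Dy]]; first by exists x; rewrite expr0 mul1mx.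
by exists (A' *m y); rewrite exprSr -mulmxA (mulmxA A) AA' mul1mx.
Qed.

(** If v affords the character chi, then v s^j affords chi composed with A^j.
    As eigenvectors for distinct characters are independent, two of the first
    n + 1 of these characters coincide; A being invertible, chi is fixed by
    A^d for some d between 1 and n, which divides n!. *)
Let character_fixed (v : 'rV[C]_n) (chi : 'cV[int]_p -> C) : v != 0 ->
  (forall y, v *m toC (tau y) = chi y *: v) -> forall x, chi ((A ^+ n`! - 1) *m x) = 1.
Proof.
move=> nz_v v_chi; pose w j : 'rV_n := v *m toC (s ^+ j).
have s_tauX j y : s ^+ j * tau y = tau (A ^+ j *m y) * s ^+ j.
  elim: j y => [|j IH] y; first by rewrite !expr0 mul1mx mul1r mulr1.
  by rewrite !exprSr -mulrA s_tau mulrA IH -[_ * A]/(_ *m A) -mulmxA -mulrA.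
have w_chi j y : w j *m toC (tau y) = chi (A ^+ j *m y) *: w j.
  by rewrite /w -mulmxA -toCM s_tauX toCM mulmxA v_chi scalemxAl.
have nz_w j : w j != 0.
  apply: contraNneq nz_v => wj0; rewrite -[v]mulmx1 -[1%:M]toC1.
  have <- : s ^+ j * s' ^+ j = 1.
    by rewrite -exprMn_comm ?ss' ?expr1n // /GRing.comm ss' s's.
  by rewrite toCM mulmxA -/(w j) wj0 mul0mx.
have chiD x y : chi (x + y) = chi x * chi y.
  have := v_chi (x + y); rewrite tauD toCM mulmxA v_chi -scalemxAl v_chi scalerA => /eqP.
  by rewrite -subr_eq0 -scalerBl scaler_eq0 (negPf nz_v) orbF subr_eq0 => /eqP.
have chi0 : chi 0 = 1.
  have := v_chi 0; rewrite tau0 toC1 mulmx1 => /eqP.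
  by rewrite -{1}[v]scale1r -subr_eq0 -scalerBl scaler_eq0 (negPf nz_v) orbF subr_eq0 => /eqP.
have [m le_mn [[c Dwm] free_w]] := first_dependent_row w.
have [i nz_ci] : exists i, c 0 i != 0.
  apply/existsP; move: (nz_w m); apply: contraNT => /existsPn c0.
  by rewrite Dwm big1 // => i _; move/negPn/eqP: (c0 i) => ->; rewrite scale0r.
have eq_chi y : chi (A ^+ m *m y) = chi (A ^+ i *m y).
  have := free_w (fun k => c 0 k * (chi (A ^+ m *m y) - chi (A ^+ k *m y))).
  move=> /(_ _ i)/eqP; rewrite mulf_eq0 (negPf nz_ci) /= subr_eq0 => H.
  apply/eqP/H; apply/eqP.
  have -> : \sum_(k < m) (c 0 k * (chi (A ^+ m *m y) - chi (A ^+ k *m y))) *: w k =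
      \sum_(k < m) (chi (A ^+ m *m y) *: (c 0 k *: w k) - c 0 k *: (chi (A ^+ k *m y) *: w k)).
    by apply: eq_bigr => k _; rewrite !scalerA -scalerBl; congr (_ *: _); ring.
  rewrite sumrB -scaler_sumr -Dwm -w_chi subr_eq0 {1}Dwm mulmx_suml; apply/eqP/eq_bigr => k _.
  by rewrite -scalemxAl w_chi.
have lt_im := ltn_ord i; pose d := (m - i)%N.
have fix_d y : chi (A ^+ d *m y) = chi y.
  have [z <-] := AX_inj i y; rewrite mulmxA -[A ^+ d *m _]/(A ^+ d * _) -exprD.
  by rewrite subnK ?eq_chi // ltnW.
have fix_dk k y : chi (A ^+ (d * k) *m y) = chi y.
  elim: k y => [|k IH] y; first by rewrite muln0 expr0 mul1mx.
  by rewrite mulnS exprD -mulmxA fix_d IH.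
have /dvdnP[k Dk] : (d %| n`!)%N.
  by rewrite dvdn_fact // subn_gt0 lt_im (leq_trans (leq_subr _ _)).
move=> x; have := chiD ((A ^+ n`! - 1) *m x) x.
rewrite mulmxBl mul1mx subrK Dk mulnC fix_dk => /eqP; rewrite eq_sym -subr_eq0.
have nz_chi : chi x != 0.
  apply/eqP => chix0; have := chiD x (- x); rewrite subrr chi0 chix0 mul0r.
  by move/eqP; rewrite oner_eq0.
by rewrite -{2}[chi x]mul1r -mulrBl mulf_eq0 (negPf nz_chi) orbF subr_eq0 => /eqP.
Qed.

(** An eigenvalue of the matrix is attained on a common eigenvector of the
    commuting matrices tau y, hence is the value of a character, and
    character_fixed says that it is 1. *)
Lemma unipotent_translation x : unipotent (tau ((A ^+ n`! - 1) *m x)).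
Proof.
set b := _ *m x; pose M := toC (tau b).
have eig1 a : eigenvalue M a -> a = 1.
  move=> a_eig; pose As := [seq toC (tau (delta_mx k 0)) | k <- enum 'I_p].
  have [||v nz_v [vM v_As]] := common_eigenvector_in (As := As) a_eig.
  - by move=> _ /mapP[k _ ->]; apply: tau_comm.
  - by move=> _ _ /mapP[k _ ->] /mapP[l _ ->]; apply: tau_comm.
  have v_tau y : exists c, v *m toC (tau y) = c *: v.
    have addP y1 y2 : (exists c, v *m toC (tau y1) = c *: v) ->
        (exists c, v *m toC (tau y2) = c *: v) -> exists c, v *m toC (tau (y1 + y2)) = c *: v.
      move=> [c1 E1] [c2 E2]; exists (c1 * c2).
      by rewrite tauD toCM mulmxA E1 -scalemxAl E2 scalerA.
    have oppP y1 : (exists c, v *m toC (tau y1) = c *: v) ->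
        exists c, v *m toC (tau (- y1)) = c *: v.
      move=> [c1 E1]; exists c1^-1.
      have Ev : v = c1 *: (v *m toC (tau (- y1))).
        rewrite scalemxAl -E1 -mulmxA -toCM -tauD subrr tau0 toC1 mulmx1 //.
      have nz_c1 : c1 != 0 by apply: contraNneq nz_v => c10; rewrite Ev c10 scale0r.
      by rewrite {2}Ev scalerA mulVf // scale1r.
    have zP : exists c, v *m toC (tau 0) = c *: v by exists 1; rewrite tau0 toC1 mulmx1 scale1r.
    have -> : y = \sum_k \sum_(j < 1) y k j *: delta_mx k j by exact: matrix_sum_delta.
    apply: (big_ind (fun y => exists c, v *m toC (tau y) = c *: v)) => // k _.
    rewrite big_ord1 [ord0]/(0 : 'I_1).
    have eP : exists c, v *m toC (tau (delta_mx k 0)) = c *: v.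
      by apply: v_As; apply: map_f; rewrite mem_enum.
    have natP (m : nat) : exists c, v *m toC (tau (m%:Z *: delta_mx k 0)) = c *: v.
      elim: m => [|m IH]; first by rewrite scale0r.
      by rewrite intS scalerDl scale1r; apply: addP.
    case: (y k 0) => m; first exact: natP.
    by rewrite NegzE scaleNr; apply: oppP.
  have [k0 vk0] : exists k0, v 0 k0 != 0.
    apply/existsP; move: nz_v; apply: contraNT => /existsPn v0.
    by apply/eqP/rowP => k; rewrite mxE; apply/eqP/negPn.
  pose chi y := (v *m toC (tau y)) 0 k0 / v 0 k0.
  have chiP y : v *m toC (tau y) = chi y *: v.
    by have [c Dc] := v_tau y; rewrite /chi Dc mxE mulfK.
  have := character_fixed nz_v chiP x; rewrite /chi vM mxE mulfK //.
apply: (map_mx_inj (f := (ratr : {rmorphism rat -> C}))).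
rewrite /unipotent map_mx0 [LHS]rmorphXn /= map_mxB map_mx1 -/M.
have [rs Drs] := closed_field_poly_normal (char_poly M).
rewrite (monicP (char_poly_monic M)) scale1r in Drs.
have sz_rs : size rs = n by have := size_char_poly M; rewrite Drs size_prod_XsubC => -[].
have rs1 : rs = nseq n 1.
  rewrite -[X in nseq X _]sz_rs; apply/all_pred1P/allP => r r_rs /=.
  by apply/eqP/eig1; rewrite eigenvalue_root_char Drs root_prod_XsubC.
have := Cayley_Hamilton M; rewrite Drs rs1 big_nseq iter_mulr_1 rmorphXn /=.
by rewrite rmorphB /= horner_mx_X horner_mx_C.
Qed.
End UnipotentTranslations.

Section LogEigenvector.
Variables (n' p : nat) (tau : 'cV[int]_p -> 'M[rat]_n'.+1) (A A' : 'M[int]_p).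
Local Notation n := n'.+1.
Variable s s' : 'M[rat]_n.
Hypotheses (tau0 : tau 0 = 1) (tauD : forall x y, tau (x + y) = tau x * tau y).
Hypotheses (AA' : A *m A' = 1%:M) (ss' : s * s' = 1).
Hypothesis s_tau : forall x, s * tau x = tau (A *m x) * s.
Hypothesis tau_inj : injective tau.

Let B : 'M[int]_p := A ^+ n`! - 1.
Hypothesis B_inj : forall x : 'cV[int]_p, B *m x = 0 -> x = 0.

Let ell x := mx_log (tau (B *m x)).

Let uni x : unipotent (tau (B *m x)).
Proof. exact: (unipotent_translation tau0 tauD AA' ss' s_tau). Qed.

Let ellD x y : ell (x + y) = ell x + ell y.
Proof.
rewrite /ell mulmxDr tauD mx_logM //; first by rewrite /GRing.comm -!tauD addrC.
by rewrite -tauD -mulmxDr.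
Qed.

Let ell_eq0 x : ell x = 0 -> x = 0.
Proof.
move=> /(mx_log_eq0 (uni x)); rewrite -tau0 => /tau_inj; exact: B_inj.
Qed.

Let ell0 : ell 0 = 0.
Proof. by apply: (addrI (ell 0)); rewrite -ellD !addr0. Qed.

Let ellN x : ell (- x) = - ell x.
Proof. by apply: (addrI (ell x)); rewrite -ellD !subrr ell0. Qed.

Let ellZ (c : int) x : ell (c *: x) = c%:~R *: ell x.
Proof.
have ell_nat (m : nat) : ell (m%:Z *: x) = m%:R *: ell x.
  elim: m => [|m IH]; first by rewrite !scale0r ell0.
  by rewrite intS -natr1 addrC !scalerDl !scale1r ellD IH.
case: c => m; first exact: ell_nat.
by rewrite NegzE scaleNr ellN ell_nat mulrNz scaleNr.
Qed.

Let ell_sum (I : Type) (r : seq I) (F : I -> 'cV[int]_p) :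
  ell (\sum_(i <- r) F i) = \sum_(i <- r) ell (F i).
Proof. exact: (big_morph ell ellD ell0). Qed.

Let e (k : 'I_p) : 'cV[int]_p := delta_mx k 0.

Let col_delta (x : 'cV[int]_p) : x = \sum_k x k 0 *: e k.
Proof.
rewrite {1}[x]matrix_sum_delta; apply: eq_bigr => k _.
by rewrite big_ord1 [ord0]/(0 : 'I_1).
Qed.

Let ell_expand x : ell x = \sum_k (x k 0)%:~R *: ell (e k).
Proof. by rewrite {1}[x]col_delta ell_sum; apply: eq_bigr => k _; rewrite ellZ. Qed.

Let R : 'M[rat]_(p, n * n) := \matrix_k mxvec (ell (e k)).

(** A rational relation between the ell (e k) has a nonzero integral multiple,
    and ell is injective. *)
Let row_free_R : row_free R.
Proof.
rewrite -kermx_eq0; apply/rowV0P => u /sub_kermxP u0.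
have [N N_gt0 [b Db]] := common_denominator u.
suff b0 : b^T = 0.
  have : map_mx intr b = 0 :> 'rV[rat]_p by rewrite -[b]trmxK b0 trmx0 map_mx0.
  by rewrite Db => /eqP; rewrite scaler_eq0 intr_eq0 gt_eqF // => /eqP.
apply: ell_eq0; rewrite ell_expand; apply: (can_inj mxvecK).
transitivity (N%:~R *: (u *m R)); last by rewrite u0 scaler0 linear0.
rewrite linear_sum mulmx_sum_row scaler_sumr; apply: eq_bigr => k _ /=.
rewrite linearZ rowK scalerA /=; congr (_ *: _).
by have /rowP/(_ k) := Db; rewrite !mxE.
Qed.

(** The map ell is additive and injective, and conjugation by g acts on it as
    c. Extended to L^p it remains injective, and v is the value of the
    extension at the eigenvector w. *)
Lemma log_eigenvector (L : fieldType) (f : {rmorphism rat -> L}) (w : 'cV[L]_p) :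
  w != 0 -> exists2 v : 'M[L]_n, v != 0 &
  forall (g : 'M[rat]_n) (c : 'M[int]_p) (gam : L),
    (forall x, g * tau x = tau (c *m x) * g) -> c *m A = A *m c ->
    map_mx intr c *m w = gam *: w ->
    map_mx f g * v = gam *: (v * map_mx f g).
Proof.
move=> nz_w; pose v : 'M[L]_n := \sum_k w k 0 *: map_mx f (ell (e k)); exists v.
  apply: contraNneq nz_w => v0.
  have : w^T *m map_mx f R = 0.
    transitivity (mxvec v); last by rewrite v0 linear0.
    rewrite mulmx_sum_row linear_sum; apply: eq_bigr => k _ /=.
    by rewrite linearZ mxE -map_row rowK map_mxvec.
  have rfR : row_free (map_mx f R) by rewrite row_free_map.
  by move/eqP; rewrite mulmx_free_eq0 // => /eqP wT0; rewrite -[w]trmxK wT0 trmx0.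
move=> g c gam g_tau c_A c_w.
have cB : c *m B = B *m c.
  rewrite /B mulmxBr mulmxBl mulmx1 mul1mx; congr (_ - _).
  elim: (n`!) => [|k IH]; first by rewrite expr0 mulmx1 mul1mx.
  by rewrite exprS mulmxA c_A -mulmxA IH mulmxA.
have g_ell x : g * ell x = ell (c *m x) * g.
  by apply: mx_log_conj; rewrite g_tau mulmxA cB mulmxA.
have Dv : v * map_mx f g = \sum_k w k 0 *: map_mx f (ell (e k) * g).
  by rewrite mulr_suml; apply: eq_bigr => k _; rewrite -scalerAl map_mxM.
rewrite Dv mulr_sumr scaler_sumr.
transitivity (\sum_k \sum_j (w k 0 * (c j k)%:~R) *: map_mx f (ell (e j) * g)).
  apply: eq_bigr => k _; rewrite -scalerAr -[map_mx f g * _]map_mxM [g *m _]g_ell ell_expand.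
  rewrite mulr_suml raddf_sum scaler_sumr; apply: eq_bigr => j _ /=.
  rewrite -scalerAl map_mxZ rmorph_int scalerA; congr ((_ * _%:~R) *: _).
  rewrite mxE (bigD1 k) //= mxE !eqxx mulr1 big1 ?addr0 // => l lk.
  by rewrite mxE (negPf lk) mulr0.
rewrite exchange_big; apply: eq_bigr => j _; rewrite /= -scaler_suml scalerA; congr (_ *: _).
have /colP/(_ j) := c_w; rewrite !mxE => <-.
by apply: eq_bigr => k _; rewrite mxE mulrC.
Qed.
End LogEigenvector.

(** * The Galois-equivariant torus element *)

Section TorusElement.
Variables (L : splittingFieldType rat) (galL : galois 1 {:L}).
Variables (rs Lam : seq L) (u : L -> L) (lam : L).
Local Notation G := (gal_of {:L}).
Hypotheses (uniq_rs : uniq rs) (uniq_Lam : uniq Lam).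
Hypotheses (gal_rs : forall (g : G) r, r \in rs -> g r \in rs).
Hypotheses (gal_Lam : forall (g : G) z, z \in Lam -> g z \in Lam).
Hypothesis trans_rs : forall r, r \in rs -> exists g : G, g lam = r.
Hypothesis nz_Lam : forall z, z \in Lam -> z != 0.
Hypotheses (nz_u : forall r, r \in rs -> u r != 0).
Hypothesis gal_u : forall (g : G) r, g (u r) = u (g r).
Hypothesis prod_u : \prod_(r <- rs) u r = 1.
Hypothesis indep_rs : forall f : L -> int, \prod_(r <- rs) r ^ f r = 1 ->
  {in rs &, forall x y, f x = f y}.
Hypotheses (lam_rs : lam \in rs).
Hypothesis lam_ratio : exists a b, [/\ a \in Lam, b \in Lam & a = lam * b].

Let gal_perm (s : seq L) (g : G) : uniq s -> (forall z, z \in s -> g z \in s) ->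
  perm_eq (map g s) s.
Proof. exact/perm_map_stable/fmorph_inj. Qed.

Let galMx (g h : G) x : (g * h)%g x = h (g x). Proof. by rewrite galM ?memvf. Qed.

Let galVK (g : G) x : g ((g^-1)%g x) = x. Proof. by rewrite -galMx mulVg gal_id. Qed.
Let galKV (g : G) x : (g^-1)%g (g x) = x. Proof. by rewrite -galMx mulgV gal_id. Qed.

Let expz_sum (x : L) (I : Type) (r : seq I) (f : I -> int) : x != 0 ->
  x ^ (\sum_(i <- r) f i) = \prod_(i <- r) x ^ f i.
Proof.
by move=> nz_x; apply: (big_morph (fun k => x ^ k)) => [k l|]; rewrite ?expr0z ?expfzDr.
Qed.

Let expz_prod (c : int) (I : Type) (r : seq I) (f : I -> L) :
  (\prod_(i <- r) f i) ^ c = \prod_(i <- r) f i ^ c.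
Proof. exact: (big_morph (fun x => x ^ c) (fun x y => expfzMl x y c) (exp1rz _ c)). Qed.

Let p := size rs.
(** The exponents of the character on the roots. They sum to 0 over rs, which
    is the only condition that the relations between the roots impose. The
    outer factor p makes it enough to know that the p-th power of the product
    of the u (g lam) is 1. *)
Let beta (r : L) : int := p%:Z * (p%:Z * (r == lam)%:Z - 1).

(** Let c be a character with values N * beta on the roots, and let T z be the
    product over g of u (g lam) ^ c (g^-1 z). Reindexing the product shows
    that T is equivariant. If a = lam * b, then T a / T b is the product of
    the powers u (g lam) ^ (N * beta (g^-1 lam)): the g that fix lam
    contribute a power of u lam, and the constant part of beta contributes a
    product of norms of u. *)
Lemma galois_torus_element : exists T : L -> L, exists2 M : nat, (0 < M)%N &
  [/\ forall z, T z != 0 /\ exists e : G -> int, T z = \prod_(g : G) u (g lam) ^ e g,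
      forall (g : G) z, g (T z) = T (g z),
      forall e : L -> int, \prod_(z <- Lam) z ^ e z = 1 -> \prod_(z <- Lam) T z ^ e z = 1
    & forall a b, a \in Lam -> b \in Lam -> a = lam * b -> T a = u lam ^+ M * T b].
Proof.
have p_gt0 : (0 < p)%N by rewrite /p; case: (rs) lam_rs.
have [|f f1|c [N N_gt0 [c_rel c_ratio]]] :=
    extend_character_seq (beta := beta) uniq_Lam uniq_rs nz_Lam.
- move=> r /trans_rs[g <-]; have [a [b [aL bL Dab]]] := lam_ratio.
  by exists (g a), (g b); split; rewrite ?gal_Lam // Dab rmorphM.
- have f_const r : r \in rs -> f r = f lam by move=> r_rs; apply: (indep_rs f1).
  transitivity (\sum_(r <- rs) f lam * beta r).
    by rewrite !big_seq; apply: eq_bigr => r /f_const ->.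
  rewrite -mulr_sumr -mulr_sumr sumrB -mulr_sumr (big_rem lam) //= eqxx.
  rewrite big_seq big1 => [|r]; last first.
    by rewrite mem_rem_uniq // inE => /andP[/negPf->].
  rewrite addr0 mulr1 big_const_seq count_predT -/p.
  suff -> : iter p (+%R 1) 0 = p%:Z by rewrite subrr !mulr0.
  by elim: (p) => //= k ->; rewrite intS.
pose T z := \prod_(g : G) u (g lam) ^ c ((g^-1)%g z).
have nz_ug (g : G) : u (g lam) != 0 by rewrite nz_u ?gal_rs.
have T0 z : T z != 0 by apply/prodf_neq0 => g _; rewrite expfz_neq0.
pose St := #|[pred g : G | g lam == lam]|.
have St_gt0 : (0 < St)%N.
  by apply/card_gt0P; exists 1%g; rewrite inE gal_id.
exists T, (`|N| * (p * (p * St)))%N.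
  by rewrite !muln_gt0 absz_gt0 gt_eqF // p_gt0.
split.
- by move=> z; split=> //; exists (fun g : G => c ((g^-1)%g z)).
- move=> h z; rewrite /T rmorph_prod [RHS](reindex_inj (mulIg h)) /=.
  apply: eq_bigr => g _; rewrite fmorphXz /= gal_u galMx; congr (_ ^ c _).
  by rewrite invMg galMx galKV.
- move=> e e1.
  have e_c (g : G) : \sum_(z <- Lam) e z * c ((g^-1)%g z) = 0.
    have gL := gal_perm uniq_Lam (@gal_Lam g).
    rewrite -(perm_big _ gL) big_map /=.
    under eq_bigr => z _ do rewrite galKV.
    apply: c_rel; apply: (fmorph_inj g); rewrite rmorph1 rmorph_prod -[RHS]e1.
    rewrite -[RHS](perm_big _ gL) big_map; apply: eq_bigr => z _; exact: fmorphXz.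
  transitivity (\prod_(g : G) u (g lam) ^ (\sum_(z <- Lam) e z * c ((g^-1)%g z))).
    rewrite /T.
    under eq_bigr => z _ do rewrite expz_prod.
    rewrite exchange_big; apply: eq_bigr => g _ /=; rewrite expz_sum //.
    by apply: eq_bigr => z _; rewrite exprz_exp mulrC.
  by rewrite big1 // => g _; rewrite e_c expr0z.
move=> a b aL bL Dab; pose U (g : G) := u (g lam).
have c_ab (g : G) : c ((g^-1)%g a) = N * beta ((g^-1)%g lam) + c ((g^-1)%g b).
  rewrite -(c_ratio ((g^-1)%g lam) ((g^-1)%g a) ((g^-1)%g b)) ?gal_rs ?gal_Lam ?subrK //.
  by rewrite Dab rmorphM.
have U_ab : T a = (\prod_(g : G) U g ^ beta ((g^-1)%g lam)) ^ N * T b.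
  rewrite expz_prod -big_split; apply: eq_bigr => g _ /=.
  by rewrite c_ab expfzDr // exprz_exp [N * _]mulrC.
rewrite U_ab; congr (_ * _).
pose nu := \prod_(g : G) U g.
(* The product of u (g r) over all g and r is nu ^+ p on the one hand, and a
   product of norms of u on the other. *)
have nu_p : nu ^+ p = 1.
  have nuE r : r \in rs -> \prod_(g : G) u (g r) = nu.
    move=> /trans_rs[h <-]; rewrite /nu [RHS](reindex_inj (mulgI h)).
    by apply: eq_bigr => g _; rewrite /U galMx.
  have -> : nu ^+ p = \prod_(r <- rs) nu by rewrite big_const_seq iter_mulr_1 count_predT.
  transitivity (\prod_(r <- rs) \prod_(g : G) u (g r)).
    by rewrite !big_seq; apply: eq_bigr => r /nuE.
  rewrite exchange_big big1 // => g _.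
  by rewrite -(big_map g predT u) (perm_big _ (gal_perm uniq_rs (@gal_rs g))).
have fix_inv (g : G) : ((g^-1)%g lam == lam) = (g lam == lam).
  by rewrite -(inj_eq (fmorph_inj g)) /= galVK eq_sym.
have -> : \prod_(g : G) U g ^ beta ((g^-1)%g lam) = u lam ^+ (p * (p * St)).
  transitivity ((\prod_(g : G) U g ^ (g lam == lam)%:Z) ^+ p ^+ p / nu ^+ p).
    rewrite -!prodrXl -prodfV -big_split; apply: eq_bigr => g _ /=.
    have -> : beta ((g^-1)%g lam) = (g lam == lam)%:Z * p%:Z * p%:Z - p%:Z.
      by rewrite /beta fix_inv; ring.
    by rewrite expfzDr ?(nz_ug g) // -invr_expz -!exprz_exp.
  rewrite nu_p divr1 -exprM.
  have -> : \prod_(g : G) U g ^ (g lam == lam)%:Z = u lam ^+ St.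
    rewrite -prodr_const [RHS]big_mkcond /=; apply: eq_bigr => g _.
    by rewrite inE /U; case: eqP => [->|_]; rewrite ?expr1z ?expr0z.
  by rewrite -exprM mulnC mulnA.
by case: (N) N_gt0 => // k _; rewrite -exprnP -exprM mulnC.
Qed.
End TorusElement.

Lemma meval_map_rmorph (R S : comNzRingType) (h : {rmorphism R -> S}) m
    (f : {mpoly R[m]}) (v : 'I_m -> R) (w : 'I_m -> S) :
  (forall i, w i = h (v i)) -> (map_mpoly h f).@[w] = h f.@[v].
Proof.
move=> wv.
have -> : map_mpoly h f = \sum_(k <- msupp f) h f@_k *: 'X_[k].
  rewrite {1}[f]mpolyE (big_morph (map_mpoly h) (mmapD _ _) (mmap0 _ _)).
  by apply: eq_bigr => k _; rewrite map_mpolyZ map_mpolyX.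
rewrite [in RHS]mevalE !rmorph_sum.
apply: eq_bigr => k _ /=; rewrite mevalZ rmorphM mevalX; congr (_ * _).
rewrite rmorph_prod.
by apply: eq_bigr => i _; rewrite rmorphXn wv.
Qed.

Section RationalTorusMatrix.
Variables (L : splittingFieldType rat) (galL : galois 1 {:L}) (iota : {rmorphism L -> algC}).
Local Notation G := (gal_of {:L}).
Variables (n' : nat) (s : 'M[rat]_n'.+1) (rs : seq L).
Local Notation n := n'.+1.
Local Notation toL := (map_mx (in_alg L)).
Hypothesis Ds : char_poly (toL s) = \prod_(r <- rs) ('X - r%:P).
Let Lam := undup rs.
Hypothesis nz_Lam : forall z, z \in Lam -> z != 0.

Let gal_Lam (g : G) : perm_eq (map g Lam) Lam.
Proof.
apply: perm_map_stable => [||z]; [exact: fmorph_inj | exact: undup_uniq |].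
by rewrite !mem_undup -!root_prod_XsubC -Ds -map_char_poly gal_root.
Qed.

Let gal_rational (g : G) (M : 'M[rat]_n) : map_mx g (toL M) = toL M.
Proof. by apply/matrixP => i j; rewrite !mxE /= rmorph_alg. Qed.

Let spectral_rational T : (forall (g : G) z, g (T z) = T (g z)) ->
  exists t : 'M[rat]_n, toL t = spectral_fun (toL s) rs T.
Proof.
move=> gT; have inv (g : G) : map_mx g (spectral_fun (toL s) rs T) = spectral_fun (toL s) rs T.
  by apply: (map_spectral_fun (gal_Lam g) erefl (gal_rational g s)) => z _; apply: gT.
have /fin_all_exists[t tP] (ij : 'I_n * 'I_n) : exists a : rat, spectral_fun (toL s) rs T ij.1 ij.2 = a%:A.
  apply: (gal_fixed_rat galL) => g _.
  by rewrite -[in RHS](inv g) mxE.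
by exists (\matrix_(i, j) t (i, j)); apply/matrixP => i j; rewrite (tP (i, j)) [LHS]mxE mxE.
Qed.

(** Both matrices come from spectral_fun, for T and for its inverse. The
    powers of t are combinations of the same projections with coefficients T z
    ^+ k, which are algebraic integers, so that a common denominator of the
    entries of the projections is a common denominator for all powers. *)
Lemma rational_torus_matrix (T : L -> L) :
  (forall z, T z != 0) -> (forall (g : G) z, g (T z) = T (g z)) ->
  (forall e : L -> int, \prod_(z <- Lam) z ^ e z = 1 -> \prod_(z <- Lam) T z ^ e z = 1) ->
  (forall z, iota (T z) \in Aint /\ (iota (T z))^-1 \in Aint) ->
  exists t t' : 'M[rat]_n, [/\ toL t = spectral_fun (toL s) rs T, t * t' = 1,
    forall f : {mpoly rat[n * n]}, (forall j, f.@[fun k => mxvec (s ^+ j) 0 k] = 0) ->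
      f.@[fun k => mxvec t 0 k] = 0
    & exists2 k, (0 < k)%N & int_mx (t ^+ k) /\ int_mx (t' ^+ k)].
Proof.
move=> nz_T gT T_rel T_int.
have pchar0L : [pchar L] =i pred0 by move=> k; rewrite -(fmorph_pchar iota); exact: pchar_num.
have [t Dt] := spectral_rational gT.
have [|t' Dt'] := @spectral_rational (fun z => (T z)^-1).
  by move=> g z; rewrite fmorphV /= gT.
have tt' : t * t' = 1.
  apply: (map_mx_inj (f := in_alg L)); rewrite map_mxM map_mx1 Dt Dt' -/(_ * _).
  rewrite (spectral_funM Ds) -[RHS]/(1 : 'M[L]_n) -(spectral_fun1 Ds); apply: eq_spectral_fun => z _.
  by rewrite mulfV.
exists t, t'; split=> //.
  move=> f f0; apply: (fmorph_inj (in_alg L)); rewrite rmorph0.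
  pose sT k := mxvec (spectral_fun (toL s) rs T) 0 k.
  have sT_t k : sT k = in_alg L (mxvec t 0 k) by rewrite /sT -Dt -map_mxvec mxE.
  rewrite -(meval_map_rmorph f sT_t).
  apply: (zariski_closure_powers pchar0L Ds nz_Lam (fun z _ => nz_T z) T_rel) => j.
  have sj k : mxvec (toL s ^+ j) 0 k = in_alg L (mxvec (s ^+ j) 0 k).
    by rewrite -rmorphXn -map_mxvec mxE.
  by rewrite (meval_map_rmorph f sj) f0 rmorph0.
have [D D_gt0 /allP AD] := Aint_common_denominator
  [seq (z, ab) | z <- Lam, ab <- enum {: 'I_n * 'I_n}]
  (fun zab => iota (spectral_proj (toL s) rs zab.1 zab.2.1 zab.2.2)).
have int_T (S : L -> L) (r : 'M[rat]_n) : (forall z, iota (S z) \in Aint) ->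
    toL r = spectral_fun (toL s) rs S -> forall k, int_mx (D%:~R *: r ^+ k).
  move=> S_int Dr k.
  have entry i j : D%:~R * (r ^+ k) i j \is a Num.int.
    suff : ratr (D%:~R * (r ^+ k) i j) \in Aint.
      by move/(Cint_rat_Aint (Crat_rat _)); rewrite Cint_rat.
    have -> : ratr (D%:~R * (r ^+ k) i j) = iota (D%:~R * (toL r ^+ k) i j).
      by rewrite -rmorphXn !mxE !rmorphM /= !rmorph_int alg_num_field fmorph_rat.
    rewrite Dr (spectral_funX Ds) summxE rmorphM rmorph_sum rmorph_int mulr_sumr /=.
    rewrite big_seq rpred_sum // => z z_L; rewrite mxE rmorphM rmorphXn mulrCA.
    rewrite rpredM ?rpredX //.
    apply: (AD (z, (i, j))); apply: allpairs_f; first exact: z_L.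
    by rewrite mem_enum.
  pose B : 'M[int]_n := \matrix_(i, j) numq (D%:~R * (r ^+ k) i j).
  exists B; apply/matrixP => i j.
  by rewrite !mxE numqK.
have nz_D : D != 0 by rewrite gt_eqF.
apply: (integral_power nz_D tt').
  by apply: int_T Dt => z; have [] := T_int z.
by apply: int_T Dt' => z; rewrite fmorphV; have [] := T_int z.
Qed.
End RationalTorusMatrix.

(** * Arithmetic semidirect products *)

(** There being finitely many cosets, two powers of g with distinct exponents
    lie in the same left coset of H. *)
Lemma finite_index_expg (G : groupType) (H K : set G) (g : G) :
  finite_index H K -> H 1%g -> (forall k, K (g ^+ k)%g) ->
  exists2 m, (0 < m)%N & H (g ^+ m)%g.
Proof.
move=> fin H1 Kg; pose coset x : set G := [set (x * h)%g | h in H]%classic.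
have [i [j [lt_ij eq_ij]]] : exists i j : nat, (i < j)%N /\ coset (g ^+ i)%g = coset (g ^+ j)%g.
  apply: contrapT => inj; apply: infinite_nat.
  rewrite (_ : setT = ((fun k => coset (g ^+ k)%g) @^-1` [set coset x | x in K])%classic).
    apply: finite_preimage fin => i j _ _ eq_ij; apply: contrapT => /eqP ne_ij; apply: inj.
    by move: ne_ij; rewrite neq_ltn => /orP[lt|lt]; [exists i, j | exists j, i].
  by apply/seteqP; split=> // k _ /=; exists (g ^+ k)%g.
have : coset (g ^+ j)%g (g ^+ j)%g by exists 1%g; rewrite ?mulg1.
rewrite -eq_ij => -[h Hh Eh]; exists (j - i)%N; first by rewrite subn_gt0.
have -> : (g ^+ (j - i))%g = h; last by [].
by apply: (mulgI (g ^+ i)%g); rewrite Eh -expgnDr subnKC // ltnW.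
Qed.

Section Arith.
Variables (p' : nat) (A : GL int p'.+1).
Local Notation p := p'.+1.
Local Notation q := (map_poly intr (char_poly A) : {poly rat}).

Lemma hyperbolic_not_unity (R : realType) k : hyperbolic R A -> (0 < k)%N ->
  ~~ (q %| 'X^k - 1).
Proof.
move=> hypA k_gt0; apply/negP => dvd_q.
have [z Az] : exists z, eigenvalue (map_mx intr A : 'M[R[i]]_p) z by apply: eigenvalue_closed.
apply: (hypA z Az); move: Az; rewrite eigenvalue_root_char -map_char_poly => Az.
have : root (map_poly (ratr : rat -> R[i]) ('X^k - 1)) z.
  move: dvd_q; rewrite -(dvdp_map (ratr : {rmorphism rat -> R[i]})) => /root_dvdp; apply.
  by rewrite -map_poly_comp (eq_map_poly (g := intr)) // => c /=; rewrite ratr_int.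
rewrite rmorphB /= map_polyXn rmorph1 rootE !hornerE subr_eq0 => /eqP zk.
apply/eqP; rewrite -(pexpr_eq1 (n := k)) ?normr_ge0 //.
by rewrite -normrX zk normr1.
Qed.

Lemma GL_int_unit_coef0 : q`_0 ^+ 2 = 1.
Proof.
rewrite coef_map /= char_poly_det -rmorphXn exprMn -exprM mulnC exprM sqrrN !expr1n mul1r.
have := GLvalP A; rewrite unitmxE => /divrr; set d := \det A.
move: (d^-1) => e /(congr1 absz); rewrite abszM /= => /eqP.
rewrite muln_eq1 => /andP[/eqP d1 _].
by have [->|->] : d = 1 \/ d = -1 by lia.
Qed.

(** A Bezout relation between q and X^k - 1, evaluated at A, makes A^k - 1
    invertible over the rationals. *)
Lemma expr_sub1_mulmx_inj k (x : 'cV[int]_p) : irreducible_poly q -> ~~ (q %| 'X^k - 1) ->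
  ((A : 'M_p) ^+ k - 1) *m x = 0 -> x = 0.
Proof.
move=> irr_q; rewrite -irreducible_poly_coprime //.
move=> /Bezout_coprimepP[[f g] /=]; rewrite -size_poly_eq1 => /size_poly1P[c nz_c Dc] Ax0.
pose AQ : 'M[rat]_p := map_mx intr A.
have := congr1 (horner_mx AQ) Dc; rewrite rmorphD !rmorphM /= horner_mx_C.
have -> : horner_mx AQ q = 0.
  by rewrite map_char_poly Cayley_Hamilton.
rewrite mulr0 add0r rmorphB rmorphXn /= rmorph1 horner_mx_X => Dg.
have : c%:M *m (map_mx intr x : 'cV[rat]_p) = 0.
  have -> : c%:M = horner_mx AQ g *m map_mx intr ((A : 'M_p) ^+ k - 1).
    by rewrite -Dg rmorphB rmorphXn rmorph1.
  by rewrite -mulmxA -map_mxM Ax0 map_mx0 mulmx0.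
rewrite mul_scalar_mx => /eqP; rewrite scaler_eq0 (negPf nz_c) /= => /eqP x0.
by apply: map_intr_mx_inj; rewrite x0 map_mx0.
Qed.

End Arith.

Lemma monic_dvd_prod_XsubC (F : fieldType) (h : {poly F}) rs : h \is monic ->
  h %| \prod_(r <- rs) ('X - r%:P) -> exists s, h = \prod_(r <- s) ('X - r%:P).
Proof.
move=> mon_h /dvdp_prod_XsubC[m eq_h]; exists (mask m rs).
by apply/eqP; rewrite -eqp_monic ?monic_prod_XsubC.
Qed.

Section Core.
Variables (p' n' : nat) (A : GL int p'.+1).
Local Notation p := p'.+1.
Local Notation n := n'.+1.
Local Notation q := (map_poly intr (char_poly A) : {poly rat}).
Hypotheses (p_pr : prime p) (p_ge5 : (5 <= p)%N).
Hypotheses (irr_q : irreducible_poly q).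
Hypothesis not_unity : forall k, (0 < k)%N -> ~~ (q %| 'X^k - 1).
Variable phi : {multiplicative sdprodZ A -> GL rat n}.
Hypothesis phi_inj : injective phi.

Let ph (x : 'cV[int]_p) (i : int) : 'M[rat]_n := phi ((x, i) : sdprodZ A).

Let phM x i y j : ph x i * ph y j = ph (x + (expgz A i : 'M_p) *m y) (i + j).
Proof. by rewrite /ph -[LHS]/(Defs.GLval (phi _ * phi _)%g) -gmulfM. Qed.

Let ph1 : ph 0 0 = 1.
Proof.
rewrite /ph; set e := phi _; suff -> : e = 1%g by [].
by apply: (mulgI e); rewrite mulg1 -gmulfM; congr (phi _); exact: mulg1.
Qed.

Let ph_conj x i y : ph x i * ph y 0 = ph ((expgz A i : 'M_p) *m y) 0 * ph x i.
Proof. by rewrite !phM addr0 add0r mul1mx addrC. Qed.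

Let expgz_comm i : (expgz A i : 'M_p) *m A = (A : 'M_p) *m expgz A i.
Proof.
have E1 : A = expgz A 1 by rewrite /= expg1.
by rewrite {2 3}E1 -[LHS]/(Defs.GLval (_ * _)%g) -[RHS]/(Defs.GLval (_ * _)%g) -!expgzD addrC.
Qed.

Let expgz_eigen (L : fieldType) (w : 'cV[L]_p) lam i : lam != 0 ->
  map_mx intr A *m w = lam *: w -> map_mx intr (expgz A i) *m w = lam ^ i *: w.
Proof.
move=> nz_lam Aw; have AXw k : map_mx intr (A ^+ k)%g *m w = lam ^+ k *: w.
  elim: k => [|k IH]; first by rewrite expg0 /= map_mx1 mul1mx scale1r.
  by rewrite expgSr /= map_mxM -mulmxA Aw -scalemxAr IH scalerA -exprS.
case: i => k; first exact: AXw.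
have /(congr1 (fun M => map_mx intr M *m w)) : (A ^- k.+1 : GL int p)%g *m (A ^+ k.+1 : GL int p)%g = 1%:M :> 'M[int]_p.
  by rewrite -[LHS]/(Defs.GLval (_ * _)%g) mulVg.
rewrite map_mxM map_mx1 mul1mx -mulmxA AXw -scalemxAr NegzE -invr_expz => Ew.
by rewrite -[in RHS]Ew scalerA mulVf ?scale1r // expf_neq0.
Qed.

(** The last property compares the actions on the matrix v of log_eigenvector:
    phi (z, i) acts by lam ^ i, and t ^+ m by u lam ^+ (M * m). *)
Lemma exists_integral_torus_matrix : exists t t' : 'M[rat]_n,
  [/\ t * t' = 1,
      forall f : {mpoly rat[n * n]},
        (forall u : sdprodZ A, f.@[fun k => mxvec (phi u : 'M_n) 0 k] = 0) ->
        f.@[fun k => mxvec t 0 k] = 0,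
      exists2 k, (0 < k)%N & int_mx (t ^+ k) /\ int_mx (t' ^+ k)
    & forall (m : nat) u, (0 < m)%N -> t ^+ m <> (phi u : 'M_n)].
Proof.
have mon_qZ : char_poly A \is monic := char_poly_monic _.
have mon_q : q \is monic by apply: monic_map.
have sz_q : size q = p.+1.
  by rewrite size_map_inj_poly ?size_char_poly //; exact: intr_inj.
pose s := ph 0 1.
have mon_prod : q * char_poly s \is monic by rewrite monicMl ?char_poly_monic.
have [L [iota [rsA [galL DrsA _]]]] := splitting_number_field mon_prod.
pose f : {rmorphism rat -> L} := in_alg L.
have dvd_factor h : h \is monic -> h %| q * char_poly s ->
    exists rs, map_poly f h = \prod_(r <- rs) ('X - r%:P).
  move=> mon_h dvd_h; apply: (monic_dvd_prod_XsubC (rs := rsA)); first exact: monic_map.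
  by rewrite -DrsA dvdp_map.
have [rq Dq] := dvd_factor q mon_q (dvdp_mulIl _ _).
have [rss] := dvd_factor _ (char_poly_monic s) (dvdp_mulIr _ _).
rewrite map_char_poly => Ds; set sL := map_mx f s in Ds.
have root_rq r : root (map_poly f q) r = (r \in rq) by rewrite Dq root_prod_XsubC.
have uniq_rq : uniq rq := irreducible_roots_uniq irr_q Dq.
have sz_rq : size rq = p.
  by have := size_map_poly f q; rewrite Dq size_prod_XsubC sz_q => -[].
have DqC : map_poly intr (char_poly A) = \prod_(r <- map iota rq) ('X - r%:P).
  rewrite big_map; transitivity (map_poly iota (map_poly f q)).
    rewrite -!map_poly_comp; apply: eq_map_poly => c.
    by rewrite -[RHS]/(iota (f c%:~R)) !rmorph_int.
  by rewrite Dq rmorph_prod; apply: eq_bigr => r _; rewrite rmorphB /= map_polyX map_polyC.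
have [|x [y /=]] := exists_independent_unit irr_q mon_qZ DqC; first by rewrite size_map sz_rq.
pose uC (r : algC) := evalZ x r / evalZ y r => -[nz_y uC_int prod_uC indep_uC].
pose u (r : L) := evalZ x r / evalZ y r.
have iota_u r : iota (u r) = uC (iota r).
  by rewrite rmorphM fmorphV /= !rmorph_evalZ.
have prod_u : \prod_(r <- rq) u r = 1.
  apply: (fmorph_inj iota); rewrite rmorph1 -prod_uC big_map rmorph_prod.
  by apply: eq_bigr => r _; exact: iota_u.
have nz_u r : r \in rq -> u r != 0.
  move=> r_rq; have : \prod_(r <- rq) u r != 0 by rewrite prod_u oner_eq0.
  by rewrite prodf_seq_neq0 => /allP/(_ r r_rq).
have gal_u (g : gal_of {:L}) r : g (u r) = u (g r).
  by rewrite rmorphM fmorphV /= !rmorph_evalZ.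
have gal_rq (g : gal_of {:L}) r : r \in rq -> g r \in rq.
  by rewrite -!root_rq gal_root.
pose lam := rq`_0; have lam_rq : lam \in rq by rewrite mem_nth // sz_rq.
have trans_rq r : r \in rq -> exists g : gal_of {:L}, g lam = r.
  move=> r_rq; have [||g _ <-] := @gal_conjugate L q lam r irr_q; rewrite ?root_rq //.
  by exists g.
pose s' := ph 0 (-1).
have ss' : s * s' = 1 by rewrite phM mulmx0 addr0 subrr ph1.
have nz_lam : lam != 0.
  have := GL_int_unit_coef0 A; apply: contra_eqN => /eqP lam0.
  have : root (map_poly f q) lam by rewrite root_rq.
  rewrite lam0 rootE horner_coef0 coef_map fmorph_eq0 => /eqP ->.
  by rewrite expr0n eq_sym oner_eq0.
have nz_Lam z : z \in undup rss -> z != 0.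
  rewrite mem_undup -root_prod_XsubC -Ds -eigenvalue_root_char => /eigenvalueP[w sw nz_w].
  apply: contraNneq nz_w => z0; rewrite -[w]mulmx1 -(map_mx1 f) -[1%:M]/(1 : 'M_n) -ss'.
  by rewrite map_mxM mulmxA sw z0 scale0r mul0mx.
have indep_rq (e : L -> int) : \prod_(r <- rq) r ^ e r = 1 -> {in rq &, forall r1 r2, e r1 = e r2}.
  exact: (roots_independent iota p_pr irr_q mon_q sz_q (GL_int_unit_coef0 A) not_unity Dq).
have [w nz_w Aw] : exists2 w : 'cV[L]_p, w != 0 & map_mx intr A *m w = lam *: w.
  have : root (char_poly (map_mx intr A : 'M[L]_p)) lam.
    have := lam_rq; rewrite -root_rq -map_poly_comp -map_char_poly.
    by rewrite (eq_map_poly (g := intr)) // => c; rewrite -[LHS]/(f c%:~R) rmorph_int.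
  have -> : char_poly (map_mx intr A : 'M[L]_p) = char_poly ((map_mx intr A)^T : 'M[L]_p).
    by rewrite /char_poly -det_tr; congr (\det _); apply/matrixP => i j; rewrite !mxE eq_sym.
  rewrite -eigenvalue_root_char => /eigenvalueP[w Aw nz_w].
  exists w^T; first by apply: contraNneq nz_w => w0; rewrite -[w]trmxK w0 trmx0.
  by apply: trmx_inj; rewrite trmx_mul trmxK Aw linearZ /= trmxK.
pose tau z := ph z 0.
have tauD z1 z2 : tau (z1 + z2) = tau z1 * tau z2 by rewrite /tau phM addr0 mul1mx.
have tau_inj : injective tau by move=> z1 z2 /val_inj/phi_inj[].
have s_tau z : s * tau z = tau ((A : 'M_p) *m z) * s by rewrite ph_conj /= expg1.
have AA' : (A : 'M_p) *m invmx A = 1%:M by rewrite mulmxV ?GLvalP.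
have B_inj (z : 'cV[int]_p) : ((A : 'M_p) ^+ n`! - 1) *m z = 0 -> z = 0.
  by apply: expr_sub1_mulmx_inj irr_q _; apply: not_unity; exact: fact_gt0.
have [v nz_v v_conj] := log_eigenvector ph1 tauD AA' ss' s_tau tau_inj B_inj f nz_w.
have ph_v z i : map_mx f (ph z i) * v = lam ^ i *: (v * map_mx f (ph z i)).
  apply: (v_conj _ (expgz A i)); last exact: expgz_eigen.
    by move=> z'; rewrite ph_conj.
  exact: expgz_comm.
have s_v : sL * v = lam *: (v * sL) by rewrite ph_v expr1z.
have lam_ratio := eigenvector_ratio Ds nz_v nz_lam s_v.
have gal_Lam (g : gal_of {:L}) z : z \in undup rss -> g z \in undup rss.
  by rewrite !mem_undup -!root_prod_XsubC -Ds -map_char_poly gal_root.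
have [T [M M_gt0 [T_prod gT T_rel T_ratio]]] :=
  galois_torus_element uniq_rq (undup_uniq rss) gal_rq gal_Lam trans_rq nz_Lam nz_u gal_u
    prod_u indep_rq lam_rq lam_ratio.
have u_int r : r \in rq -> forall c : int, iota (u r ^ c) \in Aint.
  move=> r_rq c; rewrite fmorphXz iota_u.
  have [A1 A2] := uC_int (iota r) (map_f iota r_rq).
  by case: c => k; [apply: rpredX | rewrite NegzE -invr_expz -exprVn; apply: rpredX].
have T_int z : iota (T z) \in Aint /\ (iota (T z))^-1 \in Aint.
  have [_ [e ->]] := T_prod z; rewrite -fmorphV -prodfV !rmorph_prod.
  split; rewrite rpred_prod // => g _; first by apply: u_int; apply: gal_rq.
  by rewrite invr_expz; apply: u_int; apply: gal_rq.
have [t [t' [Dt tt' t_zar t_int]]] :=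
  rational_torus_matrix galL Ds nz_Lam (fun z => (T_prod z).1) gT T_rel T_int.
exists t, t'; split=> //.
  move=> h h0; apply: t_zar => j.
  have -> : s ^+ j = phi ((0, j%:Z) : sdprodZ A).
    elim: j => [|j IH]; first by rewrite expr0 -ph1.
    by rewrite exprSr IH -/(ph 0 j) phM mulmx0 addr0 addrC -intS.
  exact: h0.
move=> m [z i] m_gt0 tm.
pose tL := map_mx f t.
have tL_v : tL * v = (u lam ^+ M) *: (v * tL).
  by rewrite /tL Dt; apply: (spectral_fun_conj Ds nz_lam s_v).
have tLm_v : tL ^+ m * v = (u lam ^+ M) ^+ m *: (v * tL ^+ m).
  elim: (m) => [|k IH]; first by rewrite !expr0 scale1r mul1r mulr1.
  by rewrite exprSr -mulrA tL_v -scalerAr mulrA IH -scalerAl scalerA -exprS -mulrA -exprSr.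
have nz_vt : v * tL ^+ m != 0.
  apply: contraNneq nz_v => vt0; rewrite -[v]mulr1.
  have <- : tL ^+ m * map_mx f t' ^+ m = 1.
    have E1 : tL * map_mx f t' = 1 by rewrite -[LHS]map_mxM [t *m t']tt' map_mx1.
    have E2 : map_mx f t' * tL = 1 by apply: mulmx1C.
    by rewrite -exprMn_comm ?E1 ?expr1n // /GRing.comm E1 E2.
  by rewrite mulrA vt0 mul0r.
have lam_u : u lam ^+ (M * m) = lam ^ i.
  have Dtm : tL ^+ m = map_mx f (ph z i) by rewrite -rmorphXn /= tm.
  have := ph_v z i; rewrite -Dtm tLm_v => /eqP; rewrite -subr_eq0 -scalerBl.
  by rewrite scaler_eq0 (negPf nz_vt) orbF subr_eq0 exprM => /eqP.
apply: (indep_uC (M * m)%N i); first by rewrite muln_gt0 M_gt0.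
move=> _ /mapP[r r_rq ->]; have [g <-] := trans_rq r r_rq.
have u_g : u (g lam) ^+ (M * m) = (g lam) ^ i.
  by rewrite -gal_u -rmorphXn lam_u; exact: fmorphXz.
by rewrite -[_ / _]/(uC _) -iota_u -rmorphXn u_g; exact: fmorphXz.
Qed.
End Core.

Lemma GLmap1 (R S : comUnitRingType) (f : {rmorphism R -> S}) n : GLmap f (1%g : GL R n) = 1%g.
Proof. by apply: val_inj; rewrite /= map_mx1. Qed.

Lemma GLmapM (R S : comUnitRingType) (f : {rmorphism R -> S}) n (g h : GL R n) :
  GLmap f (g * h)%g = (GLmap f g * GLmap f h)%g.
Proof. by apply: val_inj; rewrite /= map_mxM. Qed.

Lemma zero_locus_rational (R : realType) n (I : set {mpoly rat[n * n]}) (g : GL rat n) :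
  zero_locus I (GLmap (ratr : {rmorphism rat -> R[i]}) g) <->
  forall f, I f -> f.@[fun k => mxvec (g : 'M_n) 0 k] = 0.
Proof.
have E (f : {mpoly rat[n * n]}) :
    (map_mpoly (ratr : {rmorphism rat -> R[i]}) f).@[fun k =>
      mxvec (GLmap (ratr : {rmorphism rat -> R[i]}) g : 'M_n) 0 k] =
    ratr f.@[fun k => mxvec (g : 'M_n) 0 k].
  by apply: meval_map_rmorph => k; rewrite /= -map_mxvec mxE.
split=> g0 f If; last by rewrite E g0 ?rmorph0.
by apply: (fmorph_inj (ratr : {rmorphism rat -> R[i]})); rewrite rmorph0; apply: etrans (esym (E f)) (g0 f If).
Qed.

Theorem theorem4 (R : realType) (p : nat) (p_prime : prime p)
    (p_ge5 : (5 <= p)%N) :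
  ~ exists A : GL int p,
      [/\ hyperbolic R A, irreducible_GLZ A & arithmetic R (sdprodZ A)].
Proof.
case: p p_prime p_ge5 => // p' p_prime p_ge5.
move=> [A [hypA irrA [n [G [phi [[[G1 GM GV] [I DG]] phi_inj phiG [_ fin]]]]]]].
case: n => [|n'] in G phi G1 GM GV I DG phi_inj phiG fin *.
  have /phi_inj // : phi ((0, 0) : sdprodZ A) = phi ((0, 1) : sdprodZ A).
  by apply: val_inj; apply/matrixP => -[].
have not_unity k : (0 < k)%N -> ~~ (map_poly intr (char_poly A) %| ('X^k - 1 : {poly rat})).
  exact: hyperbolic_not_unity hypA.
have [t [t' [tt' t_zar [k k_gt0 [[B DB] [B' DB']]] no_phi]]] :=
  exists_integral_torus_matrix p_prime p_ge5 irrA not_unity phi_inj.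
have t_unit : t \in unitmx by case: (mulmx1_unit tt').
pose tG : GL rat n'.+1 := MkGL t t_unit.
have GtG : Qpoints G tG.
  rewrite /Qpoints /= DG; apply/zero_locus_rational => f If; apply: t_zar => u.
  have : Qpoints G (phi u) by apply: phiG; exists u.
  by rewrite /Qpoints /= DG => /zero_locus_rational; apply.
have Gpow m : Qpoints G (tG ^+ m)%g.
  by elim: m => [|m IH]; rewrite /Qpoints /= ?expg0 ?GLmap1 // expgSr GLmapM; apply: GM.
have tGX m : (tG ^+ m)%g = t ^+ m :> 'M_n'.+1.
  by elim: m => [|m IH] //; rewrite expgSr exprSr -IH.
have BB' : B *m B' = 1%:M.
  apply: map_intr_mx_inj; rewrite map_mxM -DB -DB' map_mx1.
  by rewrite -[LHS]/(_ * _) -exprMn_comm ?tt' ?expr1n // /GRing.comm tt'; apply/esym/mulmx1C.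
have B_unit : B \in unitmx by case: (mulmx1_unit BB').
pose BG : GL int n'.+1 := MkGL B B_unit.
have phi1 : phi 1%g = 1%g by apply: (mulgI (phi 1%g)); rewrite mulg1 -gmulfM mulg1.
have ZX m : Zpoints G ((tG ^+ k) ^+ m)%g.
  split; first by rewrite -expgnA.
  elim: m => [|m [C _ DC]]; first by exists 1%g => //; rewrite expg0 GLmap1.
  exists (C * BG)%g => //; rewrite GLmapM DC expgSr; congr (_ * _)%g.
  by apply: val_inj; rewrite /= tGX DB.
have [|m m_gt0] := finite_index_expg (g := (tG ^+ k)%g) fin _ ZX.
  by split; [exists 1%g | have := ZX 0%N].
rewrite -expgnA => -[[u _ Du] _].
apply: (no_phi (k * m)%N u); first by rewrite muln_gt0 k_gt0.
by rewrite Du tGX.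
Qed.
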